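(* (Odd Littlewood–Richardson rule.) For all partitions $\lambda,\mu$, the odd Schur functions satisfy, in $\mathsf{OSym}$, $$s_\lambda s_\mu=\sum_\nu oc_{\lambda\mu}^\nu s_\nu,$$ where the sum is over partitions $\nu$ and $$oc_{\lambda\mu}^\nu=\sum_{\substack{S\in\mathrm{SYT}(\nu/\lambda)\\ \mathrm{rect}(S)=T_\mu}}(-1)^{\mathrm{inv}((T_\lambda)_S)}\ \text{ if }\lambda\subset\nu,\qquad oc_{\lambda\mu}^\nu=0\ \text{ otherwise.}$$
   Context: **Odd (quasi)symmetric functions.** Let $k$ be a commutative ring with unity and $A_{-1}=k\langle\langle x_1,x_2,\dots\rangle\rangle/(x_ix_j+x_jx_i,\ i>j)$. For a composition $\alpha=(\alpha_1,\dots,\alpha_r)$, $M_\alpha=\sum_{i_1<\cdots<i_r}x_{i_1}^{\alpha_1}\cdots x_{i_r}^{\alpha_r}$, and $F_\alpha=\sum_{\beta}M_\beta$ over all refinements $\beta$ of $\alpha$ (including $\alpha$). $\mathsf{OSym}$ is the subalgebra of $A_{-1}$ generated by $h_n=\sum_{i_1\le\cdots\le i_n}x_{i_1}\cdots x_{i_n}$, $n\ge1$. **Odd Schur functions.** For a permutation $w\in\mathfrak{S}_n$, $\ell(w)$ is its number of inversions, $c(w)=(s_1,s_2-s_1,\dots,n-s_{r-1})$ where $s_1<\cdots<s_{r-1}$ are the descents $\{i:w(i)>w(i+1)\}$, and $P(w)$ is its Schensted row-insertion tableau. For a standard Young tableau $T$ put $\varsigma_T=\sum_{P(w)=T}(-1)^{\ell(w)}F_{c(w)}\in\mathsf{OSym}$.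 For a partition $\lambda$ the odd Schur function is $s_\lambda:=\varsigma_{T_\lambda}$. **Tableaux** (English convention; $(i,j)$ is the box in row $i$, column $j$, rows counted from top). $\mathrm{SYT}(\nu/\lambda)$ is the set of standard tableaux of skew shape $\nu/\lambda$. For a tableau $T$ of shape $\lambda$, $\mathrm{inv}(T)$ is the number of pairs of boxes $((i,j),(i',j'))$ with $i<i'$ and $T(i,j)\ge T(i',j')$. $T_\lambda$ is the unique standard tableau of shape $\lambda$ with $\mathrm{inv}(T_\lambda)=0$ (filled row by row). $\mathrm{rect}(S)$ is the rectification of $S$ by Schützenberger slides (jeu de taquin). For $T\in\mathrm{SYT}(\lambda)$ and $S\in\mathrm{SYT}(\nu/\lambda)$, $(T)_S$ is the standard tableau of shape $\nu$ obtained by adding $|\lambda|$ to all entries of $S$ and placing $T$ in the inner shape $\lambda$. *)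

(* Defs.v *)
From HB Require Import structures.
From mathcomp Require Import all_boot all_order all_algebra perm.
From mathcomp Require Import boolp classical_sets functions fsbigop.

Set Implicit Arguments.
Unset Strict Implicit.
Unset Printing Implicit Defensive.

Import GRing.Theory.
Local Open Scope ring_scope.

(* [k<<x_1, x_2, ...>>]: the coefficient function on words in the variables;
   the letter [i : nat] stands for the variable [x_{i+1}]. *)
Definition ncseries (k : comPzRingType) : Type := seq nat -> k.

HB.instance Definition _ (k : comPzRingType) :=
  GRing.Lmodule.copy (ncseries k) (seq nat -> k^o).

Section NCSeries.
Variable k : comPzRingType.
Implicit Types f g h : ncseries k.

Definition ncone : ncseries k := fun w => (w == [::])%:R.

Definition ncmul f g : ncseries k :=
  fun w => \sum_(i < (size w).+1) f (take i w) * g (drop i w).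

Definition ncshift (x : nat) f : ncseries k := fun w => f (x :: w).

Lemma ncmul_nil f g : ncmul f g [::] = f [::] * g [::].
Proof. by rewrite /ncmul big_ord1. Qed.

Lemma ncmul_cons f g x w :
  ncmul f g (x :: w) = f [::] * g (x :: w) + ncmul (ncshift x f) g w.
Proof. by rewrite /ncmul /= big_ord_recl. Qed.

Lemma ncmulDl : left_distributive ncmul +%R.
Proof.
move=> f g h; apply/funext => w; rewrite /ncmul -[RHS]big_split /=.
by apply: eq_bigr => i _; rewrite -mulrDl.
Qed.

Lemma ncmulDr : right_distributive ncmul +%R.
Proof.
move=> f g h; apply/funext => w; rewrite /ncmul -[RHS]big_split /=.
by apply: eq_bigr => i _; rewrite -mulrDr.
Qed.

Lemma ncscaleAl (c : k) f g : c *: ncmul f g = ncmul (c *: f) g.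
Proof.
apply/funext => w; rewrite /ncmul [LHS]mulr_sumr.
by apply: eq_bigr => i _; rewrite mulrA.
Qed.

Lemma ncscaleAr (c : k) f g : c *: ncmul f g = ncmul f (c *: g).
Proof.
apply/funext => w; rewrite /ncmul [LHS]mulr_sumr.
by apply: eq_bigr => i _; rewrite mulrCA.
Qed.

Lemma ncmulA : associative ncmul.
Proof.
move=> f g h; apply/funext => w; elim: w f g h => [|x w IHw] f g h.
  by rewrite !ncmul_nil mulrA.
rewrite !ncmul_cons IHw ncmul_nil mulrDr mulrA -addrA; congr (_ + _).
have -> : ncshift x (ncmul f g)
          = f [::] *: ncshift x g + ncmul (ncshift x f) g.
  by apply/funext => u; rewrite {1}/ncshift ncmul_cons.
by rewrite ncmulDl -ncscaleAl.
Qed.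

Lemma ncmul1l : left_id ncone ncmul.
Proof.
move=> f; apply/funext => -[|x w]; first by rewrite ncmul_nil mul1r.
rewrite ncmul_cons /ncone eqxx mul1r -[RHS]addr0; congr (_ + _).
by rewrite /ncmul big1 // => i _; rewrite mul0r.
Qed.

Lemma ncmul1r : right_id ncone ncmul.
Proof.
move=> f; apply/funext => w; elim: w f => [|x w IHw] f.
  by rewrite ncmul_nil mulr1.
by rewrite ncmul_cons IHw /ncone mulr0 add0r.
Qed.

HB.instance Definition _ := GRing.Zmodule_isPzRing.Build (ncseries k)
  ncmulA ncmul1l ncmul1r ncmulDl ncmulDr.

Definition ncvar (i : nat) : ncseries k := fun w => (w == [:: i])%:R.

(* Coefficientwise sum of a family of series; meaningful when every word has a
   nonzero coefficient in only finitely many members of the family. *)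
Definition ncsum (I : choiceType) (D : set I) (F : I -> ncseries k) :
    ncseries k :=
  fun w => \sum_(i \in D) F i w.

Definition anticomm_ideal f : Prop :=
  exists2 s : seq (ncseries k * (nat * nat) * ncseries k),
    all (fun t => t.1.2.2 < t.1.2.1)%N s &
    f = \sum_(t <- s) t.1.1
          * (ncvar t.1.2.1 * ncvar t.1.2.2 + ncvar t.1.2.2 * ncvar t.1.2.1)
          * t.2.

(* Closure of the ideal for coefficientwise convergence.  In a power series ring
   the ideal of relations has to be closed: already [h_1 ^+ 2 = M_(2)] needs
   the infinite sum of all the generators to be zero. *)
Definition anticomm_closure f : Prop :=
  forall W : seq (seq nat),
    exists2 g, anticomm_ideal g & {in W, forall w, f w = g w}.

Definition anticomm : {pred ncseries k} := fun f => `[< anticomm_closure f >].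

Lemma anticommP f : reflect (anticomm_closure f) (f \in anticomm).
Proof. exact: asboolP. Qed.

Lemma anticomm_ideal0 : anticomm_ideal 0.
Proof. by exists [::] => //; rewrite big_nil. Qed.

Lemma anticomm_idealD f g :
  anticomm_ideal f -> anticomm_ideal g -> anticomm_ideal (f + g).
Proof.
move=> [s sP ->] [t tP ->]; exists (s ++ t); first by rewrite all_cat sP.
by rewrite big_cat.
Qed.

Lemma anticomm_idealMl f g : anticomm_ideal g -> anticomm_ideal (f * g).
Proof.
move=> [s sP ->]; exists [seq (f * t.1.1, t.1.2, t.2) | t <- s].
  by rewrite all_map.
by rewrite big_map mulr_sumr; apply: eq_bigr => t _; rewrite !mulrA.
Qed.

Lemma anticomm_idealMr f g : anticomm_ideal g -> anticomm_ideal (g * f).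
Proof.
move=> [s sP ->]; exists [seq (t.1.1, t.1.2, t.2 * f) | t <- s].
  by rewrite all_map.
by rewrite big_map mulr_suml; apply: eq_bigr => t _; rewrite !mulrA.
Qed.

Lemma anticomm_zmod : zmod_closed anticomm.
Proof.
split=> [|f g /anticommP fP /anticommP gP]; apply/anticommP => W.
  by exists 0 => //; apply: anticomm_ideal0.
have [f' f'P ff'] := fP W; have [g' g'P gg'] := gP W.
exists (f' - g') => [|w wW].
  by rewrite -mulN1r; apply/anticomm_idealD/anticomm_idealMl.
by rewrite -[LHS]/(f w - g w) ff' // gg'.
Qed.

HB.instance Definition _ := GRing.isZmodClosed.Build _ anticomm anticomm_zmod.

Lemma anticommMl f g : g \in anticomm -> f * g \in anticomm.
Proof.
move=> /anticommP gP; apply/anticommP => W.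
have [g' g'P gg'] := gP [seq drop i w | w <- W, i <- iota 0 (size w).+1].
exists (f * g') => [|w wW]; first exact: anticomm_idealMl.
apply: eq_bigr => i _; rewrite gg' //; apply/allpairsPdep.
by exists w, (i : nat); split=> //; rewrite mem_iota /=.
Qed.

Lemma anticommMr f g : g \in anticomm -> g * f \in anticomm.
Proof.
move=> /anticommP gP; apply/anticommP => W.
have [g' g'P gg'] := gP [seq take i w | w <- W, i <- iota 0 (size w).+1].
exists (g' * f) => [|w wW]; first exact: anticomm_idealMr.
apply: eq_bigr => i _; rewrite gg' //; apply/allpairsPdep.
by exists w, (i : nat); split=> //; rewrite mem_iota /=.
Qed.

End NCSeries.

Local Open Scope quotient_scope.

(* [A_{-1}] *)
Definition oddser (k : comPzRingType) : Type := Quotient.quot (@anticomm k).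

HB.instance Definition _ (k : comPzRingType) :=
  GRing.Zmodule.on (oddser k).

Section OddSeries.
Variable k : comPzRingType.
Implicit Types f g : ncseries k.

Definition oddpi (f : ncseries k) : oddser k :=
  \pi_(Quotient.quot (@anticomm k)) f.
Definition oddrepr (a : oddser k) : ncseries k :=
  repr (a : Quotient.quot (@anticomm k)).

Lemma oddreprK : cancel oddrepr oddpi.
Proof. exact: reprK. Qed.

Lemma oddpi_eq f g : (oddpi f = oddpi g) <-> (f - g \in @anticomm k).
Proof. by rewrite Quotient.idealrBE; split=> [e|/eqP //]; apply/eqP. Qed.

Lemma oddpiB : {morph oddpi : f g / f - g}.
Proof. exact: (raddfB \pi_(Quotient.quot (@anticomm k))). Qed.

Lemma oddpiD : {morph oddpi : f g / f + g}.
Proof. exact: (raddfD \pi_(Quotient.quot (@anticomm k))). Qed.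

Lemma oddrepr_pi f : oddrepr (oddpi f) - f \in @anticomm k.
Proof. by apply/oddpi_eq; rewrite oddreprK. Qed.

Definition oddone : oddser k := oddpi 1.
Definition oddmul (a b : oddser k) : oddser k := oddpi (oddrepr a * oddrepr b).
Definition oddscale (c : k) (a : oddser k) : oddser k := oddpi (c *: oddrepr a).

Lemma oddpiM f g : oddpi (f * g) = oddmul (oddpi f) (oddpi g).
Proof.
apply/esym/oddpi_eq; set f' := oddrepr _; set g' := oddrepr _.
rewrite -[f' * g'](subrK (f * g')) -addrA -mulrBl -mulrBr.
by apply: rpredD; [apply: anticommMr | apply: anticommMl]; apply: oddrepr_pi.
Qed.

Lemma oddpiZ c f : oddpi (c *: f) = oddscale c (oddpi f).
Proof.
apply/esym/oddpi_eq; rewrite -scalerBr -[X in _ *: X]mul1r.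
rewrite -[_ *: _]/(c *: ncmul _ _) ncscaleAl.
exact: anticommMl (oddrepr_pi f).
Qed.

Lemma oddmulA : associative oddmul.
Proof.
move=> a b c; rewrite -[a]oddreprK -[b]oddreprK -[c]oddreprK.
by rewrite -!oddpiM mulrA.
Qed.

Lemma oddmul1l : left_id oddone oddmul.
Proof. by move=> a; rewrite -[a]oddreprK -oddpiM mul1r. Qed.

Lemma oddmul1r : right_id oddone oddmul.
Proof. by move=> a; rewrite -[a]oddreprK -oddpiM mulr1. Qed.

Lemma oddmulDl : left_distributive oddmul +%R.
Proof.
move=> a b c; rewrite -[a]oddreprK -[b]oddreprK -[c]oddreprK.
by rewrite -!(oddpiD, oddpiM) mulrDl.
Qed.

Lemma oddmulDr : right_distributive oddmul +%R.
Proof.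
move=> a b c; rewrite -[a]oddreprK -[b]oddreprK -[c]oddreprK.
by rewrite -!(oddpiD, oddpiM) mulrDr.
Qed.

HB.instance Definition _ := GRing.Zmodule_isPzRing.Build (oddser k)
  oddmulA oddmul1l oddmul1r oddmulDl oddmulDr.

Lemma oddscaleA c d a : oddscale c (oddscale d a) = oddscale (c * d) a.
Proof. by rewrite -[a]oddreprK -!oddpiZ scalerA. Qed.

Lemma oddscale1 : left_id 1 oddscale.
Proof. by move=> a; rewrite -[a]oddreprK -oddpiZ scale1r. Qed.

Lemma oddscaleDr : right_distributive oddscale +%R.
Proof.
move=> c a b; rewrite -[a]oddreprK -[b]oddreprK.
by rewrite -!(oddpiD, oddpiZ) scalerDr.
Qed.

Lemma oddscaleDl a : {morph oddscale^~ a : c d / c + d}.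
Proof.
by move=> c d; rewrite -[a]oddreprK /= -!(oddpiD, oddpiZ) scalerDl.
Qed.

HB.instance Definition _ := GRing.Zmodule_isLmodule.Build k (oddser k)
  oddscaleA oddscale1 oddscaleDr oddscaleDl.

Lemma oddscaleAl (c : k) (a b : oddser k) : c *: (a * b) = (c *: a) * b.
Proof.
have e : c *: (oddrepr a * oddrepr b) = (c *: oddrepr a) * oddrepr b.
  exact: ncscaleAl.
by move/(congr1 oddpi): e; rewrite oddpiZ !oddpiM oddpiZ !oddreprK.
Qed.

Lemma oddscaleAr (c : k) (a b : oddser k) : c *: (a * b) = a * (c *: b).
Proof.
have e : c *: (oddrepr a * oddrepr b) = oddrepr a * (c *: oddrepr b).
  exact: ncscaleAr.
by move/(congr1 oddpi): e; rewrite oddpiZ !oddpiM oddpiZ !oddreprK.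
Qed.

Lemma oddpi_is_zmod_morphism : zmod_morphism oddpi.
Proof. exact: oddpiB. Qed.
HB.instance Definition _ :=
  GRing.isZmodMorphism.Build _ _ oddpi oddpi_is_zmod_morphism.

Lemma oddpi_is_monoid_morphism : monoid_morphism oddpi.
Proof. by split=> // f g; rewrite oddpiM. Qed.
HB.instance Definition _ :=
  GRing.isMonoidMorphism.Build _ _ oddpi oddpi_is_monoid_morphism.

Lemma oddpi_is_scalable : scalable oddpi.
Proof. by move=> c f; rewrite oddpiZ. Qed.
HB.instance Definition _ :=
  GRing.isScalable.Build k _ _ _ oddpi oddpi_is_scalable.

End OddSeries.

(* [b] is a refinement of [a]: a list of nonempty compositions of the successive
   parts of [a], put end to end. *)
Definition refines (b a : seq nat) : Prop :=
  exists g : seq (seq nat),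
    [/\ flatten g = b, [seq sumn c | c <- g] = a & 0%N \notin b].

Section QSym.
Variable k : comPzRingType.
Local Open Scope classical_set_scope.

Definition monomialM (a : seq nat) : oddser k :=
  oddpi (ncsum [set i : seq nat | size i = size a /\ sorted ltn i]
          (fun i => \prod_(p <- zip i a) ncvar k p.1 ^+ p.2)).

Definition fundamentalF (a : seq nat) : oddser k :=
  \sum_(b \in [set b | refines b a]) monomialM b.

Definition completeh (n : nat) : oddser k :=
  oddpi (ncsum [set i : seq nat | size i = n /\ sorted leq i]
          (fun i => \prod_(j <- i) ncvar k j)).

(* [GRing.subalg_closed] is spelled out because the library only provides it
   for nontrivial rings. *)
Definition OSym (a : oddser k) : Prop :=
  forall B : {pred oddser k},
    [/\ 1 \in B, GRing.linear_closed B & GRing.mulr_2closed B] ->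
    (forall n, (0 < n)%N -> completeh n \in B) -> a \in B.

End QSym.

Definition is_part (s : seq nat) : bool := sorted geq s && (0%N \notin s).

Record intpart := IntPart { parts :> seq nat; _ : is_part parts }.
HB.instance Definition _ := [isSub for parts].
HB.instance Definition _ := [Choice of intpart by <:].

Definition part (la : seq nat) (i : nat) : nat := nth 0%N la i.

Definition included (la nu : seq nat) : Prop :=
  forall i, (part la i <= part nu i)%N.

(* Boxes are numbered from 0, so [(i, j)] is in row [i + 1] and column [j + 1].
   The boxes of a straight shape [nu] are [boxes nu [::]]. *)
Definition boxes (nu la : seq nat) : seq (nat * nat) :=
  [seq (i, j) | i <- iota 0 (size nu),
                j <- iota (part la i) (part nu i - part la i)].

(* The entry in each box, with 0 for "no entry". *)
Definition filling := nat -> nat -> nat.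

Record is_SYT (nu la : seq nat) (T : filling) : Prop := IsSYT {
  SYT_out : forall i j, (i, j) \notin boxes nu la -> T i j = 0%N;
  SYT_std : perm_eq [seq T b.1 b.2 | b <- boxes nu la]
                    (iota 1 (size (boxes nu la)));
  SYT_row : forall i j, (i, j) \in boxes nu la -> (i, j.+1) \in boxes nu la ->
              (T i j < T i j.+1)%N;
  SYT_col : forall i j, (i, j) \in boxes nu la -> (i.+1, j) \in boxes nu la ->
              (T i j < T i.+1 j)%N
}.

Definition tabinv (nu : seq nat) (T : filling) : nat :=
  count (fun p => (p.1.1 < p.2.1) && (T p.2.1 p.2.2 <= T p.1.1 p.1.2))%N
    [seq (b, c) | b <- boxes nu [::], c <- boxes nu [::]].

(* [T_la] *)
Definition rowtab (la : seq nat) : filling :=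
  fun i j => if (j < part la i)%N then (sumn (take i la) + j).+1 else 0%N.

(* [(T)_S] *)
Definition gluetab (la nu : seq nat) (T S : filling) : filling :=
  fun i j => if (i, j) \in boxes la [::] then T i j
             else if (i, j) \in boxes nu la then (S i j + sumn la)%N
             else 0%N.

Fixpoint rowins (x : nat) (t : seq (seq nat)) : seq (seq nat) :=
  if t is r :: t' then
    let j := find (ltn x) r in
    if (j < size r)%N then set_nth 0%N r j x :: rowins (nth 0%N r j) t'
    else rcons r x :: t'
  else [:: [:: x]].

Section Permutations.
Variables (n : nat) (w : 'S_n).

Definition permword : seq nat := [seq (w i).+1 | i <- enum 'I_n].

Definition permlen : nat :=
  #|[set p : 'I_n * 'I_n | (p.1 < p.2)%N && (w p.2 < w p.1)%N]|.

(* [s_1, ..., s_{r-1}, n]; empty if [n = 0]. *)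
Definition runends : seq nat :=
  [seq i <- iota 1 n |
     (i == n) || (nth 0 permword i < nth 0 permword i.-1)%N].

Definition desccomp : seq nat :=
  pairmap (fun s t => t - s)%N 0%N runends.

Definition Ptab : filling :=
  let t := foldl (fun t x => rowins x t) [::] permword in
  fun i j => nth 0%N (nth [::] t i) j.

End Permutations.

Definition setbox (T : filling) (i j x : nat) : filling :=
  fun i' j' => if (i' == i) && (j' == j) then x else T i' j'.

(* [slide i j T U]: sliding into the empty box [(i, j)] of [T] yields [U]. *)
Inductive slide : nat -> nat -> filling -> filling -> Prop :=
| slide_stop i j T of T i j.+1 = 0%N & T i.+1 j = 0%N : slide i j T T
| slide_right i j T U of
    (0 < T i j.+1)%N & T i.+1 j = 0%N \/ (T i j.+1 < T i.+1 j)%N &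
    slide i j.+1 (setbox (setbox T i j (T i j.+1)) i j.+1 0) U :
    slide i j T U
| slide_down i j T U of
    (0 < T i.+1 j)%N & T i j.+1 = 0%N \/ (T i.+1 j < T i j.+1)%N &
    slide i.+1 j (setbox (setbox T i j (T i.+1 j)) i.+1 j 0) U :
    slide i j T U.

(* [rectifies la S U]: [rect S = U], for [S] of some skew shape [nu / la].  Each
   step slides into a corner of the current inner shape, here the last box of
   row [i]; the outcome does not depend on the choice of the corners. *)
Inductive rectifies : intpart -> filling -> filling -> Prop :=
| rect_done (la : intpart) S of parts la = [::] : rectifies la S S
| rect_step (la la' : intpart) i S S' U of
    (part la i.+1 < part la i)%N &
    (forall r, part la' r = (part la r - (r == i))%N) &
    slide i (part la i).-1 S S' & rectifies la' S' U :
    rectifies la S U.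

Section OddSchur.
Variable k : comPzRingType.

(* [varsigma_T] for a standard tableau [T] with [n] boxes. *)
Definition oddvarsigma (n : nat) (T : filling) : oddser k :=
  \sum_(w : 'S_n | `[< Ptab w = T >])
    (-1) ^+ permlen w * fundamentalF k (desccomp w).

Definition oddschur (la : intpart) : oddser k :=
  oddvarsigma (sumn la) (rowtab la).

End OddSchur.

Definition LRtableaux (la mu nu : intpart) : set filling :=
  [set S | is_SYT nu la S /\ rectifies la S (rowtab mu)]%classic.

(* [oc_{la mu}^nu] *)
Definition oddLR (la mu nu : intpart) : int :=
  if `[< included la nu >] then
    \sum_(S \in LRtableaux la mu nu)
      (-1 : int) ^+ tabinv nu (gluetab la nu (rowtab la) S)
  else 0.

(* Main.v *)
Require Import Defs.
From HB Require Import structures.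
From mathcomp Require Import all_boot all_order all_algebra perm zify.
From mathcomp Require Import boolp classical_sets functions fsbigop.

Set Implicit Arguments.
Unset Strict Implicit.
Unset Printing Implicit Defensive.

Import GRing.Theory.

(** Expand everything in words.  A word [a] in the variables equals, in the
    quotient, [(-1) ^ inv a] times its weakly increasing rearrangement
    ([oddpi_norm]).  Listing the positions of [a] by increasing letter gives a
    permutation [posword a] with as many inversions as [a], and [a] can be
    recovered from this permutation and from the rearrangement.  Hence the
    defining sum of [varsigma_T] is the class of the plain, unsigned sum of all
    the words [a] such that [posword a] inserts to [T] ([vsigE]): the odd signs
    are absorbed by the straightening.

    In this form products are concatenations.  The positions of a concatenation
    [u ++ v], cut at [n = size u], are those of [u] and those of [v], and
    the insertion tableau of a part only depends on that of the whole, because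
    plactic equivalence is compatible with the restriction to an interval of
    letters ([knuth_filter]), insertion is constant on plactic classes
    ([Pword_knuth]) and every word is equivalent to the reading word of its
    insertion tableau ([knuth_Pword]).  Thus
    [varsigma_T1 * varsigma_T2] is the sum of the [varsigma_T] over the standard
    [T] whose entries up to [n] form [T1] and whose other entries rectify to
    [T2] ([vsigM]); slides preserve the plactic class of the reading word
    ([slide_skewf]), which identifies insertion with rectification.

    It remains to compare [varsigma_T] with the odd Schur function of the shape
    of [T].  Bumping through a row with [m] entries changes the number of
    inversions by [m + 1] modulo 2, whatever the letters ([inv_rowins]).  So the
    sign of a permutation is the sign of its insertion tableau times a sign that
    only depends on its recording tableau; its descent composition also depends
    only on the recording tableau ([row_bump]).  As the Robinson-Schensted correspondence is a bijection
    ([RSK_inj], [RSK_surj]), [varsigma_T] is [(-1) ^ inv T] times the odd Schur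
    function ([vsig_rtab]).  Reindexing the product by pairs of a shape and a
    skew tableau gives the rule ([oddschurM_LR]).

    The odd Schur functions lie in [OSym] because the product with a one-row
    function, which is a complete function [h_p], is unitriangular: multiplying
    [s_la] by [h_p] produces [s_(la, p)] with coefficient 1, and shapes with
    fewer rows or a shorter last row ([LRtabs_strip]). *)

(** * Plactic equivalence *)

(** Plactic equivalence of words with distinct letters, whence the strict
    inequalities; the name of a relation lists its first three letters. *)
Inductive knuth : seq nat -> seq nat -> Prop :=
| knuth_refl u : knuth u u
| knuth_sym u v : knuth u v -> knuth v u
| knuth_trans v u w : knuth u v -> knuth v w -> knuth u w
| knuth_yxz p s x y z of x < y & y < z :
    knuth (p ++ [:: y, x, z & s]) (p ++ [:: y, z, x & s])
| knuth_xzy p s x y z of x < y & y < z :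
    knuth (p ++ [:: x, z, y & s]) (p ++ [:: z, x, y & s]).

Lemma knuth_cat2 p s u v : knuth u v -> knuth (p ++ u ++ s) (p ++ v ++ s).
Proof.
elim=> {u v} [u|u v _|v u w _ Huv _|q r x y z xy yz|q r x y z xy yz].
- exact: knuth_refl.
- exact: knuth_sym.
- exact: knuth_trans.
- by rewrite -!catA !(catA p) /=; apply: knuth_yxz.
- by rewrite -!catA !(catA p) /=; apply: knuth_xzy.
Qed.

Lemma knuth_catl p u v : knuth u v -> knuth (p ++ u) (p ++ v).
Proof. by move/(knuth_cat2 p [::]); rewrite !cats0. Qed.

Lemma knuth_catr s u v : knuth u v -> knuth (u ++ s) (v ++ s).
Proof. exact: (knuth_cat2 [::] s). Qed.

Lemma knuth_perm u v : knuth u v -> perm_eq u v.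
Proof.
elim=> {u v} [u|u v _|v u w _ Huv _|q r x y z xy yz|q r x y z xy yz] //.
- by rewrite perm_sym.
- exact: perm_trans.
- by apply/seq.permP => a; rewrite !count_cat /=; lia.
- by apply/seq.permP => a; rewrite !count_cat /=; lia.
Qed.

(** A relation moves [x] past [z] in the presence of an intermediate [y]; if a
    convex [P] keeps both [x] and [z], it keeps the witness [y]. *)
Lemma knuth_filter (P : pred nat) u v :
  (forall x y z, x < y -> y < z -> P x -> P z -> P y) ->
  knuth u v -> knuth (filter P u) (filter P v).
Proof.
move=> Pconv; elim=> {u v} [u|u v _|v u w _ Huv _|q r x y z xy yz|q r x y z xy yz].
- exact: knuth_refl.
- exact: knuth_sym.
- exact: knuth_trans.
- rewrite !filter_cat /=; have := Pconv _ _ _ xy yz.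
  case: (P x); case: (P y); case: (P z) => //=; try (move=> _; exact: knuth_refl).
  + by move=> _; apply: knuth_yxz.
  + by move/(_ isT isT).
- rewrite !filter_cat /=; have := Pconv _ _ _ xy yz.
  case: (P x); case: (P y); case: (P z) => //=; try (move=> _; exact: knuth_refl).
  + by move=> _; apply: knuth_xzy.
  + by move/(_ isT isT).
Qed.

Lemma knuth_map (f : nat -> nat) (P : pred nat) u v :
  {in P &, {homo f : x y / x < y}} -> all P u ->
  knuth u v -> knuth (map f u) (map f v).
Proof.
move=> fP Pu Kuv; elim: Kuv Pu => {u v}
  [u|u v Kuv IH|v u w Kuv IH1 _ IH2|q r x y z xy yz|q r x y z xy yz] Pu.
- exact: knuth_refl.
- by apply: knuth_sym; apply: IH; rewrite (perm_all _ (knuth_perm Kuv)).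
- apply: knuth_trans (IH1 Pu) (IH2 _).
  by rewrite -(perm_all _ (knuth_perm Kuv)).
- rewrite !map_cat /=; move: Pu; rewrite all_cat /= => /and5P[_ Py Px Pz _].
  by apply: knuth_yxz; apply: fP.
- rewrite !map_cat /=; move: Pu; rewrite all_cat /= => /and5P[_ Px Pz Py _].
  by apply: knuth_xzy; apply: fP.
Qed.

(** The letters of [w] that are at most [n]; the other letters are listed by
    [hi], lowered by [n]. *)
Definition lo n (w : seq nat) := [seq x <- w | x <= n].
Definition hi n (w : seq nat) := [seq x - n | x <- w & n < x].

Lemma knuth_lo n u v : knuth u v -> knuth (lo n u) (lo n v).
Proof. by apply: knuth_filter => x y z /=; lia. Qed.

Lemma knuth_hi n u v : knuth u v -> knuth (hi n u) (hi n v).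
Proof.
move=> Kuv; apply: (@knuth_map _ (ltn n)).
- by move=> x y; rewrite !unfold_in /=; lia.
- exact: filter_all.
- by apply: knuth_filter Kuv => x y z /=; lia.
Qed.

(** [pairwise] rather than [sorted] makes a row easy to cut into blocks. *)
Notation isrow := (pairwise ltn).

(** The plactic form of row bumping.  First [x] moves left across [f], the
    witness being the letter on the left of the exchanged pair; then [y] moves
    left across [e], the witness being the letter on its right. *)
Lemma knuth_bump e y f x :
  isrow (e ++ y :: f) -> all (gtn x) e -> x < y ->
  knuth (e ++ y :: f ++ [:: x]) (y :: e ++ x :: f).
Proof.
rewrite pairwise_cat /= allrel_consr => /and3P[_ re /andP[yf rf]] ex xy.
apply: (@knuth_trans (e ++ y :: x :: f)).
  apply: knuth_catl => {e ex re}.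
  elim/last_ind: f yf rf => [|f z IHf] /=; first by move=> *; apply: knuth_refl.
  rewrite all_rcons pairwise_rcons => /andP[/= yz yf] /andP[fz rf].
  rewrite -!cats1 -catA /=.
  apply: knuth_trans (knuth_catr [:: z] (IHf yf rf)); rewrite /= -catA /=.
  case/lastP: f yf fz {IHf rf} => [|f u]; first by move=> _ _; apply: knuth_sym;
    apply: (@knuth_yxz [::] [::]).
  rewrite !all_rcons /= => /andP[yu _] /andP[uz _].
  rewrite -!cats1 -!catA /=.
  by apply: knuth_sym; apply: (@knuth_yxz (y :: f) [::]) => //; apply: ltn_trans yu.
elim/last_ind: e x f ex xy re {yf rf} => [|e z IHe] x f.
  by move=> *; apply: knuth_refl.
rewrite all_rcons pairwise_rcons => /andP[/= zx _] xy /andP[ez re].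
rewrite -!cats1 -!catA /=.
apply: (@knuth_trans (e ++ [:: y, z, x & f])); first exact: knuth_xzy.
exact: IHe (ltn_trans zx xy) re.
Qed.

(** Insertion of [x] in a row: the new row and the bumped letter, as a word of
    length at most 1. *)
Definition rins (x : nat) (r : seq nat) : seq nat * seq nat :=
  let j := find (ltn x) r in
  if j < size r then (set_nth 0 r j x, [:: nth 0 r j]) else (rcons r x, [::]).

(** Insertion of a word in a single row, with the word of the bumped letters.
    A whole tableau is built one row at a time in this way, see
    [insword_rproc]. *)
Fixpoint rproc (r u : seq nat) : seq nat * seq nat :=
  if u is x :: u' then
    let p := rins x r in let q := rproc p.1 u' in (q.1, p.2 ++ q.2)
  else (r, [::]).

Definition insword (t : seq (seq nat)) (u : seq nat) :=
  foldl (fun t x => rowins x t) t u.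

Definition Pword := insword [::].

Lemma rowins_rins x r t :
  rowins x (r :: t) = (rins x r).1 :: insword t (rins x r).2.
Proof. by rewrite /rins /=; case: ifP. Qed.

Lemma insword_cat t u v : insword t (u ++ v) = insword (insword t u) v.
Proof. exact: foldl_cat. Qed.

(** Row [i] only sees the letters bumped from row [i - 1], in their order, so
    that the order of the operations can be exchanged: all the insertions in the
    first row come before those in the other rows. *)
Lemma insword_rproc r t u :
  insword (r :: t) u = (rproc r u).1 :: insword t (rproc r u).2.
Proof.
elim: u r t => [|x u IH] r t //.
rewrite -[LHS]/(insword (rowins x (r :: t)) u) rowins_rins IH /=.
by rewrite insword_cat.
Qed.

Lemma Pword_rproc x u :
  Pword (x :: u) = (rproc [::] (x :: u)).1 :: Pword (rproc [::] (x :: u)).2.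
Proof. exact: (insword_rproc [::] [::] (x :: u)). Qed.

Lemma rins_split x a b : all (gtn x) a -> all (ltn x) b ->
  rins x (a ++ b) = if b is y :: b' then (a ++ x :: b', [:: y]) else (rcons a x, [::]).
Proof.
move=> ax bx; rewrite /rins find_cat.
have -> : has (ltn x) a = false.
  by apply/hasPn => z /(allP ax) /=; lia.
case: b bx => [|y b] /=; first by rewrite addn0 cats0 ltnn.
case/andP=> -> _; rewrite addn0 size_cat /= -[X in X < _]addn0 ltn_add2l /=.
rewrite nth_cat ltnn subnn /=; congr pair.
by elim: a {ax} => //= z a ->.
Qed.

Lemma row_splitP x r : isrow r -> x \notin r ->
  exists a b, [/\ r = a ++ b, all (gtn x) a & all (ltn x) b].
Proof.
elim: r => [|y r IH] /=; first by exists [::], [::].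
rewrite inE negb_or => /andP[yr rr] /andP[xy xr].
have [/ltnW yx|xy'] := ltnP y x; last first.
  exists [::], (y :: r); split => //=.
  have xy'' : x < y by lia.
  by rewrite xy''; apply: sub_all yr => z /=; lia.
have [a [b [-> ax bx]]] := IH rr xr.
by exists (y :: a), b; split => //=; rewrite ax andbT; lia.
Qed.

Lemma rproc_cat r u v :
  rproc r (u ++ v) =
  ((rproc (rproc r u).1 v).1, (rproc r u).2 ++ (rproc (rproc r u).1 v).2).
Proof.
by elim: u r => [|x u IH] r /=; [case: rproc|rewrite IH /= catA].
Qed.

Lemma rins_perm x r : perm_eq ((rins x r).1 ++ (rins x r).2) (x :: r).
Proof.
rewrite /rins; case: ifP => [jr|_] /=; last first.
  by rewrite cats0 -cats1 -cat1s perm_catC.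
apply/seq.permP => a; rewrite -[in RHS](cat_take_drop (find (ltn x) r) r).
rewrite (drop_nth 0) // set_nthE jr !count_cat /= !count_cat /=; lia.
Qed.

Lemma rproc_perm r u : perm_eq ((rproc r u).1 ++ (rproc r u).2) (r ++ u).
Proof.
elim: u r => [|x u IH] r //=; apply/seq.permP => a.
have /seq.permP/(_ a) := IH (rins x r).1; have /seq.permP/(_ a) := rins_perm x r.
rewrite !count_cat /=; lia.
Qed.

Lemma rins_row x r : isrow r -> x \notin r -> isrow (rins x r).1.
Proof.
move=> rr xr; have [a [b [er ax bx]]] := row_splitP rr xr.
move: rr; rewrite er rins_split // pairwise_cat => /and3P[ab ra rb].
case: b {er} ab bx rb => [|y b] /= ab bx rb; first by rewrite pairwise_rcons ax.
move: ab bx rb; rewrite allrel_consr => /andP[_ ab] /andP[xy xb] /andP[_ rb].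
by rewrite pairwise_cat /= allrel_consr ax ab ra xb rb.
Qed.

Lemma rins_uniq x r u : uniq (r ++ x :: u) ->
  [/\ x \notin r, uniq ((rins x r).1 ++ u) & uniq ((rins x r).2 ++ u)].
Proof.
move=> U; have {U} : uniq ((x :: r) ++ u).
  by rewrite (perm_uniq (_ : perm_eq _ (r ++ x :: u))) //=; apply/seq.permP => a;
    rewrite /= !count_cat /=; lia.
move=> U; split; first by move: U; rewrite /= mem_cat negb_or => /andP[/andP[]].
  have: uniq (((rins x r).1 ++ (rins x r).2) ++ u).
    by rewrite (perm_uniq (_ : perm_eq _ ((x :: r) ++ u))) // perm_cat2r rins_perm.
  by apply: subseq_uniq; rewrite -catA; apply: cat_subseq => //; apply: suffix_subseq.
have: uniq (((rins x r).1 ++ (rins x r).2) ++ u).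
  by rewrite (perm_uniq (_ : perm_eq _ ((x :: r) ++ u))) // perm_cat2r rins_perm.
by apply: subseq_uniq; rewrite -catA; apply: suffix_subseq.
Qed.

Lemma rproc_row r u : isrow r -> uniq (r ++ u) -> isrow (rproc r u).1.
Proof.
elim: u r => [|x u IH] r //= rr /rins_uniq[xr U _].
by apply: IH U; apply: rins_row.
Qed.

Lemma rproc_uniq r u : uniq (r ++ u) -> uniq (rproc r u).2.
Proof.
rewrite -(perm_uniq (rproc_perm r u)) cat_uniq => /and3P[_ _ ->] //.
Qed.

Lemma rins_catl x a s : all (gtn x) a ->
  rins x (a ++ s) = (a ++ (rins x s).1, (rins x s).2).
Proof.
move=> ax; have hN : has (ltn x) a = false.
  by apply/hasPn => z /(allP ax) /=; lia.
rewrite /rins find_cat hN size_cat ltn_add2l; case: ifP => _ /=.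
  rewrite nth_cat ltnNge leq_addr /= addKn; congr pair.
  by elim: a {ax hN} => //= y a ->.
by rewrite rcons_cat.
Qed.

Lemma rins_cons_lt x y s : x < y -> rins x (y :: s) = (x :: s, [:: y]).
Proof. by rewrite /rins /= => ->. Qed.

Lemma rins_cons_gt x y s : y < x ->
  rins x (y :: s) = (y :: (rins x s).1, (rins x s).2).
Proof. by move=> yx; rewrite -cat1s rins_catl //= yx. Qed.

Lemma rins_nil x : rins x [::] = ([:: x], [::]). Proof. by []. Qed.

(** The letters [x < y < z] cut the row in four blocks. *)
Lemma row_split3P x y z r : x < y -> y < z -> isrow r -> x \notin r -> y \notin r ->
  z \notin r -> exists a b c d, r = a ++ b ++ c ++ d /\
  [/\ [/\ all (gtn x) a, all (gtn y) a & all (gtn z) a],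
      [/\ all (ltn x) b, all (gtn y) b & all (gtn z) b],
      [/\ all (ltn x) c, all (ltn y) c & all (gtn z) c] &
      [/\ all (ltn x) d, all (ltn y) d & all (ltn z) d] ].
Proof.
move=> xy yz rr xr yr zr.
have [a [s [er ax sx]]] := row_splitP rr xr.
have [rs ys zs] : [/\ isrow s, y \notin s & z \notin s].
  move: rr yr zr; rewrite er pairwise_cat !mem_cat !negb_or.
  by move=> /and3P[_ _ ->] /andP[_ ->] /andP[_ ->].
have [b [t [es bt ty]]] := row_splitP rs ys.
have [rt zt] : isrow t /\ z \notin t.
  move: rs zs; rewrite es pairwise_cat !mem_cat !negb_or.
  by move=> /and3P[_ _ ->] /andP[_ ->].
have [c [d [et cz dz]]] := row_splitP rt zt.
exists a, b, c, d; split; first by rewrite er es et.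
move: sx; rewrite es et !all_cat => /and3P[-> -> ->].
move: ty; rewrite et !all_cat => /andP[-> ->]; rewrite bt cz dz ax.
have xz := ltn_trans xy yz.
by split; split => //; [move: ax|move: ax|move: bt]; apply: sub_all => u /= /ltn_trans;
  apply.
Qed.

Ltac rins_facts := repeat
  match goal with
  | H : is_true (all _ (_ :: _)) |- _ =>
    let H1 := fresh "h" in let H2 := fresh "h" in move: H => /= /andP[H1 H2]
  | H : is_true (pairwise _ (_ :: _)) |- _ =>
    let H1 := fresh "h" in let H2 := fresh "h" in move: H => /= /andP[H1 H2]
  end.

(** One computation step of an insertion in a row given as a concatenation of
    blocks; a block is destructed when its first letter matters. *)
Ltac rins_step :=
  match goal with
  | |- context [rins ?x [::]] => rewrite (rins_nil x) /=
  | H : is_true (all _ ?a) |- context [rins ?x (?a ++ ?s)] =>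
      rewrite (@rins_catl x a s H) /=
  | H : is_true (?x < ?y) |- context [rins ?x (?y :: ?s)] =>
      rewrite (@rins_cons_lt x y s H) /=
  | H : is_true (?y < ?x) |- context [rins ?x (?y :: ?s)] =>
      rewrite (@rins_cons_gt x y s H) /=
  | H : is_true (all _ ?b) |- context [rins ?x (?b ++ ?s)] =>
      is_var b; have _ : all (ltn x) b := H; destruct b; rins_facts;
        rewrite ?cat0s ?cat_cons
  | H : is_true (all _ ?b) |- context [rins ?x ?b] =>
      is_var b; have _ : all (ltn x) b := H; destruct b; rins_facts
  end.

Ltac rproc_compute :=
  repeat rins_step; (split; [reflexivity|]);
  repeat match goal with
  | H : is_true (all _ _) |- _ => clear H
  | H : is_true (pairwise _ _) |- _ => clear H
  end;
  first [exact: knuth_refl | apply: (@knuth_yxz [::] [::]); lia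
    | apply: knuth_sym; apply: (@knuth_yxz [::] [::]); lia
    | apply: (@knuth_xzy [::] [::]); lia].

(** Which letters are bumped depends on which of the blocks of [row_split3P] are
    empty.  In all cases the row is the same on both sides, and the bumped words
    are equal or related by an elementary relation. *)
Lemma rproc_yxz r x y z : x < y -> y < z -> isrow r ->
  x \notin r -> y \notin r -> z \notin r ->
  let p := rproc r [:: y; x; z] in let q := rproc r [:: y; z; x] in
  p.1 = q.1 /\ knuth p.2 q.2.
Proof.
move=> xy yz rr xr yr zr; have xz := ltn_trans xy yz.
have [a [b [c [d [er [[Ax Ay Az] [Bx By Bz] [Cx Cy Cz] [Dx Dy Dz]]]]]]] :=
  row_split3P xy yz rr xr yr zr.
have [rc rd] : isrow c /\ isrow d.
  by move: rr; rewrite er !pairwise_cat => /and5P[_ _ _ _ /and3P[_ -> ->]].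
clear xr yr zr rr; rewrite er /rproc /=; clear er r.
rproc_compute.
Qed.

Lemma rproc_xzy r x y z : x < y -> y < z -> isrow r ->
  x \notin r -> y \notin r -> z \notin r ->
  let p := rproc r [:: x; z; y] in let q := rproc r [:: z; x; y] in
  p.1 = q.1 /\ knuth p.2 q.2.
Proof.
move=> xy yz rr xr yr zr; have xz := ltn_trans xy yz.
have [a [b [c [d [er [[Ax Ay Az] [Bx By Bz] [Cx Cy Cz] [Dx Dy Dz]]]]]]] :=
  row_split3P xy yz rr xr yr zr.
have [rc rd] : isrow c /\ isrow d.
  by move: rr; rewrite er !pairwise_cat => /and5P[_ _ _ _ /and3P[_ -> ->]].
clear xr yr zr rr; rewrite er /rproc /=; clear er r.
rproc_compute.
Qed.

(** * Row insertion and tableaux *)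

Lemma rproc_uniq_row r u v : uniq (r ++ u ++ v) -> uniq ((rproc r u).1 ++ v).
Proof.
elim: u r => [|x u IH] r //= /rins_uniq[_ U _]; exact: IH.
Qed.

Lemma rproc_knuth_ctx r p c c' s :
  (forall R, isrow R -> uniq (R ++ c) ->
    (rproc R c).1 = (rproc R c').1 /\ knuth (rproc R c).2 (rproc R c').2) ->
  isrow r -> uniq (r ++ p ++ c ++ s) ->
  (rproc r (p ++ c ++ s)).1 = (rproc r (p ++ c' ++ s)).1 /\
  knuth (rproc r (p ++ c ++ s)).2 (rproc r (p ++ c' ++ s)).2.
Proof.
move=> cc rr U; rewrite !rproc_cat /=.
have U1 : uniq (r ++ p) by move: U; rewrite catA cat_uniq => /and3P[].
have U2 : uniq ((rproc r p).1 ++ c).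
  apply: rproc_uniq_row; have : uniq ((r ++ p ++ c) ++ s) by rewrite -!catA.
  by rewrite (cat_uniq _ s) => /and3P[].
have [-> Kc] := cc _ (rproc_row rr U1) U2.
by split=> //; apply: knuth_cat2.
Qed.

(** The elementary relations are treated by [rproc_yxz] and [rproc_xzy]; the
    context only changes the row where the three letters are inserted. *)
Lemma rproc_knuth r u v : knuth u v -> isrow r -> uniq (r ++ u) ->
  (rproc r u).1 = (rproc r v).1 /\ knuth (rproc r u).2 (rproc r v).2.
Proof.
move=> Kuv rr; elim: Kuv => {u v}
  [u|u v Kuv IH|v u w Kuv IH1 _ IH2|p s x y z xy yz|p s x y z xy yz] U.
- by split=> //; apply: knuth_refl.
- have e : perm_eq (r ++ u) (r ++ v) by rewrite perm_cat2l knuth_perm.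
  have [|-> ?] := IH; first by rewrite (perm_uniq e).
  by split=> //; apply: knuth_sym.
- have e : perm_eq (r ++ v) (r ++ u) by rewrite perm_cat2l perm_sym knuth_perm.
  have [-> K1] := IH1 U.
  have [|-> K2] := IH2; first by rewrite (perm_uniq e).
  by split=> //; apply: knuth_trans K2.
- apply: (@rproc_knuth_ctx r p [:: y; x; z] [:: y; z; x] s) => // R rR UR.
  by apply: rproc_yxz => //; move: UR; rewrite cat_uniq /= => /and3P[_];
    rewrite !negb_or => /and4P[].
- apply: (@rproc_knuth_ctx r p [:: x; z; y] [:: z; x; y] s) => // R rR UR.
  by apply: rproc_xzy => //; move: UR; rewrite cat_uniq /= => /and3P[_];
    rewrite !negb_or => /and4P[].
Qed.

(** By [rproc_knuth] the first rows agree and the bumped words are equivalent;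
    they are shorter, as the first letter is never bumped from the empty row. *)
Lemma Pword_knuth u v : knuth u v -> uniq u -> Pword u = Pword v.
Proof.
have [n] := ubnP (size u); elim: n u v => // n IH u v un Kuv Uu.
have Puv := knuth_perm Kuv.
case: u un Kuv Uu Puv => [|x u] un Kuv Uu Puv.
  by case: v Kuv Puv => // y v _ /perm_size.
case: v Kuv Puv => [|y v] Kuv Puv; first by move/perm_size: Puv.
rewrite !Pword_rproc; have [-> K] := @rproc_knuth [::] _ _ Kuv isT Uu.
congr cons; apply: IH => //; last exact: (@rproc_uniq [::]).
have := perm_size (rproc_perm [::] (x :: u)); rewrite size_cat.
have size_rproc w r : size r != 0 -> size (rproc r w).1 != 0.
  elim: w r => //= z w IHw r rN; apply: IHw; rewrite /rins.
  by case: ifP => _ /=; rewrite ?size_rcons // size_set_nth; lia.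
have : size (rproc [::] (x :: u)).1 != 0 by apply: (size_rproc u [:: x]).
by move: un => /=; lia.
Qed.

(** Column strictness between a row [r] and the row [s] just below it. *)
Fixpoint dom (r s : seq nat) {struct s} : bool :=
  match s, r with
  | [::], _ => true
  | y :: s', x :: r' => (x < y) && dom r' s'
  | _, [::] => false
  end.

Fixpoint tab (t : seq (seq nat)) : bool :=
  if t is r :: t' then [&& r != [::], isrow r, dom r (head [::] t') & tab t']
  else true.

(** The reading word, bottom row first. *)
Definition rdw (t : seq (seq nat)) : seq nat := flatten (rev t).

Lemma rdw_cons r t : rdw (r :: t) = rdw t ++ r.
Proof. by rewrite /rdw rev_cons flatten_rcons. Qed.

Lemma rdw_perm t : perm_eq (rdw t) (flatten t).
Proof. by apply: perm_flatten; rewrite perm_rev. Qed.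

Lemma rins_cons x y s :
  rins x (y :: s) = if x < y then (x :: s, [:: y]) else (y :: (rins x s).1, (rins x s).2).
Proof.
case: ifP => xy; first exact: rins_cons_lt.
by rewrite /rins /= xy ltnS; case: ifP.
Qed.

Lemma dom_rins x r s : dom r s -> dom (rins x r).1 s.
Proof.
elim: r s => [|y r IH] [|z s] //= /andP[yz rs]; rewrite rins_cons.
by case: ifP => xy /=; [rewrite (ltn_trans xy yz)|rewrite yz IH].
Qed.

Lemma rins_bumped x y r : (rins x r).2 = [:: y] -> x < y /\ y \in r.
Proof.
rewrite /rins; case: ifP => //= jr [<-]; split; last exact: mem_nth.
by apply: (nth_find 0 (a := ltn x)); rewrite has_find.
Qed.

(** The letter bumped from a column of [r] is smaller than the entry of [s] in
    that column, so it lands in this column or further left, below a smaller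
    entry. *)
Lemma dom_rins_bump x y r s : isrow r -> dom r s -> (rins x r).2 = [:: y] ->
  dom (rins x r).1 (rins y s).1.
Proof.
elim: r s => [|u r IH] s //= /andP[ur rr]; rewrite rins_cons.
case: ifP => [xu|xu] /=.
  case: s => [|z s] /=; first by move=> _ [<-]; rewrite /= xu.
  by move=> /andP[uz rs] [<-]; rewrite rins_cons uz /= xu.
move=> rs e.
have uy : u < y by have [_ /(allP ur)] := rins_bumped e.
case: s rs => [|z s] /=; first by rewrite uy.
move=> /andP[uz rs]; rewrite rins_cons; case: ifP => yz /=.
  by rewrite uy dom_rins.
by rewrite uz IH.
Qed.

Lemma rins_neq0 x r : (rins x r).1 != [::].
Proof. by case: r => [|y r] //; rewrite rins_cons; case: ifP. Qed.

Lemma rins2P x r : (rins x r).2 = [::] \/ exists y, (rins x r).2 = [:: y].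
Proof. by rewrite /rins; case: ifP => _ /=; [right; eexists|left]. Qed.

Lemma rins_append x r : (rins x r).2 = [::] -> (rins x r).1 = rcons r x.
Proof. by rewrite /rins; case: ifP. Qed.

Lemma rowins_tab x t : tab t -> uniq (x :: flatten t) -> tab (rowins x t).
Proof.
elim: t x => [|r t IH] x //.
move=> /and4P[_ rr rt tt] U.
have xr : x \notin r by move: U; rewrite /= mem_cat negb_or => /andP[/andP[]].
rewrite rowins_rins /= rins_neq0 rins_row //=.
have [e|[y e]] := rins2P x r; rewrite e /=.
  by rewrite dom_rins // tt.
have Uy : uniq (y :: flatten t).
  have : uniq (((rins x r).1 ++ (rins x r).2) ++ flatten t).
    have E : perm_eq (((rins x r).1 ++ (rins x r).2) ++ flatten t) ((x :: r) ++ flatten t).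
      by rewrite perm_cat2r rins_perm.
    by rewrite (perm_uniq E).
  by rewrite e -catA cat_uniq => /and3P[].
rewrite IH // andbT.
case: t rt tt {IH U Uy} => [|s t] rs tt; last by rewrite rowins_rins /= dom_rins_bump.
exact: (@dom_rins_bump x y r [::]).
Qed.

Lemma rowins_perm x t : perm_eq (flatten (rowins x t)) (x :: flatten t).
Proof.
elim: t x => [|r t IH] x //; rewrite rowins_rins /=.
have /seq.permP E := rins_perm x r; apply/seq.permP => a; move: (E a).
have [e|[y e]] := rins2P x r; rewrite e /= !count_cat /=; first lia.
by have /seq.permP/(_ a) := IH y; rewrite /= => ->; lia.
Qed.

(** [knuth_bump] in each row of the bumping route. *)
Lemma rowins_knuth x t : tab t -> uniq (x :: flatten t) ->
  knuth (rdw t ++ [:: x]) (rdw (rowins x t)).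
Proof.
elim: t x => [|r t IH] x; first by move=> _ _; apply: knuth_refl.
move=> /and4P[_ rr rt tt] U.
have xr : x \notin r by move: U; rewrite /= mem_cat negb_or => /andP[/andP[]].
rewrite rowins_rins !rdw_cons -catA.
have [a [b [er ax bx]]] := row_splitP rr xr.
have E := rins_split ax bx; rewrite -er in E; rewrite E.
case: b er bx E => [|y b] er bx E /=.
  by rewrite er cats0 cats1; apply: knuth_refl.
have Uy : uniq (y :: flatten t).
  by move: U; rewrite er /= => /andP[_]; rewrite -catA cat_uniq => /and3P[_ _] /=;
    rewrite mem_cat negb_or cat_uniq => /andP[/andP[_ ->] /and3P[_ _ ->]].
apply: (@knuth_trans (rdw t ++ y :: a ++ x :: b)); last first.
  by rewrite -cat1s catA; apply: knuth_catr; apply: IH.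
by apply: knuth_catl; rewrite er -catA /=; apply: knuth_bump; rewrite -?er //;
  case/andP: bx.
Qed.

Lemma insword_tab t u : tab t -> uniq (flatten t ++ u) ->
  [/\ tab (insword t u), perm_eq (flatten (insword t u)) (flatten t ++ u) &
      knuth (rdw t ++ u) (rdw (insword t u))].
Proof.
elim: u t => [|x u IH] t tt U; first by rewrite !cats0; split=> //; apply: knuth_refl.
have E : perm_eq (x :: flatten t ++ u) (flatten t ++ x :: u).
  by apply/seq.permP => a; rewrite /= !count_cat /=; lia.
have Ux : uniq (x :: flatten t).
  by move: U; rewrite -(perm_uniq E) -cat_cons cat_uniq => /and3P[].
have E2 : perm_eq (flatten (rowins x t) ++ u) (flatten t ++ x :: u).
  by apply: perm_trans E; rewrite -cat_cons perm_cat2r rowins_perm.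
have [||T1 T2 T3] := IH (rowins x t); first exact: rowins_tab.
  by rewrite (perm_uniq E2).
split=> //; first exact: perm_trans E2.
apply: knuth_trans T3; rewrite -cat1s catA; apply: knuth_catr.
exact: rowins_knuth.
Qed.

Lemma Pword_tab u : uniq u -> tab (Pword u).
Proof. by move=> U; case: (@insword_tab [::] u isT U). Qed.

Lemma Pword_perm u : uniq u -> perm_eq (flatten (Pword u)) u.
Proof. by move=> U; case: (@insword_tab [::] u isT U). Qed.

Lemma knuth_Pword u : uniq u -> knuth u (rdw (Pword u)).
Proof. by move=> U; case: (@insword_tab [::] u isT U). Qed.

(** Each letter of [r] bumps exactly the entry of [s] in its column, so that
    [r] pushes the whole row [s] out. *)
Lemma rproc_dom a r s : isrow (a ++ r) -> dom r s -> rproc (a ++ s) r = (a ++ r, s).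
Proof.
elim: r a s => [|x r IH] a [|y s] //=.
  move=> R _; rewrite cats0.
  have E : rins x a = (rcons a x, [::]).
    by rewrite -{1}[a]cats0 rins_catl // ?rins_nil ?cats1 //; move: R;
      rewrite pairwise_cat allrel_consr => /andP[/andP[]].
  have := IH (rcons a x) [::]; rewrite cats0 cat_rcons E /= => -> //.
move=> R /andP[xy rs].
have E : rins x (a ++ y :: s) = (rcons a x ++ s, [:: y]).
  by rewrite rins_catl ?rins_cons_lt ?cat_rcons //=; move: R;
    rewrite pairwise_cat allrel_consr => /andP[/andP[]].
by rewrite E /= IH ?cat_rcons.
Qed.

Lemma rproc_rdw t : tab t -> rproc [::] (rdw t) = (head [::] t, rdw (behead t)).
Proof.
elim: t => [|r t IH] // /and4P[_ rr rt tt].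
rewrite rdw_cons rproc_cat IH //= (@rproc_dom [::] r) //=.
by case: t {IH rt tt} => [|s t] //=; rewrite rdw_cons.
Qed.

(** By [rproc_dom], each row of the reading word pushes the rows inserted before
    it down by one. *)
Lemma Pword_rdw t : tab t -> Pword (rdw t) = t.
Proof.
elim: t => [|r t IH] // T; have /and4P[rN _ _ tt] := T.
case E : (rdw (r :: t)) => [|x u].
  by move: E rN; rewrite rdw_cons; case: (rdw t); case: (r).
by rewrite Pword_rproc -E rproc_rdw //= IH.
Qed.

(** * The Robinson-Schensted correspondence *)

(** The row of the box created by the insertion of [x]. *)
Fixpoint insrow (x : nat) (t : seq (seq nat)) : nat :=
  if t is r :: t' then
    if (rins x r).2 is y :: _ then (insrow y t').+1 else 0
  else 0.

(** The recording tableau of an insertion starting from [t], encoded as the list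
    of the rows of the successive new boxes. *)
Fixpoint Qrec (t : seq (seq nat)) (u : seq nat) : seq nat :=
  if u is x :: u' then insrow x t :: Qrec (rowins x t) u' else [::].

Definition Qword := Qrec [::].

Lemma Qrec_cat t u v : Qrec t (u ++ v) = Qrec t u ++ Qrec (insword t u) v.
Proof. by elim: u t => //= x u IH t; rewrite IH. Qed.

Lemma size_Qrec t u : size (Qrec t u) = size u.
Proof. by elim: u t => //= x u IH t; rewrite IH. Qed.

Lemma size_rins x r :
  size (rins x r).1 = if (rins x r).2 is [::] then (size r).+1 else size r.
Proof.
rewrite /rins; case: ifP => jr /=; last by rewrite size_rcons.
by rewrite size_set_nth; apply/maxn_idPr.
Qed.

Lemma shape_rowins x t : shape (rowins x t) = incr_nth (shape t) (insrow x t).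
Proof.
elim: t x => [|r t IH] x //; rewrite rowins_rins /= size_rins.
by have [e|[y e]] := rins2P x r; rewrite e /= ?IH.
Qed.

(** Reverse bumping: [y] replaces the last letter smaller than [y], which is
    returned. *)
Fixpoint rout (y : nat) (r : seq nat) : nat * seq nat :=
  if r is x :: r' then
    if r' is z :: _ then
      if z < y then ((rout y r').1, x :: (rout y r').2) else (x, y :: r')
    else (x, [:: y])
  else (0, [::]).

Lemma rout_split x y a b : all (gtn y) a -> x < y -> all (ltn y) b ->
  rout y (a ++ x :: b) = (x, a ++ y :: b).
Proof.
move=> ay xy yb; elim: a ay => [|z a IH] /=.
  by case: b yb => [|z b] //= /andP[yz _]; rewrite ltnNge ltnW.
case/andP=> zy ay; move: (IH ay).
case: a {IH} ay => [|w a] /=; first by rewrite xy => _ ->.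
by case/andP=> -> _ ->.
Qed.

Lemma rins_routK x y r : isrow r -> x \notin r -> (rins x r).2 = [:: y] ->
  rout y (rins x r).1 = (x, r).
Proof.
move=> rr xr; have [a [b [er ax bx]]] := row_splitP rr xr.
rewrite er rins_split //; case: b er bx => [|z b] er //= /andP[xz xb] [<-].
move: rr; rewrite er pairwise_cat /= => /and3P[_ _ /andP[zb _]].
by apply: rout_split => //; apply: sub_all ax => u /= /ltn_trans; apply.
Qed.

Lemma row_head_splitP y r : isrow r -> y \notin r -> r != [::] -> head 0 r < y ->
  exists a x b, [/\ r = a ++ x :: b, all (gtn y) a, x < y & all (ltn y) b].
Proof.
move=> rr yr; have [a [b [-> ay yb]]] := row_splitP rr yr.
case/lastP: a ay => [|a x]; first by case: b yb => //= z b /andP[]; lia.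
rewrite all_rcons => /andP[/= xy ay] _ _.
by exists a, x, b; rewrite cat_rcons.
Qed.

(** [y] enters [r] in the column where it would be inserted in [s], or further to
    the right, and the entries of [s] there are larger than [y]. *)
Lemma rout_dom y r s : isrow r -> head 0 r < y -> y \notin r -> isrow s ->
  y \notin s -> dom r (rins y s).1 -> dom (rout y r).2 s.
Proof.
elim: r s => [|x r IH] s; first by case: s => [|u s] //=; rewrite rins_cons; case: ifP.
case: s => [|u s] // rr xy; rewrite inE negb_or => /andP[yx yr] rs.
rewrite inE negb_or => /andP[yu ys].
have {}xy : x < y := xy.
case: r IH rr yr => [|z r] IH rr yr.
  rewrite rins_cons; case: ifP => yu' /=.
    by rewrite yu' => /andP[_]; case: (s).
  by case: (rins y s) (rins_neq0 y s) => -[|? ?] ? //=; rewrite andbF.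
have zr : isrow (z :: r) by move: rr => /= /andP[_ ->].
have sr : isrow s by move: rs => /= /andP[_ ->].
have us : all (ltn u) s by move: rs => /= /andP[].
rewrite [rout _ _]/=; case: ifP => zy.
  rewrite rins_cons; case: ifP => yu' /= /andP[xu D].
    rewrite (ltn_trans xy yu') /=; apply: IH => //.
    case: s us D {rs ys sr} => [|v s] /=; first by rewrite zy.
    case/andP=> uv us /andP[zv D].
    by rewrite rins_cons (ltn_trans yu' uv) /= zy.
  by rewrite xu; apply: IH.
have yz : y < z by move: yr; rewrite inE; lia.
rewrite rins_cons; case: ifP => yu' /= /andP[xu D]; first by rewrite yu'.
have {}yu' : u < y by lia.
case: s D ys {rs sr us} => [|v s]; first by move=> /=; lia.
rewrite inE negb_or => + /andP[yv _]; rewrite rins_cons.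
by case: ifP => yv' /= /andP[]; lia.
Qed.

(** Reverse insertion from the last box of row [i], assumed to be a corner.  A
    row that becomes empty is dropped. *)
Fixpoint unins (i : nat) (t : seq (seq nat)) : nat * seq (seq nat) :=
  if t is r :: t' then
    if i is i'.+1 then
      let p := unins i' t' in let q := rout p.1 r in (q.1, q.2 :: p.2)
    else (last 0 r,
          if take (size r).-1 r is x :: a then (x :: a) :: t' else t')
  else (0, [::]).

Lemma rins_uniq_bump x y r u : uniq (x :: r ++ u) -> (rins x r).2 = [:: y] ->
  uniq (y :: u).
Proof.
move=> U e; suff U' : uniq (r ++ x :: u) by case: (rins_uniq U'); rewrite e.
have E : perm_eq (x :: r ++ u) (r ++ x :: u).
  by apply/seq.permP => a; rewrite /= !count_cat /=; lia.
by rewrite -(perm_uniq E).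
Qed.

Lemma unins_rowins x t : tab t -> uniq (x :: flatten t) ->
  unins (insrow x t) (rowins x t) = (x, t).
Proof.
elim: t x => [|r t IH] x //.
move=> /and4P[rN rr _ tt] U.
have xr : x \notin r by move: U; rewrite /= mem_cat negb_or => /andP[/andP[]].
rewrite rowins_rins /=.
have [e|[y e]] := rins2P x r; rewrite e /=.
  rewrite rins_append // last_rcons size_rcons /= -cats1 take_size_cat //.
  by case: r rN {rr xr U e}.
by rewrite IH ?(rins_uniq_bump U e) //= rins_routK.
Qed.

Lemma dom_head r s : dom r s -> s != [::] -> head 0 r < head 0 s.
Proof. by case: s r => [|y s] [|x r] //= /andP[]. Qed.

Lemma tab_head r t : tab (r :: t) -> all (ltn (head 0 r)) (flatten t).
Proof.
elim: t r => [|s t IH] r //= /and4P[rN rr D T].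
have [sN sr _ _] := and4P T.
have rs := dom_head D sN.
rewrite all_cat; apply/andP; split; last first.
  by apply: sub_all (IH s T) => u /=; apply: ltn_trans.
case: s sr rs {sN D T} => //= y s /andP[ys _] rs; rewrite rs /=.
by apply: sub_all ys => u /=; apply: ltn_trans.
Qed.

Definition corner (sh : seq nat) i := (nth 0 sh i.+1 < nth 0 sh i).

Lemma dom_size r s : dom r s -> size s <= size r.
Proof. by elim: s r => [|y s IH] [|x r] //= /andP[_ /IH]. Qed.

(** Induction on the rows below: the letter [y] that comes up from them exceeds
    the first entry of [r], hence it reverse bumps a letter of [r]. *)
Lemma rowins_unins i t : tab t -> uniq (flatten t) -> corner (shape t) i ->
  let p := unins i t in
  [/\ tab p.2, rowins p.1 p.2 = t & insrow p.1 p.2 = i].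
Proof.
elim: t i => [|r t IH] i; first by rewrite /corner !nth_nil.
move=> T U; have /and4P[rN rr rt tt] := T; case: i => [|i].
  rewrite /corner /=.
  case/lastP: r rN rr rt {T U} => // a x _; rewrite pairwise_rcons => /andP[ax ra].
  rewrite last_rcons size_rcons -cats1 take_size_cat // cats1 => rt sx.
  have ea : rins x a = (rcons a x, [::]).
    by rewrite -{1}[a]cats0 rins_split.
  case: a ax ra rt sx ea => [|y a] ax ra rt sx ea.
    by case: t tt sx {IH rt} => [|[|z s] t] //= /and4P[].
  split=> //.
  - apply/and4P; split=> //.
    have E b s' : size s' <= size b -> dom (rcons b x) s' -> dom b s'.
      by elim: b s' => [|z b IHb] [|w s'] //= sb /andP[->]; apply: IHb.
    by apply: E rt; case: (t) sx.
  - by rewrite rowins_rins ea.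
  - by rewrite /= -/(rins x (y :: a)) ea.
move=> ci0; have ci : corner (shape t) i := ci0; clear ci0.
have Ut : uniq (flatten t) by move: U => /=; rewrite cat_uniq => /and3P[].
have [T0 E0 I0] := IH i tt Ut ci.
set y := (unins i t).1 in T0 E0 I0 *; set t0 := (unins i t).2 in T0 E0 I0 *.
have yt : y \in flatten t by rewrite -E0 (perm_mem (rowins_perm _ _)) inE eqxx.
have yr : y \notin r.
  apply/negP => yr; move: U => /=; rewrite cat_uniq => /and3P[_ /hasPn/(_ _ yt)].
  by rewrite /= yr.
have ry : head 0 r < y by apply: (allP (tab_head T)).
have Ut0 : uniq (y :: flatten t0).
  by rewrite -(perm_uniq (rowins_perm _ _)) E0.
have [a [x [b [er ay xy yb]]]] := row_head_splitP rr yr rN ry.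
have [ax xb] : all (gtn x) a /\ all (ltn x) b.
  by move: rr; rewrite er pairwise_cat /= allrel_consr => /and3P[/andP[]] ? ? ? /andP[].
have Ex : rins x (a ++ y :: b) = (r, [:: y]).
  rewrite rins_split // ?er //= xy.
  by apply: sub_all yb => u /=; apply: ltn_trans.
have -> : unins i.+1 (r :: t) = (x, (a ++ y :: b) :: t0).
  by rewrite /= -/y -/t0 er rout_split.
split.
- apply/and4P; split=> //; first by case: (a).
    move: rr; rewrite er !pairwise_cat !allrel_consr /= =>
      /and3P[/andP[_ ->] -> /andP[_ ->]].
    by rewrite ay yb.
  have := @rout_dom y r (head [::] t0) rr ry yr.
  rewrite {2}er rout_split //=; apply.
  + by case: (t0) T0 => //= s ? /and4P[].
  + by case: (t0) Ut0 => //= s ? /andP[]; rewrite mem_cat negb_or => /andP[].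
  + move: rt; rewrite -E0; case: (t0) => [|s t0'] //.
    by rewrite rowins_rins.
- by rewrite -[LHS]/(rowins x (_ :: _)) rowins_rins Ex /= E0.
- by rewrite /= -/(rins x (a ++ y :: b)) Ex /= I0.
Qed.

Lemma Qword_rcons u x : Qword (rcons u x) = rcons (Qword u) (insrow x (Pword u)).
Proof. by rewrite -!cats1 /Qword Qrec_cat. Qed.

Lemma Pword_rcons u x : Pword (rcons u x) = rowins x (Pword u).
Proof. by rewrite -cats1 /Pword insword_cat. Qed.

Lemma rcons_Pword_uniq u x : uniq (rcons u x) ->
  [/\ uniq u, tab (Pword u) & uniq (x :: flatten (Pword u))].
Proof.
rewrite rcons_uniq => /andP[xu Uu]; have Puu := Pword_perm Uu.
by split; rewrite ?Pword_tab //= (perm_mem Puu) xu (perm_uniq Puu).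
Qed.

(** The insertions are undone from the last one, the recording telling the box
    to start from. *)
Lemma RSK_inj u v : uniq u -> uniq v -> Pword u = Pword v -> Qword u = Qword v ->
  u = v.
Proof.
elim/last_ind: u v => [|u x IH] v Uu Uv.
  by case: v Uv => // y v _ _ /(congr1 size); rewrite size_Qrec.
case/lastP: v Uv => [|v y] Uv; first by move=> _ /(congr1 size);
  rewrite !size_Qrec size_rcons.
have [Uu' Tu Fu] := rcons_Pword_uniq Uu; have [Uv' Tv Fv] := rcons_Pword_uniq Uv.
rewrite !Pword_rcons !Qword_rcons => eP /rcons_inj[eQ ei].
have := unins_rowins Tu Fu; rewrite eP ei unins_rowins // => -[-> eP'].
by rewrite (IH v).
Qed.

Lemma tab_part t : tab t -> forall i, nth 0 (shape t) i.+1 <= nth 0 (shape t) i.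
Proof.
elim: t => [|r t IH] // /and4P[_ _ D T] [|i] /=; last exact: IH.
by case: t D {IH T} => //= s t /dom_size.
Qed.

Lemma tab_shape_neq0 t : tab t -> 0 \notin shape t.
Proof.
elim: t => [|r t IH] //= /and4P[rN _ _ T]; rewrite inE negb_or IH // andbT.
by case: r rN.
Qed.

Lemma eq_from_nth0 (u v : seq nat) : 0 \notin u -> 0 \notin v ->
  (forall j, nth 0 u j = nth 0 v j) -> u = v.
Proof.
elim: u v => [|x u IH] [|y v] //=.
- by move=> _ + /(_ 0) /= e; rewrite -e inE eqxx.
- by move=> + _ /(_ 0) /= e; rewrite e inE eqxx.
- rewrite !inE !negb_or => /andP[_ u0] /andP[_ v0] e; have /= -> := e 0.
  by congr cons; apply: IH => // j; apply: (e j.+1).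
Qed.

Lemma incr_nth_inj (s s' : seq nat) i : 0 \notin s -> 0 \notin s' ->
  incr_nth s i = incr_nth s' i -> s = s'.
Proof.
move=> s0 s0' e; apply: eq_from_nth0 => // j.
by have := congr1 (nth 0 ^~ j) e; rewrite !nth_incr_nth => /addnI.
Qed.

(** Reverse insertion applied to [t] along the recording of [u]; the shapes
    agree at each stage, so that the recorded box is always a corner. *)
Lemma RSK_surj u t : uniq u -> tab t -> uniq (flatten t) ->
  shape (Pword u) = shape t ->
  exists v, [/\ perm_eq v (flatten t), Pword v = t & Qword v = Qword u].
Proof.
elim/last_ind: u t => [|u x IH] t Uu T Ut.
  by case: t {T Ut} => // _; exists [::].
have [Uu' Tu Fu] := rcons_Pword_uniq Uu.
rewrite Pword_rcons shape_rowins Qword_rcons.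
set i := insrow x (Pword u) => esh.
have ci : corner (shape t) i.
  rewrite /corner -esh !nth_incr_nth eqxx (ltn_eqF (ltnSn i)) add0n add1n ltnS.
  exact: tab_part.
have [] := rowins_unins T Ut ci.
set y := (unins i t).1; set t0 := (unins i t).2 => T0 E0 I0.
have Ut0 : uniq (y :: flatten t0) by rewrite -(perm_uniq (rowins_perm _ _)) E0.
have esh0 : shape (Pword u) = shape t0.
  apply: (@incr_nth_inj _ _ i); rewrite ?tab_shape_neq0 //.
  by rewrite esh -E0 shape_rowins I0.
have [|v [Pv Ev Qv]] := IH t0 Uu' T0 _ esh0; first by case/andP: Ut0.
exists (rcons v y); split.
- have := rowins_perm y t0; rewrite E0 perm_sym => E; apply: perm_trans E.
  by rewrite perm_rcons perm_cons.
- by rewrite Pword_rcons Ev E0.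
- by rewrite Qword_rcons Ev I0 Qv.
Qed.

(** The inversions of [u ++ v] between a letter of [u] and a letter of [v]. *)
Definition cross (u v : seq nat) := sumn [seq count (gtn x) v | x <- u].
Fixpoint inv (u : seq nat) := if u is x :: u' then count (gtn x) u' + inv u' else 0.

Lemma cross_catl u v w : cross (u ++ v) w = cross u w + cross v w.
Proof. by rewrite /cross map_cat sumn_cat. Qed.

Lemma cross_perm u v u' v' : perm_eq u u' -> perm_eq v v' -> cross u v = cross u' v'.
Proof.
move=> Euu /seq.permP Evv; rewrite /cross (@perm_sumn _ [seq count (gtn x) v | x <- u']).
  by congr sumn; apply: eq_map => x; apply: Evv.
exact: perm_map.
Qed.

Lemma inv_cat u v : inv (u ++ v) = inv u + inv v + cross u v.
Proof.
by elim: u => [|x u IH] /=; rewrite ?addn0 // IH count_cat /cross /=; lia.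
Qed.

Lemma inv_row r : isrow r -> inv r = 0.
Proof.
elim: r => //= x r IH /andP[xr /IH ->]; rewrite addn0; apply/eqP.
by rewrite -leqn0 leqNgt -has_count -all_predC; apply: sub_all xr => y /=; lia.
Qed.

(** The change of the number of inversions, modulo 2, in an insertion that ends
    in row [i]: [m + 1] for each row of length [m] above. *)
Fixpoint bumppar (i : nat) (sh : seq nat) : nat :=
  if i is i'.+1 then (if sh is m :: sh' then m.+1 + bumppar i' sh' else 0) else 0.

(** With [y] bumped by [x] from [a ++ y :: b], the word [a ++ y :: b ++ [:: x]]
    becomes [y :: a ++ x :: b]: the [|b| + 1] inversions of [x] are replaced with
    [|a| + 1] inversions of [y], and the difference is congruent to
    [|a| + |b| + 2], the length of the row plus 1. *)
Lemma inv_rowins x t : tab t -> uniq (x :: flatten t) ->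
  odd (inv (rdw t ++ [:: x])) =
  odd (inv (rdw (rowins x t)) + bumppar (insrow x t) (shape t)).
Proof.
elim: t x => [|r t IH] x //.
move=> /and4P[_ rr rt tt] U.
have xr : x \notin r by move: U; rewrite /= mem_cat negb_or => /andP[/andP[]].
have [a [b [er ax bx]]] := row_splitP rr xr.
have E := rins_split ax bx; rewrite -er in E.
rewrite rowins_rins !rdw_cons /= -/(rins x r) E -catA.
case: b er bx E => [|y b] er bx E /=.
  by rewrite er cats0 cats1 addn0.
have Uy : uniq (y :: flatten t) by apply: (rins_uniq_bump U); rewrite E.
have {}IH := IH y tt Uy.
have cr : cross (rdw (rowins y t)) (a ++ x :: b) = cross (rdw t ++ [:: y]) (a ++ x :: b).
  apply: cross_perm => //; apply: perm_trans (rdw_perm _) _.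
  apply: perm_trans (rowins_perm _ _) _; rewrite perm_sym cats1 perm_rcons.
  by rewrite perm_cons rdw_perm.
have c1 : cross (rdw t) (r ++ [:: x]) = cross (rdw t) (a ++ x :: b) + cross (rdw t) [:: y].
  rewrite er; elim: (rdw t) => //= z s; rewrite /cross /= => ->.
  rewrite !count_cat /= ?count_cat /=; clear; lia.
have ra : isrow (a ++ x :: b).
  by have := rins_row rr xr; rewrite E.
change (insword t [:: y]) with (rowins y t).
rewrite (inv_cat (rdw t)) c1 (inv_cat (rdw (rowins y t))) cr cross_catl (inv_row ra)
  (inv_cat r) (inv_row rr).
rewrite inv_cat in IH.
have -> : cross r [:: x] = (size b).+1.
  rewrite er /cross map_cat sumn_cat.
  have -> : sumn [seq count (gtn z) [:: x] | z <- a] = 0.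
    apply/eqP; elim: (a) ax => //= z s IHs /andP[zx /IHs].
    by rewrite addn_eq0 => ->; rewrite andbT !addn0 eqb0 -leqNgt ltnW.
  move: bx => /=; case: ltngtP => //= xy bx; rewrite add0n add1n; congr S.
  by elim: b bx {er E ra c1 cr} => //= z s IHs /andP[-> /IHs ->].
have -> : cross [:: y] (a ++ x :: b) = (size a).+1.
  rewrite /cross /= addn0 count_cat /= addnC.
  move: rr; rewrite er pairwise_cat /= allrel_consr => /and3P[/andP[ya _] _ /andP[yb _]].
  have -> : (x < y) = true by case/andP: bx.
  have /eqP -> : count (gtn y) b == 0.
    by rewrite -leqn0 leqNgt -has_count -all_predC; apply: sub_all yb => z /=;
      rewrite -leqNgt => /ltnW.
  rewrite addn0 add1n; congr S; apply/eqP; rewrite -all_count.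
  exact: ya.
move: IH; rewrite er size_cat /= !oddD /= !oddD /=.
do ! case: (odd _) => //=.
Qed.

(** The total of [bumppar] over an insertion with recording [q] that starts
    from the shape [sh]. *)
Fixpoint Qpar (sh q : seq nat) : nat :=
  if q is i :: q' then bumppar i sh + Qpar (incr_nth sh i) q' else 0.

Lemma inv_insword t u : tab t -> uniq (flatten t ++ u) ->
  odd (inv (rdw t ++ u)) =
  odd (inv (rdw (insword t u)) + Qpar (shape t) (Qrec t u)).
Proof.
elim: u t => [|x u IH] t T U; first by rewrite cats0 addn0.
have E : perm_eq (x :: flatten t ++ u) (flatten t ++ x :: u).
  by apply/seq.permP => a; rewrite /= !count_cat /=; lia.
have Ux : uniq (x :: flatten t).
  by move: U; rewrite -(perm_uniq E) -cat_cons cat_uniq => /and3P[].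
have E2 : perm_eq (flatten (rowins x t) ++ u) (flatten t ++ x :: u).
  by apply: perm_trans E; rewrite -cat_cons perm_cat2r rowins_perm.
have := IH (rowins x t) (rowins_tab T Ux); rewrite (perm_uniq E2) => /(_ U).
rewrite -[insword _ (x :: u)]/(insword (rowins x t) u) /= shape_rowins.
rewrite -cat1s catA !(inv_cat _ u).
have -> : cross (rdw (rowins x t)) u = cross (rdw t ++ [:: x]) u.
  apply: cross_perm => //; apply: perm_trans (rdw_perm _) _.
  apply: perm_trans (rowins_perm _ _) _; rewrite perm_sym cats1 perm_rcons.
  by rewrite perm_cons rdw_perm.
have := inv_rowins T Ux.
rewrite !oddD; do ! case: (odd _) => //=.
Qed.

Lemma rins_bumped_exists x y r : isrow r -> x \in r -> y < x ->
  exists2 z, (rins y r).2 = [:: z] & z <= x.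
Proof.
elim: r => // z r IH /= /andP[zr rr]; rewrite inE rins_cons => xr yx.
case: ifP => [yz|yz] /=; last first.
  by apply: IH => //; case/orP: xr => // /eqP exz; rewrite -exz yx in yz.
by exists z => //; case/orP: xr => [/eqP ->|/(allP zr) /ltnW].
Qed.

(** If [x < y], then the bumping route of [y] is strictly to the right of that
    of [x] in every row, and it ends no lower; otherwise it is weakly to the left
    and goes on below the end of the route of [x]. *)
Lemma row_bump x y t : tab t -> uniq [:: x, y & flatten t] ->
  (insrow y (rowins x t) <= insrow x t) = (x < y).
Proof.
elim: t x y => [|r t IH] x y.
  by move=> _; rewrite /= inE andbT -/(rins y [:: x]) rins_cons; case: ltngtP.
move=> /and4P[_ rr _ tt] U.
have [xy xr yr] : [/\ x != y, x \notin r & y \notin r].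
  move: U; rewrite /= !inE !mem_cat !negb_or.
  by case/and3P=> /and3P[-> -> _] /andP[-> _] _.
have rr1 := rins_row rr xr.
rewrite rowins_rins /= -/(rins x r) -/(rins y (rins x r).1).
have U2 z w : (rins x r).2 = [:: z] -> (rins y (rins x r).1).2 = [:: w] ->
    uniq [:: z, w & flatten t].
  move=> ez ew; have /seq.permP E1 := rins_perm x r.
  have /seq.permP E2 := rins_perm y (rins x r).1; rewrite ez in E1; rewrite ew in E2.
  have E : perm_eq ((rins y (rins x r).1).1 ++ [:: z, w & flatten t])
              [:: x, y & flatten (r :: t)].
    apply/seq.permP => a; move: (E1 a) (E2 a); rewrite /= !count_cat /= ?count_cat /=.
    by clear; lia.
  by move: U; rewrite -(perm_uniq E) cat_uniq => /and3P[].
have [lxy|] := ltnP x y; last first.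
  rewrite leq_eqVlt eq_sym (negPf xy) /= => lyx.
  have x1 : x \in (rins x r).1.
    have : x \in (rins x r).1 ++ (rins x r).2.
      by rewrite (perm_mem (rins_perm x r)) inE eqxx.
    rewrite mem_cat => /orP[//|]; have [->|[z e]] := rins2P x r; first by [].
    rewrite e inE => /eqP exz; case: (rins_bumped e) => _; rewrite -exz.
    by rewrite (negPf xr).
  have [w ew wx] := rins_bumped_exists rr1 x1 lyx; rewrite ew.
  have [e|[z e]] := rins2P x r; rewrite e //= ltnS IH //; last exact: U2.
  by have [xz _] := rins_bumped e; apply/negbTE; rewrite -leqNgt; lia.
have [ey|[w ew]] := rins2P y (rins x r).1; first by rewrite ey.
rewrite ew.
have [yw] := rins_bumped ew.
have wr : w \in (rins x r).1 -> w \in r.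
  move=> w1; have : w \in (rins x r).1 ++ (rins x r).2 by rewrite mem_cat w1.
  rewrite (perm_mem (rins_perm x r)) inE => /orP[/eqP wx|//].
  by rewrite wx ltnNge ltnW in yw.
move=> /wr {}wr; have [z e zw] := rins_bumped_exists rr wr (ltn_trans lxy yw).
rewrite e ltnS IH //; last exact: U2.
rewrite ltn_neqAle zw andbT; apply/negP => /eqP ezw.
by have := U2 _ _ e ew; rewrite ezw /= inE eqxx.
Qed.

(** * Slides and rectification *)

(** Inserting the letters of [a] in the row [e ++ c ++ d] bumps the letters of
    [c], one by one. *)
Lemma knuth_swap_rows e c d a : isrow (e ++ c ++ d) -> all2 ltn a c -> isrow (e ++ a) ->
  knuth (e ++ c ++ d ++ a) (c ++ e ++ a ++ d).
Proof.
elim: a e c => [|x a IH] e [|y c] //=; first by rewrite !cats0 => *; apply: knuth_refl.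
move=> R /andP[xy ac] ea.
have ex : all (gtn x) e.
  by move: ea; rewrite pairwise_cat allrel_consr => /andP[/andP[]].
have K1 := knuth_bump R ex xy.
apply: (@knuth_trans ((y :: e ++ x :: c ++ d) ++ a)).
  by have := knuth_catr a K1; rewrite -!catA /= -!catA.
have := IH (rcons e x) c; rewrite !cat_rcons => IH'.
rewrite /= -!catA /= -catA; apply: (@knuth_catl [:: y]); apply: IH' => //.
move: R; rewrite !(pairwise_cat _ e) !allrel_consr /=.
move=> /and3P[/andP[_ ->] -> /andP[ycd ->]] /=.
rewrite ex !andbT /=.
by apply: sub_all ycd => u /=; apply: ltn_trans.
Qed.

(** Two consecutive rows around the empty box: [c0 ++ c1 ++ x :: d] is below
    [a ++ b1 ++ b2], where [c1] is below [a] and [d] is below [b1], and [x] moves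
    up between [a] and [b1].  Inserting [a] exchanges it with [c1], then
    inserting [b1] exchanges it with [d], and [a] is finally put back. *)
Lemma knuth_slide_down c0 c1 x d a b1 b2 :
  isrow (c1 ++ x :: d) -> all2 ltn a c1 -> isrow a -> all2 ltn b1 d -> isrow (x :: b1) ->
  knuth (c0 ++ c1 ++ x :: d ++ a ++ b1 ++ b2) (c0 ++ c1 ++ d ++ a ++ x :: b1 ++ b2).
Proof.
move=> R ac ra bd rb; apply: knuth_catl.
have R' : isrow (c1 ++ d).
  by move: R; rewrite !pairwise_cat allrel_consr /= => /and3P[/andP[_ ->] -> /andP[_ ->]].
have Rd : isrow (x :: d) by move: R; rewrite pairwise_cat => /and3P[].
have K1 := @knuth_swap_rows [::] c1 (x :: d) a R ac ra.
have K2 := @knuth_swap_rows [:: x] d [::] b1; rewrite !cats0 /= in K2.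
have {}K2 := K2 Rd bd rb.
have K3 := @knuth_swap_rows [::] c1 d a R' ac ra.
apply: (@knuth_trans (c1 ++ a ++ x :: d ++ b1 ++ b2)).
  by have := knuth_catr (b1 ++ b2) K1; rewrite /= -?catA /= -?catA /= -?catA.
apply: (@knuth_trans (c1 ++ a ++ d ++ x :: b1 ++ b2)).
  by have := knuth_cat2 (c1 ++ a) b2 K2; rewrite /= -?catA /= -?catA /= -?catA.
by have := knuth_sym (knuth_catr (x :: b1 ++ b2) K3); rewrite /= -?catA /= -?catA /= -?catA.
Qed.

(** The entries 0 mark the boxes without entry and are skipped. *)
Definition rowf N (T : filling) i := [seq x <- [seq T i j | j <- iota 0 N] | 0 < x].
(** The row reading word of a filling that vanishes outside an [N] by [N]
    square. *)
Definition fread N T := flatten [seq rowf N T i | i <- rev (iota 0 N)].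

(** Fillings, increasing along rows and columns, of the skew shape with the
    columns from [l i] to [m i - 1] in row [i], except that the boxes in [H] are
    empty.  The conditions on rows and columns compare all pairs
    of entries, hence also the entries on either side of an empty box. *)
Record skewf (l m : nat -> nat) (H : nat -> nat -> bool) (T : filling) : Prop := Skewf {
  sk_l : forall i, l i.+1 <= l i;
  sk_m : forall i, m i.+1 <= m i;
  sk_lm : forall i, l i <= m i;
  sk_supp : forall i j, (0 < T i j) = (l i <= j < m i) && ~~ H i j;
  sk_row : forall i j j', j < j' -> 0 < T i j -> 0 < T i j' -> T i j < T i j';
  sk_col : forall i i' j, i < i' -> 0 < T i j -> 0 < T i' j -> T i j < T i' j }.

(** The shape with row lengths [m] fits in an [N] by [N] square. *)
Definition bnd N (m : nat -> nat) :=
  (forall i, m i <= N) /\ (forall i, N <= i -> m i = 0).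

Definition nohole : nat -> nat -> bool := fun _ _ => false.
Definition hole (i j : nat) : nat -> nat -> bool := fun i' j' => (i' == i) && (j' == j).

Lemma nonincr_leq (f : nat -> nat) : (forall i, f i.+1 <= f i) ->
  forall i j, i <= j -> f j <= f i.
Proof.
move=> fP i j; elim: j => [|j IH]; first by rewrite leqn0 => /eqP ->.
rewrite leq_eqVlt => /orP[/eqP -> //|]; rewrite ltnS => /IH; exact: leq_trans.
Qed.

Lemma filter_iota N (P : pred nat) s : sorted ltn s ->
  (forall x, (x \in s) = (x < N) && P x) -> filter P (iota 0 N) = s.
Proof.
move=> ss sP; apply: (irr_sorted_eq ltn_trans ltnn) => // [|x].
  by apply: sorted_filter; [exact: ltn_trans|exact: iota_ltn_sorted].
by rewrite mem_filter mem_iota sP /= add0n andbC.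
Qed.

Lemma rowfE N T i s : sorted ltn s ->
  (forall j, (j \in s) = (j < N) && (0 < T i j)) -> rowf N T i = [seq T i j | j <- s].
Proof.
by move=> ss sP; rewrite /rowf filter_map (filter_iota ss).
Qed.

Lemma eq_rowf N T T' i : T i =1 T' i -> rowf N T i = rowf N T' i.
Proof. by move=> e; rewrite /rowf (eq_map e). Qed.

(** A horizontal slide exchanges an entry with a 0, which is not read. *)
Lemma rowf_right N T i j : T i j = 0 -> j.+1 < N ->
  rowf N (setbox (setbox T i j (T i j.+1)) i j.+1 0) i = rowf N T i.
Proof.
move=> T0 jN; rewrite /rowf.
have -> : N = j + (N - j.+2).+2 by lia.
set g := setbox _ _ _ _.
have gE x : g i x = if x == j.+1 then 0 else if x == j then T i j.+1 else T i x.
  by rewrite /g /setbox eqxx.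
have E s : j \notin s -> j.+1 \notin s -> [seq g i x | x <- s] = [seq T i x | x <- s].
  move=> h1 h2; apply/eq_in_map => x xs; rewrite gE.
  by rewrite ifN ?ifN //; [apply: contraNneq h1|apply: contraNneq h2] => <-.
rewrite iotaD !map_cat !filter_cat /= !add0n !gE !eqxx (ltn_eqF (ltnSn j)) T0 /=.
by rewrite !E // mem_iota; lia.
Qed.

(** The entry moved left is smaller than the one below the empty box by the rule
    of the slide; it exceeds the entries above by comparison with those of its
    old column. *)
Lemma skewf_right l m T i j : skewf l m (hole i j) T ->
  l i <= j -> 0 < T i j.+1 -> T i.+1 j = 0 \/ T i j.+1 < T i.+1 j ->
  skewf l m (hole i j.+1) (setbox (setbox T i j (T i j.+1)) i j.+1 0).
Proof.
case=> sl sm slm ss sr sc lij T1 T2; set g := setbox _ _ _ _.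
have Lm : j.+1 < m i by have := T1; rewrite ss => /andP[/andP[]].
have gE x y : g x y = if (x == i) && (y == j.+1) then 0 else
                      if (x == i) && (y == j) then T i j.+1 else T x y.
  by [].
split=> //.
- move=> x y; rewrite gE /hole.
  have [->|xi] := eqVneq x i; last by rewrite /= ss /hole (negPf xi).
  have [->|y1] := eqVneq y j.+1; first by rewrite andbF.
  have [->|yj] := eqVneq y j; first by rewrite /= T1; lia.
  by rewrite /= ss /hole eqxx (negPf yj).
- move=> x y y' yy'; rewrite !gE; have [->|_] /= := eqVneq x i; last exact: sr.
  have [//|y1] := eqVneq y j.+1; have [//|y1'] := eqVneq y' j.+1.
  have [yj|yj] := eqVneq y j; have [yj'|yj'] := eqVneq y' j; first lia.
  + by move=> _; apply: sr => //; lia.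
  + by move=> h _; apply: sr => //; lia.
  + exact: sr.
- move=> x x' y xx'; rewrite !gE.
  case: (x =P i) => [xi|xi] /=; case: (x' =P i) => [xi'|xi'] /=; first lia.
  + subst x; have [//|y1] := eqVneq y j.+1; have [yj|yj] := eqVneq y j; last exact: sc.
    subst y => _ Tx'; case: T2 => [T2|T2].
      have : 0 < T i.+1 j = false by rewrite T2.
      rewrite ss /hole (gtn_eqF (ltnSn i)) /= andbT => h.
      have h1 := sl i; have := Tx'; rewrite ss => /andP[/andP[_ h2] _].
      by have := nonincr_leq sm xx'; lia.
    apply: (leq_trans T2); move: xx'; rewrite leq_eqVlt => /orP[/eqP -> //|xx'].
    by apply: ltnW; apply: sc => //; apply: leq_ltn_trans T2.
  + subst x'; have [//|y1] := eqVneq y j.+1; have [yj|yj] := eqVneq y j; last exact: sc.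
    subst y => Tx _; apply: (@ltn_trans (T x j.+1)).
      apply: sr => //; rewrite ss /hole.
      have h1 := nonincr_leq sm (ltnW xx'); have := Tx; rewrite ss => /andP[/andP[h2 _] _].
      by move: xi => /eqP /negPf -> /=; lia.
    apply: sc => //; rewrite ss /hole.
    have h1 := nonincr_leq sm (ltnW xx'); have := Tx; rewrite ss => /andP[/andP[h2 _] _].
    by move: xi => /eqP /negPf -> /=; lia.
  + exact: sc.
Qed.

Lemma skewf_down l m T i j : skewf l m (hole i j) T ->
  l i <= j < m i -> 0 < T i.+1 j -> T i j.+1 = 0 \/ T i.+1 j < T i j.+1 ->
  skewf l m (hole i.+1 j) (setbox (setbox T i j (T i.+1 j)) i.+1 j 0).
Proof.
case=> sl sm slm ss sr sc lij T1 T2; set g := setbox _ _ _ _.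
have Lm : l i.+1 <= j < m i.+1 by have := T1; rewrite ss => /andP[/andP[-> ->]].
have gE x y : g x y = if (x == i.+1) && (y == j) then 0 else
                      if (x == i) && (y == j) then T i.+1 j else T x y.
  by [].
split=> //.
- move=> x y; rewrite gE /hole.
  have [->|yj] := eqVneq y j; last by rewrite !andbF ss /hole (negPf yj) andbF.
  have [->|xi1] := eqVneq x i.+1; first by rewrite andbF.
  have [->|xi] := eqVneq x i; first by rewrite /= T1; lia.
  by rewrite /= ss /hole (negPf xi).
- move=> x y y' yy'; rewrite !gE.
  case: (x =P i.+1) => [->|/eqP xi1] /=.
    have [//|_] := eqVneq y j; have [//|_] := eqVneq y' j.
    by rewrite (gtn_eqF (ltnSn i)) /=; apply: sr.
  case: (x =P i) => [->|/eqP xi] /=; last exact: sr.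
  have [yj|yj] := eqVneq y j; have [yj'|yj'] := eqVneq y' j; first lia.
  + subst y => _ Ty'; case: T2 => [T2|T2].
      have : 0 < T i j.+1 = false by rewrite T2.
      rewrite ss /hole eqxx (gtn_eqF (ltnSn j)) /= andbT => h.
      by have := Ty'; rewrite ss => /andP[/andP[_ h2] _]; lia.
    apply: (leq_trans T2); move: yy'; rewrite leq_eqVlt => /orP[/eqP -> //|yy'].
    by apply: ltnW; apply: sr => //; apply: leq_ltn_trans T2.
  + subst y' => Ty _; apply: (@ltn_trans (T i.+1 y)).
      apply: sc => //; rewrite ss /hole.
      have h1 := sl i; have := Ty; rewrite ss => /andP[/andP[h2 _] _].
      by rewrite (gtn_eqF (ltnSn i)) /=; lia.
    apply: sr => //; rewrite ss /hole.
    have h1 := sl i; have := Ty; rewrite ss => /andP[/andP[h2 _] _].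
    by rewrite (gtn_eqF (ltnSn i)) /=; lia.
  + exact: sr.
- move=> x x' y xx'; rewrite !gE.
  case: (y =P j) => [->|_]; rewrite ?andbF ?andbT; last exact: sc.
  have [//|xi1] := eqVneq x i.+1; have [//|xi1'] := eqVneq x' i.+1.
  have [xi|xi] := eqVneq x i; have [xi'|xi'] := eqVneq x' i; first lia.
  + by move=> _; apply: sc => //; lia.
  + by move=> h _; apply: sc => //; lia.
  + exact: sc.
Qed.

Lemma row_cols l m H T i s : skewf l m H T -> sorted ltn s ->
  all (fun j => 0 < T i j) s -> isrow [seq T i j | j <- s].
Proof.
move=> sT; rewrite (sorted_pairwise ltn_trans) pairwise_map.
elim: s => //= y s IH /andP[ys ss] /andP[Ty Ts]; rewrite IH // andbT.
apply/allP => z zs; apply: (sk_row sT) => //; first exact: (allP ys).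
exact: (allP Ts).
Qed.

Lemma sorted_iota a n : sorted ltn (iota a n).
Proof. exact: iota_ltn_sorted. Qed.

Lemma sorted_iota_cat a n b p : a + n <= b -> sorted ltn (iota a n ++ iota b p).
Proof.
move=> ab; rewrite (sorted_pairwise ltn_trans) pairwise_cat.
rewrite -!(sorted_pairwise ltn_trans) !sorted_iota !andbT.
by apply/allrelP => x y; rewrite !mem_iota; lia.
Qed.

Lemma all2_map_lt (f g : nat -> nat) s :
  {in s, forall x, f x < g x} -> all2 ltn [seq f x | x <- s] [seq g x | x <- s].
Proof.
elim: s => //= x s IH fg; rewrite fg ?inE ?eqxx //= IH // => y ys.
by apply: fg; rewrite inE ys orbT.
Qed.

Lemma fread_split N T i : i.+1 < N ->
  fread N T = flatten [seq rowf N T r | r <- rev (iota i.+2 (N - i.+2))] ++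
    rowf N T i.+1 ++ rowf N T i ++ flatten [seq rowf N T r | r <- rev (iota 0 i)].
Proof.
move=> iN; have e : iota 0 N = iota 0 i ++ [:: i, i.+1 & iota i.+2 (N - i.+2)].
  have {1}-> : N = i + (N - i.+2).+2 by lia.
  by rewrite iotaD.
rewrite /fread e rev_cat /= !rev_cons -!cats1 !map_cat !flatten_cat /= !cats0.
by rewrite -!catA.
Qed.

Lemma fread_right N T i j : T i j = 0 -> j.+1 < N ->
  fread N (setbox (setbox T i j (T i j.+1)) i j.+1 0) = fread N T.
Proof.
move=> T0 jN; rewrite /fread; congr flatten; apply: eq_map => r.
have [->|ri] := eqVneq r i; first exact: rowf_right.
by apply: eq_rowf => y; rewrite /setbox (negPf ri).
Qed.

(** The rows [i] and [i + 1] of the reading word are in the situation of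
    [knuth_slide_down]: the columns up to [j] give [a] and [c1], those between
    [j] and the end of row [i + 1] give [b1] and [d]. *)
Lemma fread_down N l m T i j : skewf l m (hole i j) T -> bnd N m ->
  l i <= j < m i -> 0 < T i.+1 j -> T i j.+1 = 0 \/ T i.+1 j < T i j.+1 ->
  knuth (fread N T)
        (fread N (setbox (setbox T i j (T i.+1 j)) i.+1 j 0)).
Proof.
move=> sT [mN m0] lij T1 T2; have sg := skewf_down sT lij T1 T2.
set g := setbox _ _ _ _ in sg *.
have Lm : l i.+1 <= j < m i.+1.
  by have := T1; rewrite (sk_supp sT) => /andP[/andP[-> ->]].
have iN : i.+1 < N by rewrite ltnNge; apply/negP => /m0; lia.
have gE x y : g x y = if (x == i.+1) && (y == j) then 0 else
                      if (x == i) && (y == j) then T i.+1 j else T x y by [].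
have [li mi lmi miN] := And4 (sk_l sT i) (sk_m sT i) (sk_lm sT i) (mN i).
have i1 : (i.+1 == i) = false by lia.
have i2 : (i == i.+1) = false by lia.
rewrite !(fread_split _ iN).
have E s : i \notin s -> i.+1 \notin s ->
    [seq rowf N g r | r <- s] = [seq rowf N T r | r <- s].
  move=> is_ i1s; apply/eq_in_map => r rs; apply: eq_rowf => y; rewrite gE.
  by rewrite (negPf (memPn i1s _ rs)) (negPf (memPn is_ _ rs)).
rewrite !E ?mem_rev ?mem_iota; try by [|lia].
apply: knuth_catl; rewrite !catA; apply: knuth_catr.
pose A := iota (l i) (j - l i); pose B1 := iota j.+1 (m i.+1 - j.+1).
pose B2 := iota (m i.+1) (m i - m i.+1).
pose C0 := iota (l i.+1) (l i - l i.+1).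
have eB : B1 ++ B2 = iota j.+1 (m i - j.+1).
  have -> : m i - j.+1 = (m i.+1 - j.+1) + (m i - m i.+1) by lia.
  by rewrite iotaD; congr (_ ++ iota _ _); lia.
have eA : A ++ j :: B1 ++ B2 = iota (l i) (m i - l i).
  have -> : m i - l i = (j - l i) + (m i - j.+1).+1 by lia.
  by rewrite iotaD /= -/A eB; congr (_ ++ _ :: iota _ _); lia.
have eAj : A ++ j :: B1 = iota (l i) (m i.+1 - l i).
  have -> : m i.+1 - l i = (j - l i) + (m i.+1 - j.+1).+1 by lia.
  by rewrite iotaD /= -/A; congr (_ ++ _ :: iota _ _); lia.
have eC : C0 ++ A = iota (l i.+1) (j - l i.+1).
  have -> : j - l i.+1 = (l i - l i.+1) + (j - l i) by lia.
  by rewrite iotaD; congr (_ ++ iota _ _); lia.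
have eCj : C0 ++ A ++ j :: B1 = iota (l i.+1) (m i.+1 - l i.+1).
  have -> : m i.+1 - l i.+1 = (l i - l i.+1) + (m i.+1 - l i) by lia.
  by rewrite iotaD eAj; congr (_ ++ iota _ _); lia.
have r1 : rowf N T i.+1 = [seq T i.+1 y | y <- C0 ++ A ++ j :: B1].
  apply: rowfE; first by rewrite eCj sorted_iota.
  move=> y; rewrite eCj mem_iota (sk_supp sT) /hole i1 /= andbT.
  by have := mN i.+1; lia.
have r2 : rowf N T i = [seq T i y | y <- A ++ B1 ++ B2].
  rewrite eB; apply: rowfE; first by apply: sorted_iota_cat; lia.
  by move=> y; rewrite mem_cat !mem_iota (sk_supp sT) /hole eqxx /=; lia.
have r3 : rowf N g i.+1 = [seq g i.+1 y | y <- C0 ++ A ++ B1].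
  rewrite catA eC; apply: rowfE; first by apply: sorted_iota_cat; lia.
  move=> y; rewrite mem_cat !mem_iota (sk_supp sg) /hole eqxx /=.
  by have := mN i.+1; lia.
have r4 : rowf N g i = [seq g i y | y <- A ++ j :: B1 ++ B2].
  rewrite eA; apply: rowfE; first exact: sorted_iota.
  by move=> y; rewrite mem_iota (sk_supp sg) /hole i2 /=; lia.
have gT x s : j \notin s -> [seq g x y | y <- s] = [seq T x y | y <- s].
  move=> js; apply/eq_in_map => y ys; rewrite gE.
  by rewrite (negPf (memPn js _ ys)) !andbF.
have jA : j \notin A by rewrite mem_iota; lia.
have jB1 : j \notin B1 by rewrite mem_iota; lia.
have jB2 : j \notin B2 by rewrite mem_iota; lia.
have jC0 : j \notin C0 by rewrite mem_iota; lia.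
have gij : g i j = T i.+1 j by rewrite gE i2 !eqxx.
rewrite r1 r2 r3 r4 !map_cat /= !map_cat !gT // gij -!catA.
apply: knuth_slide_down.
- rewrite -[_ :: _]/([seq T i.+1 y | y <- j :: B1]) -map_cat eAj.
  apply: (row_cols sT) => //; first exact: sorted_iota.
  by apply/allP => y; rewrite mem_iota (sk_supp sT) /hole i1 /=; lia.
- apply: all2_map_lt => y; rewrite mem_iota => yA.
  by apply: (sk_col sT) => //; rewrite (sk_supp sT) /hole ?eqxx ?i1 /=; lia.
- apply: (row_cols sT); first exact: sorted_iota.
  by apply/allP => y; rewrite mem_iota (sk_supp sT) /hole eqxx /=; lia.
- apply: all2_map_lt => y; rewrite mem_iota => yA.
  by apply: (sk_col sT) => //; rewrite (sk_supp sT) /hole ?eqxx ?i1 /=; lia.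
- rewrite -gij -(gT i B1) // -[_ :: _]/([seq g i y | y <- j :: B1]).
  apply: (row_cols sg); first exact: (sorted_iota j (m i.+1 - j.+1).+1).
  by apply/allP => y; rewrite inE mem_iota (sk_supp sg) /hole i2 /=; lia.
Qed.

Lemma skewf_stop l m T i j : skewf l m (hole i j) T -> l i <= j < m i ->
  T i j.+1 = 0 -> T i.+1 j = 0 ->
  skewf l (fun r => m r - (r == i)) nohole T.
Proof.
case=> sl sm slm ss sr sc lij T1 T2.
have e1 : m i = j.+1.
  have : 0 < T i j.+1 = false by rewrite T1.
  by rewrite ss /hole (gtn_eqF (ltnSn j)) andbF andbT; lia.
have e2 : m i.+1 <= j.
  have : 0 < T i.+1 j = false by rewrite T2.
  by rewrite ss /hole (gtn_eqF (ltnSn i)) /= andbT; have := sl i; lia.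
split=> //.
- move=> x; have := sm x; have [->|xi] := eqVneq x i.
    by rewrite (gtn_eqF (ltnSn i)); lia.
  by have [->|xi'] := eqVneq x.+1 i; lia.
- by move=> x; have := slm x; have [->|xi] := eqVneq x i; lia.
- move=> x y; rewrite ss /hole /nohole andbT.
  by have [->|xi] := eqVneq x i; lia.
Qed.

(** The plactic class of the reading word is preserved by each elementary move,
    and the box where the slide stops is removed from the outer shape. *)
Lemma slide_skewf N i j T U : slide i j T U ->
  forall l m, skewf l m (hole i j) T -> bnd N m -> l i <= j < m i ->
  exists m', [/\ skewf l m' nohole U, bnd N m' & knuth (fread N T) (fread N U)].
Proof.
elim=> {i j T U} [i j T T1 T2|i j T U T1 T2 _ IH|i j T U T1 T2 _ IH] l m sT Nm lij.
- exists (fun r => m r - (r == i)); split; first exact: (skewf_stop sT).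
    by case: Nm => h1 h2; split=> r *; [apply: leq_trans (h1 r); lia|rewrite h2].
  exact: knuth_refl.
- have T0 : T i j = 0.
    by apply/eqP; rewrite -leqn0 leqNgt (sk_supp sT) /hole !eqxx andbF.
  have Lm : j.+1 < m i by have := T1; rewrite (sk_supp sT) => /andP[/andP[]].
  have lij' : l i <= j by case/andP: lij.
  have [|m' [h1 h2 h3]] := IH _ _ (skewf_right sT lij' T1 T2) Nm; first lia.
  exists m'; split=> //; move: h3; rewrite fread_right //.
  by case: Nm => /(_ i); lia.
- have Lm : l i.+1 <= j < m i.+1.
    by have := T1; rewrite (sk_supp sT) => /andP[/andP[-> ->]].
  have [|m' [h1 h2 h3]] := IH _ _ (skewf_down sT lij T1 T2) Nm; first lia.
  exists m'; split=> //; apply: knuth_trans h3.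
  exact: fread_down Nm lij T1 T2.
Qed.

(** A move is possible as soon as the entries to the right of the empty box and
    below it differ, which follows from [uniq]. *)
Lemma slide_exists N l m T i j : skewf l m (hole i j) T -> bnd N m ->
  l i <= j < m i -> uniq (fread N T) -> exists U, slide i j T U.
Proof.
have [k] := ubnP (N - i + (N - j)); elim: k i j T => // k IH i j T kN sT Nm lij UT.
have [T1|T1] := posnP (T i j.+1); have [T2|T2] := posnP (T i.+1 j).
- by exists T; apply: slide_stop.
- have Lm : l i.+1 <= j < m i.+1.
    by have := T2; rewrite (sk_supp sT) => /andP[/andP[-> ->]].
  have iN : i.+1 < N by rewrite ltnNge; apply/negP => /(proj2 Nm); lia.
  have [|||U HU] := IH i.+1 j _ _ (skewf_down sT lij T2 (or_introl T1)) Nm; try lia;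
    first by rewrite -(perm_uniq (knuth_perm (fread_down sT Nm lij T2 (or_introl T1)))).
  by exists U; apply: slide_down => //; left.
- have T0 : T i j = 0.
    by apply/eqP; rewrite -leqn0 leqNgt (sk_supp sT) /hole !eqxx andbF.
  have Lm : j.+1 < m i by have := T1; rewrite (sk_supp sT) => /andP[/andP[]].
  have lij' : l i <= j by case/andP: lij.
  have miN := proj1 Nm i.
  have [|||U HU] := IH i j.+1 _ _ (skewf_right sT lij' T1 (or_introl T2)) Nm; try lia;
    first by rewrite fread_right //; lia.
  by exists U; apply: slide_right => //; left.
have T0 : T i j = 0.
  by apply/eqP; rewrite -leqn0 leqNgt (sk_supp sT) /hole !eqxx andbF.
have Lm : l i.+1 <= j < m i.+1.
  by have := T2; rewrite (sk_supp sT) => /andP[/andP[-> ->]].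
have Lm' : j.+1 < m i by have := T1; rewrite (sk_supp sT) => /andP[/andP[]].
have lij' : l i <= j by case/andP: lij.
have iN : i.+1 < N by rewrite ltnNge; apply/negP => /(proj2 Nm); lia.
have miN := proj1 Nm i.
have [h|h] := ltnP (T i j.+1) (T i.+1 j).
  have [|||U HU] := IH i j.+1 _ _ (skewf_right sT lij' T1 (or_intror h)) Nm; try lia;
    first by rewrite fread_right //; lia.
  by exists U; apply: slide_right => //; right.
have {}h : T i.+1 j < T i j.+1.
  rewrite ltn_neqAle h andbT; apply/eqP => e.
  move: UT; rewrite (fread_split _ iN) cat_uniq => /and3P[_ _].
  rewrite cat_uniq => /and3P[_ /hasPn K _].
  have /K /negP : T i j.+1 \in rowf N T i ++
      flatten [seq rowf N T r | r <- rev (iota 0 i)].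
    by rewrite mem_cat mem_filter T1 map_f // mem_iota; lia.
  by apply; rewrite /= -e mem_filter T2 map_f // mem_iota; lia.
have [|||U HU] := IH i.+1 j _ _ (skewf_down sT lij T2 (or_intror h)) Nm; try lia;
  first by rewrite -(perm_uniq (knuth_perm (fread_down sT Nm lij T2 (or_intror h)))).
by exists U; apply: slide_down => //; right.
Qed.

Lemma eq_skewf l l' m m' H T : l =1 l' -> m =1 m' -> skewf l m H T -> skewf l' m' H T.
Proof.
move=> el em [h1 h2 h3 h4 h5 h6]; split=> // *.
- by rewrite -!el. - by rewrite -!em. - by rewrite -el -em. - by rewrite -el -em.
Qed.

Definition straight := skewf (fun=> 0).

Lemma is_part_part (s : seq nat) : is_part s -> forall i, part s i.+1 <= part s i.
Proof.
rewrite /is_part /part => /andP[ss _]; elim: s ss => [|x s IH] ss i;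
  first by rewrite !nth_nil.
case: i => [|i] /=; last by apply: IH; apply: path_sorted ss.
by case: s ss {IH} => //= y s /andP[].
Qed.

Lemma is_partI (s : seq nat) : 0 \notin s -> (forall i, part s i.+1 <= part s i) ->
  is_part s.
Proof.
move=> s0 sP; rewrite /is_part s0 andbT.
elim: s {s0} sP => // x s IH sP; have ss := IH (fun i => sP i.+1).
by move: (sP 0) {IH}; case: s sP ss => //= y s _ -> ->.
Qed.

Lemma part_size s i : 0 \notin s -> (0 < part s i) = (i < size s).
Proof.
move=> s0; have [is_|si] := ltnP i (size s); last by rewrite /part nth_default.
by rewrite lt0n; apply: contraNneq s0 => <-; apply: mem_nth.
Qed.

Lemma rect_knuth N la S U : rectifies la S U -> forall m,
  skewf (part la) m nohole S -> bnd N m ->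
  exists m', [/\ straight m' nohole U, bnd N m' & knuth (fread N S) (fread N U)].
Proof.
elim=> {la S U} [la S e|la la' i S S' U c e sl _ IH] m sS Nm.
  exists m; split=> //; last exact: knuth_refl.
  by apply: eq_skewf sS => // r; rewrite /part e nth_nil.
have l0 : 0 < part la i by apply: leq_ltn_trans c.
have sH : skewf (part la') m (hole i (part la i).-1) S.
  case: sS => h1 h2 h3 h4 h5 h6; split=> //.
  - move=> r; rewrite !e; have := h1 r.
    have [->|ri] := eqVneq r i; first by rewrite (gtn_eqF (ltnSn i)); lia.
    by have [ri'|ri'] := eqVneq r.+1 i; lia.
  - by move=> r; rewrite e; have := h3 r; lia.
  - move=> r y; rewrite h4 /nohole /hole e andbT.
    by have := h3 r; have [->|ri] := eqVneq r i; lia.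
have [|m1 [s1 N1 K1]] := slide_skewf sl sH Nm.
  by rewrite e eqxx; case: sS => _ _ /(_ i); lia.
have [m2 [s2 N2 K2]] := IH _ s1 N1.
by exists m2; split=> //; apply: knuth_trans K2.
Qed.

(** Slides into the last box of the last row of the inner shape. *)
Lemma rect_exists N (la : intpart) S m : skewf (part la) m nohole S -> bnd N m ->
  uniq (fread N S) -> exists U, rectifies la S U.
Proof.
have [k] := ubnP (sumn la); elim: k la S m => // k IH la S m lk sS Nm US.
case: la lk sS => s ps; rewrite /= => lk sS; have [ss s0] := andP ps.
case/lastP: s lk ps sS ss s0 => [|s x] lk ps sS ss s0.
  by exists S; apply: rect_done.
pose i := size s; set la := IntPart ps.
have li : part la i = x by rewrite /part /= nth_rcons ltnn eqxx.
have li1 : part la i.+1 = 0 by rewrite /part /= nth_default // size_rcons.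
have x0 : 0 < x by rewrite -li part_size //= size_rcons.
(* the inner shape without the last box of its last row *)
pose s' := if x == 1 then s else rcons s x.-1.
have e' r : part s' r = part la r - (r == i).
  rewrite /part /= nth_rcons -/i /s'; case: eqP => x1; rewrite ?nth_rcons -/i.
    have [h|h|h] := ltngtP r i; rewrite ?subn0 //; last by rewrite nth_default ?h // x1.
    by rewrite nth_default // ltnW.
  by have [h|h|h] := ltngtP r i; rewrite ?subn0 ?subn1.
have ps' : is_part s'.
  apply: is_partI => [|r].
    move: s0; rewrite mem_rcons inE negb_or => /andP[_ s0]; rewrite /s'.
    case: eqP => // x1; rewrite mem_rcons inE negb_or s0 andbT; lia.
  rewrite !e'; have h0 : part la r.+1 <= part la r := is_part_part ps r.
  have [->|ri] := eqVneq r i; first by rewrite li1.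
  by have [h|h] := eqVneq r.+1 i; lia.
have e r : part (IntPart ps') r = part la r - (r == i) := e' r.
have c : part la i.+1 < part la i by rewrite li li1.
have l0 := x0; rewrite -li in l0.
have sH : skewf (part (IntPart ps')) m (hole i (part la i).-1) S.
  case: sS => h1 h2 h3 h4 h5 h6; split=> //.
  - exact: is_part_part ps'.
  - by move=> r; rewrite e; have h0 : part la r <= m r := h3 r; lia.
  - move=> r y; have -> : (0 < S r y) = (part la r <= y < m r) && true := h4 r y.
    rewrite /hole e; by have h0 : part la r <= m r := h3 r; have [->|ri] := eqVneq r i; lia.
have lij : part (IntPart ps') i <= (part la i).-1 < m i.
  by rewrite e eqxx; have h0 : part la i <= m i := sk_lm sS i; lia.
have [S' sl] := slide_exists sH Nm lij US.
have [m1 [s1 N1 K1]] := slide_skewf sl sH Nm lij.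
have [||U HU] := IH (IntPart ps') S' m1 _ s1 N1.
- rewrite /= /s'; move: lk; rewrite sumn_rcons; case: eqP => x1; rewrite ?sumn_rcons; lia.
- by rewrite -(perm_uniq (knuth_perm K1)).
by exists U; apply: (rect_step c e sl HU).
Qed.

(** Tableaux as lists of rows, turned into fillings. *)
Definition fill (t : seq (seq nat)) : filling := fun i j => nth 0 (nth [::] t i) j.

Lemma dom_nth r s j : dom r s -> j < size s -> nth 0 r j < nth 0 s j.
Proof. by elim: s r j => // y s IH [|x r] [|j] //= /andP[xy rs]; rewrite ltnS;
  [|apply: IH]. Qed.

Lemma domI r s : size s <= size r -> (forall j, j < size s -> nth 0 r j < nth 0 s j) ->
  dom r s.
Proof.
elim: s r => // y s IH [|x r] //=; rewrite ltnS => sr h.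
by rewrite (h 0) //= IH // => j; apply: (h j.+1).
Qed.

Lemma tabI t :
  (forall i, i < size t -> nth [::] t i != [::] /\ isrow (nth [::] t i)) ->
  (forall i, dom (nth [::] t i) (nth [::] t i.+1)) -> tab t.
Proof.
elim: t => // r t IH h1 h2; have [/= -> ->] := h1 0 isT.
rewrite /= IH; [|by move=> i; apply: (h1 i.+1)|by move=> i; apply: (h2 i.+1)].
by rewrite andbT -nth0; apply: (h2 0).
Qed.

(** Back from fillings of a straight shape to lists of rows. *)
Lemma straightP N m U : straight m nohole U -> bnd N m -> exists t,
  [/\ tab t, fill t = U, 0 \notin flatten t, nth 0 (shape t) =1 m &
      forall N', bnd N' m -> rdw t = fread N' U].
Proof.
move=> sU [mN m0]; have mP := nonincr_leq (sk_m sU).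
(* [k] is the number of nonempty rows *)
have [k mk kmin] : exists2 k, m k = 0 & forall k', m k' = 0 -> k <= k'.
  have ex : exists k, m k == 0 by exists N; rewrite m0.
  exists (ex_minn ex); first by case: ex_minnP => k /eqP.
  by move=> k' /eqP; case: ex_minnP => k _ h /h.
have km i : (0 < m i) = (i < k).
  have [ki|ik] := leqP k i; first by have := mP _ _ ki; rewrite mk; lia.
  by rewrite lt0n; apply/eqP => /kmin; lia.
have Us i j : (0 < U i j) = (j < m i) by rewrite (sk_supp sU) /nohole andbT.
have U0 i j : m i <= j -> U i j = 0.
  by move=> h; apply/eqP; rewrite -leqn0 leqNgt Us -leqNgt.
pose t := mkseq (fun i => mkseq (U i) (m i)) k.
have tE i : nth [::] t i = mkseq (U i) (m i).
  have [ki|ik] := leqP k i; last by rewrite nth_mkseq.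
  by rewrite nth_default ?size_mkseq //; move: (km i); rewrite (ltnNge i) ki /=;
    case: (m i).
have tab_t : tab t.
  apply: tabI => i; rewrite !tE ?size_mkseq.
    move=> ik; split; first by rewrite -size_eq0 size_mkseq -lt0n km.
    apply: (row_cols sU); first exact: sorted_iota.
    by apply/allP => j; rewrite mem_iota Us.
  apply: domI; rewrite !size_mkseq; first exact: (sk_m sU).
  move=> j jm; have jm' := leq_trans jm (sk_m sU i).
  by rewrite !nth_mkseq //; apply: (sk_col sU) => //; rewrite Us.
exists t; split=> //.
- apply/funext => i; apply/funext => j; rewrite /fill tE.
  by have [h|h] := ltnP j (m i); [rewrite nth_mkseq|rewrite nth_default ?size_mkseq // U0].
- apply/negP => /flattenP[r /mapP[i _ ->]] /mapP[j].
  by rewrite mem_iota add0n /= -Us => /[swap] <-.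
- move=> i; have [ki|ik] := leqP k i; last first.
    by rewrite (nth_map [::]) ?size_mkseq // tE size_mkseq.
  rewrite nth_default ?size_map ?size_iota //.
  by apply/esym/eqP; rewrite -leqn0 leqNgt km -leqNgt.
- move=> N' [mN' m0']; have kN : k <= N' by apply: kmin; apply: m0'.
  rewrite /fread; have -> : N' = k + (N' - k) by lia.
  rewrite iotaD rev_cat map_cat flatten_cat.
  have -> : [seq rowf (k + (N' - k)) U i | i <- rev (iota (0 + k) (N' - k))] =
            [seq [::] | i <- rev (iota (0 + k) (N' - k))].
    apply/eq_in_map => i; rewrite mem_rev mem_iota => /andP[ki _].
    rewrite (@rowfE _ _ _ [::]) // => j; rewrite Us.
    by have := km i; rewrite (ltnNge i) ki /=; case: (m i) => // _; rewrite andbF.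
  have -> : forall s : seq nat, flatten [seq [::] : seq nat | i <- s] = [::] by elim.
  rewrite /rdw /t /mkseq -map_rev; congr flatten; apply/eq_in_map => i _.
  rewrite (@rowfE _ _ _ (iota 0 (m i))) ?sorted_iota // => j.
  by rewrite mem_iota Us add0n /= andb_idl //; have := mN' i; lia.
Qed.

Lemma tab_row t i : tab t -> i < size t -> nth [::] t i != [::] /\ isrow (nth [::] t i).
Proof. by elim: t i => // r t IH [|i] /and4P[rN rr _ T] //=; apply: IH. Qed.

Lemma tab_dom t i : tab t -> dom (nth [::] t i) (nth [::] t i.+1).
Proof.
elim: t i => [|r t IH] i; first by rewrite !nth_nil.
by move=> /and4P[_ _ D T]; case: i => [|i] /=; [rewrite nth0|apply: IH].
Qed.

Lemma nth_shape (t : seq (seq nat)) i : nth 0 (shape t) i = size (nth [::] t i).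
Proof. by rewrite /shape; elim: t i => [|r t IH] [|i] //=. Qed.

Lemma fill_supp t i j : 0 \notin flatten t ->
  (0 < fill t i j) = (j < nth 0 (shape t) i).
Proof.
move=> t0; rewrite nth_shape /fill; have [it|ti] := ltnP i (size t); last first.
  by rewrite [nth [::] t i]nth_default // nth_nil.
have [jr|rj] := ltnP j (size (nth [::] t i)); last by rewrite nth_default.
rewrite lt0n; apply: contraNneq t0 => <-.
by apply/flattenP; exists (nth [::] t i); apply: mem_nth.
Qed.

Lemma tab_straight t : tab t -> 0 \notin flatten t ->
  straight (nth 0 (shape t)) nohole (fill t).
Proof.
move=> T t0; split=> //.
- exact: tab_part.
- by move=> i j; rewrite fill_supp // /nohole andbT.
- move=> i j j' jj'; rewrite !fill_supp // !nth_shape => h1 h2.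
  have it : i < size t.
    by rewrite ltnNge; apply/negP => ti; move: h1; rewrite nth_default.
  have [_ rr] := tab_row T it; rewrite /fill.
  by apply: (sorted_ltn_nth ltn_trans) => //; rewrite (sorted_pairwise ltn_trans).
- move=> i i' j; elim: i' => // i' IH; rewrite ltnS => ii' h1 h2.
  have h3 : 0 < fill t i' j.
    move: h2; rewrite !fill_supp // => /leq_trans; apply; exact: tab_part.
  apply: (@leq_ltn_trans (fill t i' j)).
    by move: ii'; rewrite leq_eqVlt => /orP[/eqP ->//|ii']; apply: ltnW; apply: IH.
  by apply: (dom_nth (tab_dom _ T)); move: h2; rewrite fill_supp // nth_shape.
Qed.

Lemma fill_inj t t' : tab t -> tab t' -> 0 \notin flatten t -> 0 \notin flatten t' ->
  fill t = fill t' -> t = t'.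
Proof.
move=> T T' t0 t0' e.
have es : shape t = shape t'.
  apply: eq_from_nth0; rewrite ?tab_shape_neq0 // => i.
  have ej j : (j < nth 0 (shape t) i) = (j < nth 0 (shape t') i).
    by rewrite -!fill_supp // e.
  by apply/eqP; rewrite eqn_leq leqNgt ej ltnn leqNgt -ej ltnn.
apply: (@eq_from_nth _ [::]) => [|i it].
  by rewrite -(size_map size) -[RHS](size_map size) -/(shape t) es.
apply: (@eq_from_nth _ 0) => [|j _]; first by rewrite -!nth_shape es.
exact: (congr1 (fun f => f i j) e).
Qed.

Lemma tab_fread N t : tab t -> 0 \notin flatten t -> bnd N (nth 0 (shape t)) ->
  rdw t = fread N (fill t).
Proof.
move=> T t0 Nb; have [t' [T' e t0' _ /(_ N Nb) <-]] := straightP (tab_straight T t0) Nb.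
by congr rdw; apply: fill_inj.
Qed.

Lemma bnd_nth (s : seq nat) : bnd (size s + sumn s) (nth 0 s).
Proof.
split=> i; last by move=> h; rewrite nth_default //; apply: leq_trans h; apply: leq_addr.
apply: leq_trans (leq_addl _ _); elim: s i => [|x s IH] [|i] //=.
  exact: leq_addr.
exact: leq_trans (IH i) (leq_addl _ _).
Qed.

Lemma boxesE nu la i j : ((i, j) \in boxes nu la) = (part la i <= j < part nu i).
Proof.
apply/allpairsPdep/idP => [[x [y []]] |h].
  by rewrite !mem_iota => h1 h2 [-> ->]; lia.
exists i, j; split; rewrite // mem_iota; last by lia.
by rewrite /= add0n ltnNge; apply/negP => hi; move: h;
  rewrite /part [nth 0 nu i]nth_default //; lia.
Qed.

(** Both sides list the entries by rows, the reading word in reverse order of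
    the rows. *)
Lemma fread_boxes N nu la S : skewf (part la) (part nu) nohole S ->
  bnd N (part nu) -> size nu <= N ->
  perm_eq (fread N S) [seq S b.1 b.2 | b <- boxes nu la].
Proof.
move=> sS [Nm _] nuN; apply: (@perm_trans _ (flatten [seq rowf N S i | i <- iota 0 N])).
  by rewrite /fread map_rev; apply: perm_flatten; rewrite perm_rev.
have rE i : rowf N S i = [seq S i j | j <- iota (part la i) (part nu i - part la i)].
  apply: rowfE => [|j]; first exact: sorted_iota.
  rewrite (sk_supp sS) /nohole andbT mem_iota; have := Nm i; have := sk_lm sS i; lia.
rewrite (eq_map rE) /boxes map_flatten -map_comp.
have -> : N = size nu + (N - size nu) by lia.
rewrite iotaD map_cat flatten_cat.
have -> : flatten [seq [seq S i j | j <- iota (part la i) (part nu i - part la i)]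
                  | i <- iota (0 + size nu) (N - size nu)] = [::].
  elim: (N - _) (0 + size nu) (leq_addl 0 (size nu)) => //= p IH i hi.
  have -> : part nu i = 0 by rewrite /part nth_default.
  by rewrite IH // leqW.
rewrite cats0; set s1 := flatten _; set s2 := flatten _.
suff -> : s1 = s2 by [].
by congr flatten; apply: eq_map => i /=; rewrite -map_comp.
Qed.

Lemma SYT_skewf (nu la : intpart) S : included la nu -> is_SYT nu la S ->
  skewf (part la) (part nu) nohole S.
Proof.
move=> lanu [So Ss Sr Sc].
have lP i : part la i.+1 <= part la i := is_part_part (valP la) i.
have mP i : part nu i.+1 <= part nu i := is_part_part (valP nu) i.
have lA := nonincr_leq lP.
have supp i j : (0 < S i j) = (part la i <= j < part nu i).
  rewrite -boxesE; apply/idP/idP => [|b]; first by apply: contraTT => /So ->.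
  have : S i j \in [seq S c.1 c.2 | c <- boxes nu la] by apply/mapP; exists (i, j).
  by rewrite (perm_mem Ss) mem_iota => /andP[].
split=> //.
- by move=> i j; rewrite supp /nohole andbT.
- move=> i j j'; rewrite !supp; elim: j' => // j' IH; rewrite ltnS => jj' h1 h2.
  have h3 : part la i <= j' < part nu i by lia.
  apply: (@leq_ltn_trans (S i j')); last by apply: Sr; rewrite boxesE.
  by move: jj'; rewrite leq_eqVlt => /orP[/eqP -> //|jj']; apply: ltnW; apply: IH.
- move=> i i' j; rewrite !supp; elim: i' => // i' IH; rewrite ltnS => ii' h1 h2.
  have h3 : part la i' <= j < part nu i'.
    by have := lA _ _ ii'; have := mP i'; lia.
  apply: (@leq_ltn_trans (S i' j)); last by apply: Sc; rewrite boxesE.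
  by move: ii'; rewrite leq_eqVlt => /orP[/eqP -> //|ii']; apply: ltnW; apply: IH.
Qed.

Lemma skewf_SYT (nu la : seq nat) S n : skewf (part la) (part nu) nohole S ->
  perm_eq [seq S b.1 b.2 | b <- boxes nu la] (iota 1 n) -> is_SYT nu la S.
Proof.
move=> sS Sp; have e : n = size (boxes nu la).
  by rewrite -(size_iota 1 n) -(perm_size Sp) size_map.
have supp i j : (0 < S i j) = ((i, j) \in boxes nu la).
  by rewrite boxesE (sk_supp sS) /nohole andbT.
split.
- by move=> i j; rewrite -supp -leqNgt leqn0 => /eqP.
- by rewrite -e.
- by move=> i j; rewrite -!supp; apply: (sk_row sS).
- by move=> i j; rewrite -!supp; apply: (sk_col sS).
Qed.

(** * Straightening in the anticommuting variables *)

Section Words.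
Local Open Scope ring_scope.
Variable k : comPzRingType.
Implicit Types f g h : ncseries k.

(** The noncommutative monomial of a word. *)
Definition ncword (u : seq nat) : ncseries k := fun w => (w == u)%:R.

Lemma ncmulE f g w : (f * g) w = \sum_(i < (size w).+1) f (take i w) * g (drop i w).
Proof. by []. Qed.

Lemma ncaddE f g w : (f + g) w = f w + g w. Proof. by []. Qed.
Lemma ncoppE f w : (- f) w = - f w. Proof. by []. Qed.
Lemma ncscaleE (c : k) f w : (c *: f) w = c * f w. Proof. by []. Qed.
Lemma ncsumE (I : Type) (r : seq I) (P : pred I) (F : I -> ncseries k) w :
  (\sum_(i <- r | P i) F i) w = \sum_(i <- r | P i) F i w.
Proof. by elim/big_rec2: _ => //= i y1 y2 _ <-. Qed.

Lemma ncwordM u v : ncword u * ncword v = ncword (u ++ v).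
Proof.
apply/funext => w; rewrite ncmulE /ncword.
have [->|wuv] := eqVneq w (u ++ v).
  have lt : (size u < (size (u ++ v)).+1)%N by rewrite size_cat; lia.
  rewrite (bigD1 (Ordinal lt)) //= take_size_cat // drop_size_cat // !eqxx mulr1.
  rewrite big1 ?addr0 // => i /eqP iu; case: eqP => [e|]; last by rewrite mul0r.
  case: iu; apply/val_inj => /=; rewrite -(congr1 size e) size_takel //.
  by have := ltn_ord i.
rewrite big1 // => i _; case: eqP => [e|]; last by rewrite mul0r.
case: eqP => [e'|]; last by rewrite mulr0.
by rewrite -(cat_take_drop i w) e e' eqxx in wuv.
Qed.

Lemma ncmulZr (c : k) f g : f * (c *: g) = c *: (f * g).
Proof. exact/esym/ncscaleAr. Qed.
Lemma ncmulZl (c : k) f g : (c *: f) * g = c *: (f * g).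
Proof. exact/esym/ncscaleAl. Qed.

Lemma ncword_var i : ncword [:: i] = ncvar k i. Proof. by []. Qed.

Lemma anticomm_idealZ (c : k) f : anticomm_ideal f -> anticomm_ideal (c *: f).
Proof.
move=> If; have -> : c *: f = (c *: (1 : ncseries k) : ncseries k) * f;
  last exact: anticomm_idealMl.
by rewrite -[f in LHS]mul1r; apply: ncscaleAl.
Qed.

Lemma anticomm_ideal_trans f g h :
  anticomm_ideal (f - g) -> anticomm_ideal (g - h) -> anticomm_ideal (f - h).
Proof. by move=> fg gh; rewrite -(subrKA g); apply: anticomm_idealD. Qed.

Lemma anticomm_ideal_swap x y : x != y ->
  anticomm_ideal (ncword [:: x; y] + ncword [:: y; x]).
Proof.
move=> xy.
(* the generators of the ideal are indexed by decreasing pairs *)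
wlog lt : x y xy / (y < x)%N.
  move=> W; have [lt|lt|e] := ltngtP y x; first exact: W.
    by rewrite addrC; apply: W => //; rewrite eq_sym.
  by rewrite e eqxx in xy.
exists [:: (1, (x, y), 1)]; first by rewrite /= lt.
by rewrite big_seq1 /= mul1r mulr1 -!ncword_var !ncwordM.
Qed.

Lemma anticomm_ideal_move x u : all (gtn x) u ->
  anticomm_ideal (ncword (x :: u) - (-1) ^+ size u *: ncword (rcons u x)).
Proof.
elim: u => [|y u IH] /=.
  by rewrite expr0 scale1r subrr => _; apply: anticomm_ideal0.
case/andP=> yx /IH {}IH.
apply: (@anticomm_ideal_trans _ (- ncword [:: y, x & u])).
  have := @anticomm_ideal_swap x y; rewrite gtn_eqF // opprK => /(_ isT).
  by move/(anticomm_idealMr (ncword u)); rewrite mulrDl !ncwordM.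
have := anticomm_idealZ (-1) (anticomm_idealMl (ncword [:: y]) IH).
rewrite mulrBr ncwordM scalerBr scaleN1r ncmulZr ncwordM.
by rewrite scalerA exprS.
Qed.

Lemma sort_cons x w : let s := sort leq w in
  sort leq (x :: w) = filter (gtn x) s ++ x :: filter (leq x) s.
Proof.
move=> s; have ss : sorted leq s by apply: sort_sorted; exact: leq_total.
apply: (sorted_eq leq_trans anti_leq).
- by apply: sort_sorted; exact: leq_total.
- rewrite (sorted_pairwise leq_trans) pairwise_cat /= allrel_consr.
  have s1 P : pairwise leq (filter P s) by rewrite -(sorted_pairwise leq_trans)
    sorted_filter //; exact: leq_trans.
  rewrite !s1 filter_all !andbT; apply/andP; split.
    by apply/allP => y; rewrite mem_filter => /andP[/= /ltnW].
  apply/allrelP => y z; rewrite !mem_filter => /andP[/= yx _] /andP[xz _].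
  exact: leq_trans (ltnW yx) xz.
- rewrite perm_sort; apply/seq.permP => a; rewrite count_cat /= addnCA; congr addn.
  rewrite -(seq.permP (permEl (perm_sort leq w)) a) -/s -count_cat.
  have : perm_eq (filter (gtn x) s ++ filter (predC (gtn x)) s) s by rewrite perm_filterC.
  by move/seq.permP/(_ a) => <-; rewrite !count_cat; congr addn; congr count;
    apply: eq_filter => y /=; rewrite -leqNgt.
Qed.

(** Insertion sort: the first letter [x] moves past the smaller letters, with
    one change of sign for each of them ([anticomm_ideal_move]). *)
Lemma anticomm_ideal_sort w :
  anticomm_ideal (ncword w - (-1) ^+ inv w *: ncword (sort leq w)).
Proof.
elim: w => [|x w IH]; first by rewrite expr0 scale1r subrr; apply: anticomm_ideal0.
rewrite sort_cons; set s := sort leq w in IH *.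
set u := filter (gtn x) s; set v := filter (leq x) s.
have es : s = u ++ v.
  apply: (sorted_eq leq_trans anti_leq); first by apply: sort_sorted; exact: leq_total.
    have := sort_cons x w; rewrite -/s -/u -/v => e.
    have : subseq (u ++ v) (sort leq (x :: w)).
      by rewrite e; apply: cat_subseq => //; apply: subseq_cons.
    by move/(subseq_sorted leq_trans); apply; apply: sort_sorted; exact: leq_total.
  have : perm_eq (u ++ filter (predC (gtn x)) s) s by rewrite perm_filterC.
  rewrite perm_sym; congr (perm_eq _ (_ ++ _)); apply: eq_filter => y /=.
  by rewrite -leqNgt.
have e : size u = count (gtn x) w.
  by rewrite size_filter; apply/seq.permP; rewrite perm_sort.
apply: (@anticomm_ideal_trans _ ((-1) ^+ inv w *: ncword (x :: s))).
  have := anticomm_idealMl (ncword [:: x]) IH.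
  by rewrite mulrBr ncwordM ncmulZr ncwordM.
rewrite /= addnC exprD -scalerA -scalerBr; apply: anticomm_idealZ.
rewrite es -e -cat_cons -cat_rcons.
have := @anticomm_ideal_move x u (filter_all _ _).
move/(anticomm_idealMr (ncword v)); rewrite mulrBl ncwordM.
by rewrite ncmulZl ncwordM.
Qed.

(** The series obtained by straightening every word of [f]: its coefficient at
    a weakly increasing word collects all the rearrangements of this word. *)
Definition ncnorm f : ncseries k := fun a =>
  if sorted leq a then \sum_(b <- permutations a) (-1) ^+ inv b * f b else 0.

(** On a finite set of words, closed up under rearrangement, the difference is a
    finite combination of the elements of the ideal given by
    [anticomm_ideal_sort]; this is membership in the closure of the ideal. *)
Lemma oddpi_norm f : oddpi f = oddpi (ncnorm f).
Proof.
apply/oddpi_eq/anticommP => W.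
(* [W] closed up under rearrangement *)
pose W' := undup (flatten [seq permutations w | w <- W]).
exists (\sum_(w <- W') f w *: (ncword w - (-1) ^+ inv w *: ncword (sort leq w))).
  elim: W' => [|w W' IH]; first by rewrite big_nil; apply: anticomm_ideal0.
  rewrite big_cons; apply: anticomm_idealD => //; apply: anticomm_idealZ.
  exact: anticomm_ideal_sort.
move=> a aW; rewrite ncsumE.
have W'a b : perm_eq b a -> b \in W'.
  move=> ba; rewrite mem_undup; apply/flattenP; exists (permutations a).
    exact: map_f.
  by rewrite mem_permutations.
under eq_bigr do rewrite ncscaleE ncaddE ncoppE ncscaleE mulrBr.
rewrite big_split sumrN /=; congr (_ - _).
  rewrite (bigD1_seq a) ?undup_uniq ?W'a //= /ncword eqxx mulr1 big1 ?addr0 //.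
  by move=> b ba; rewrite eq_sym (negPf ba) mulr0.
rewrite /ncnorm; case: ifP => sa; last first.
  rewrite big1 // => b _; rewrite /ncword; case: eqP => [e|]; last by rewrite !mulr0.
  by rewrite e sort_sorted in sa; last exact: leq_total.
have Pa : perm_eq (permutations a) [seq b <- W' | perm_eq b a].
  apply: uniq_perm; rewrite ?permutations_uniq ?filter_uniq ?undup_uniq // => b.
  rewrite mem_permutations mem_filter andb_idr //; exact: W'a.
rewrite (perm_big _ Pa) big_filter big_mkcond; apply: eq_bigr => b _.
rewrite /ncword.
have -> : (a == sort leq b) = perm_eq b a.
  apply/eqP/idP => [->|ba]; first by rewrite perm_sym perm_sort.
  apply: (sorted_eq leq_trans anti_leq) => //; first by apply: sort_sorted;
    exact: leq_total.
  by rewrite perm_sym perm_sort.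
by case: ifP => _; rewrite ?mulr1 ?mulr0 ?mulr0 // mulrC.
Qed.

End Words.

(** * Run-lengths and refinements *)

(** For an increasing [i], the weakly increasing word with letters [i] and
    multiplicities [b]. *)
Definition expand (i b : seq nat) := flatten [seq nseq p.2 p.1 | p <- zip i b].
(** The multiplicities of the letters of [v]; for a weakly increasing [v] they
    are the exponents of its monomial. *)
Definition runlengths (v : seq nat) := [seq count_mem x v | x <- undup v].

Lemma expand_cat i1 i2 b1 b2 : size i1 = size b1 ->
  expand (i1 ++ i2) (b1 ++ b2) = expand i1 b1 ++ expand i2 b2.
Proof. by move=> e; rewrite /expand zip_cat // map_cat flatten_cat. Qed.

Lemma size_expand i b : size i = size b -> size (expand i b) = sumn b.
Proof.
elim: i b => [|x i IH] [|n b] //= [e].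
by rewrite /expand /= size_cat size_nseq -/(expand i b) IH.
Qed.

Lemma mem_expand i b x : x \in expand i b -> x \in i.
Proof.
elim: i b => [|y i IH] [|n b] //=; rewrite /expand /= mem_cat mem_nseq inE.
by case/orP=> [/andP[_ ->] //|/IH ->]; rewrite orbT.
Qed.

Lemma sorted_expand i b : sorted ltn i -> sorted leq (expand i b).
Proof.
rewrite (sorted_pairwise ltn_trans) (sorted_pairwise leq_trans).
elim: i b => [|x i IH] [|n b] //= /andP[xi si].
rewrite /expand /= -/(expand i b) pairwise_cat IH // andbT; apply/andP; split.
  by apply/allrelP => y z;
    rewrite mem_nseq => /andP[_ /eqP ->] /mem_expand /(allP xi) /ltnW.
by elim: n => //= n ->; rewrite andbT; apply/allP => y;
  rewrite mem_nseq => /andP[_ /eqP ->].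
Qed.

Lemma sorted_expandP v : sorted leq v -> exists i b,
  [/\ sorted ltn i, size i = size b, 0 \notin b & v = expand i b].
Proof.
elim: v => [|x v IH] sv; first by exists [::], [::].
have [|i [b [si e b0 ev]]] := IH; first exact: path_sorted sv.
have xv : all (leq x) v by move: sv => /=; rewrite (path_sortedE leq_trans) => /andP[].
case: i b e si b0 ev => [|y i] [|n b] //= e si b0 ev.
  by exists [:: x], [:: 1]; rewrite ev.
have n0 : 0 < n by move: b0; rewrite inE negb_or eq_sym lt0n => /andP[].
have yv : y \in v by rewrite ev /expand /= mem_cat mem_nseq n0 eqxx.
have := allP xv _ yv; rewrite leq_eqVlt => /orP[/eqP xy|xy].
  exists (y :: i), (n.+1 :: b); split=> //; last by rewrite ev xy.
  by move: b0; rewrite !inE !negb_or => /andP[_ ->].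
exists [:: x, y & i], [:: 1, n & b]; split=> //=; rewrite ?xy //.
- by rewrite e.
- by rewrite ev.
Qed.

Lemma undup_nseq_cat n x (s : seq nat) : x \notin s ->
  undup (nseq n.+1 x ++ s) = x :: undup s.
Proof.
move=> xs; elim: n => [|n IH] /=; first by rewrite (negPf xs).
by rewrite {1}inE eqxx; exact: IH.
Qed.

Lemma undup_expand i b : sorted ltn i -> size i = size b -> 0 \notin b ->
  undup (expand i b) = i.
Proof.
rewrite (sorted_pairwise ltn_trans).
elim: i b => [|x i IH] [|n b] //= /andP[xi si] [e].
rewrite inE negb_or; case: n => // n /andP[_ b0].
rewrite /expand [flatten _]/= -/(expand i b) undup_nseq_cat ?IH //.
by apply/negP => /mem_expand /(allP xi) /=; rewrite ltnn.
Qed.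

Lemma runlengths_expand i b : sorted ltn i -> size i = size b -> 0 \notin b ->
  runlengths (expand i b) = b.
Proof.
move=> si e b0; rewrite /runlengths undup_expand //; move: si e b0.
rewrite (sorted_pairwise ltn_trans).
elim: i b => [|x i IH] [|n b] //= /andP[xi si] [e].
rewrite inE negb_or => /andP[_ b0].
rewrite /expand /= -/(expand i b) count_cat count_nseq /= eqxx mul1n.
have xe : x \notin expand i b by apply/negP => /mem_expand /(allP xi) /=; rewrite ltnn.
rewrite (count_memPn xe) addn0; congr cons; rewrite -[RHS](IH b) //.
apply/eq_in_map => y yi; rewrite count_cat count_nseq /=.
by have /= := allP xi _ yi; case: eqP => [->|]; rewrite ?ltnn.
Qed.

Lemma expand_runlengths v : sorted leq v ->
  [/\ sorted ltn (undup v), size (undup v) = size (runlengths v), 0 \notin runlengths v &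
      v = expand (undup v) (runlengths v)].
Proof.
move=> /sorted_expandP[i [b [si e b0 ->]]].
by rewrite undup_expand // runlengths_expand.
Qed.

Lemma runlengths_cat u v : sorted leq u -> sorted leq v -> allrel ltn u v ->
  runlengths (u ++ v) = runlengths u ++ runlengths v.
Proof.
move=> su sv /allrelP uv; have [iu eu u0 Eu] := expand_runlengths su.
have [iv ev v0 Ev] := expand_runlengths sv.
rewrite {1}Eu {1}Ev -expand_cat // runlengths_expand //.
- rewrite (sorted_pairwise ltn_trans) pairwise_cat -!(sorted_pairwise ltn_trans).
  rewrite iu iv !andbT; apply/allrelP => x y; rewrite !mem_undup; exact: uv.
- by rewrite !size_cat eu ev.
- by rewrite mem_cat negb_or u0.
Qed.

Lemma sumn_runlengths v : sorted leq v -> sumn (runlengths v) = size v.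
Proof. by move=> /expand_runlengths[_ e _ {2}->]; rewrite size_expand. Qed.

Definition rends (w : seq nat) : seq nat :=
  [seq i <- iota 1 (size w) | (i == size w) || (nth 0 w i < nth 0 w i.-1)].
(** The descent composition of [w], as in [desccomp]. *)
Definition dcomp (w : seq nat) : seq nat := pairmap (fun s t => t - s) 0 (rends w).

Lemma refines_sumn b a : refines b a -> sumn b = sumn a.
Proof. by case=> g [<- <- _]; rewrite sumn_flatten. Qed.

(** Cut [drop s v] at the first end [t] of [e].  The run-lengths split there
    exactly when no run goes across, that is when [v] has a strict ascent at
    [t]. *)
Lemma refines_blocks v s e : sorted leq v -> path ltn s e -> last s e = size v ->
  refines (runlengths (drop s v)) (pairmap (fun s t => t - s) s e) <->
  (forall t, t \in e -> t < size v -> nth 0 v t.-1 < nth 0 v t).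
Proof.
move=> sv; elim: e s => [|t e IH] s /=.
  move=> _ ->; rewrite drop_size; split=> // _; exists [::]; split=> //.
case/andP=> st pe le; have {}IH := IH _ pe le.
have tn : t <= size v.
  rewrite -le; move: pe; rewrite (path_sortedE ltn_trans) => /andP[te _].
  by have := mem_last t e; rewrite inE => /orP[/eqP -> //|/(allP te) /ltnW].
have eu : drop s v = take (t - s) (drop s v) ++ drop t v.
  by rewrite -{1}(cat_take_drop (t - s) (drop s v)) drop_drop subnK // ltnW.
set u1 := take (t - s) _ in eu.
have su1 : size u1 = t - s by rewrite size_takel // size_drop; lia.
have sdv p : sorted leq (drop p v) by apply: drop_sorted.
have s1 : sorted leq u1 by apply: take_sorted.
split.
  case=> -[|g1 g] [] //= eg [sg1] eg' b0.
  have [si es _ ed] := expand_runlengths (sdv s).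
  set i1 := take (size g1) (undup (drop s v)).
  set i2 := drop (size g1) (undup (drop s v)).
  have ei : undup (drop s v) = i1 ++ i2 by rewrite cat_take_drop.
  have si1 : size i1 = size g1.
    by rewrite size_takel // es -eg size_cat leq_addr.
  have si2 : size i2 = size (flatten g).
    by move: es; rewrite ei -eg !size_cat si1 => /addnI.
  have ed2 : u1 ++ drop t v = expand i1 g1 ++ expand i2 (flatten g).
    by rewrite -eu {1}ed -eg {1}ei expand_cat.
  have /eqP := ed2; rewrite eqseq_cat ?su1 ?size_expand // => /andP[/eqP e1 /eqP e2].
  have i12 : sorted ltn (i1 ++ i2) by rewrite -ei.
  have : refines (runlengths (drop t v)) (pairmap (fun s t => t - s) t e).
    exists g; split=> //.
      rewrite e2 runlengths_expand //; first by apply: (subseq_sorted ltn_trans _ i12);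
        apply: suffix_subseq.
      by move: b0; rewrite -eg mem_cat negb_or => /andP[].
    move: b0; rewrite -eg mem_cat negb_or e2 => /andP[_ b0]; rewrite runlengths_expand //.
    by apply: (subseq_sorted ltn_trans _ i12); apply: suffix_subseq.
  move/IH => IH' t'; rewrite inE => /orP[/eqP -> tn'|]; last exact: IH'.
  move: i12; rewrite (sorted_pairwise ltn_trans) pairwise_cat => /and3P[/allrelP i12 _ _].
  apply: i12; [apply: (@mem_expand i1 g1)|apply: (@mem_expand i2 (flatten g))].
    rewrite -e1; have -> : nth 0 v t.-1 = nth 0 u1 (t - s).-1.
      by rewrite nth_take ?nth_drop; [congr nth; lia|lia].
    by apply: mem_nth; rewrite su1; lia.
  have -> : nth 0 v t = nth 0 (drop t v) 0 by rewrite nth_drop addn0.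
  by rewrite -e2; apply: mem_nth; rewrite size_drop subn_gt0.
move=> h; have [g [eg sg g0]] : refines (runlengths (drop t v)) (pairmap (fun s t =>
  t - s) t e).
  by apply/IH => t' t'e; apply: h; rewrite inE t'e orbT.
have e1 : runlengths (drop s v) = runlengths u1 ++ runlengths (drop t v).
  rewrite eu runlengths_cat //; apply/allrelP => x y.
  move=> /(nthP 0)[p]; rewrite su1 => pt <- /(nthP 0)[q]; rewrite size_drop => qt <-.
  rewrite nth_take // !nth_drop.
  have {}qt : q < size v - t := qt.
  have tn' : t < size v by lia.
  have := h t; rewrite inE eqxx => /(_ isT tn') ht.
  apply: (@leq_ltn_trans (nth 0 v t.-1)).
    by apply: (sorted_leq_nth leq_trans leqnn) => //; rewrite ?inE; lia.
  apply: (leq_trans ht).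
  by apply: (sorted_leq_nth leq_trans leqnn) => //; rewrite ?inE; lia.
exists (runlengths u1 :: g); split; first by rewrite /= eg e1.
  by rewrite /= sg sumn_runlengths // su1.
rewrite e1 mem_cat negb_or g0 andbT.
by have [_ _ ->] := expand_runlengths s1.
Qed.

Lemma rendsP w : path ltn 0 (rends w) /\ last 0 (rends w) = size w.
Proof.
split.
  have : sorted ltn (0 :: rends w).
    apply: (subseq_sorted ltn_trans _ (iota_ltn_sorted 0 (size w).+1)) => /=.
    by rewrite filter_subseq.
  by [].
rewrite /rends; case: (size w) => // n.
by rewrite -{2}addn1 iotaD filter_cat /= add1n eqxx cats1 last_rcons.
Qed.

(** [v] has a strict ascent at each descent of [w]: for a weakly increasing [v],
    this is the condition for its monomial to occur in the fundamental function of the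
      descent
    composition of [w]. *)
Definition compat (w v : seq nat) : bool :=
  (size v == size w) &&
  all (fun t => (t < size w) && (nth 0 w t < nth 0 w t.-1) ==> (nth 0 v t.-1 < nth 0 v t))
      (iota 1 (size w)).

Lemma sumn_dcomp w : sumn (dcomp w) = size w.
Proof.
have [p l] := rendsP w; rewrite /dcomp -l -[RHS]subn0.
elim: (rends w) 0 p => [|t e IH] s /=; first by rewrite subnn.
case/andP=> st pe; rewrite IH //.
have : t <= last t e.
  move: pe; rewrite (path_sortedE ltn_trans) => /andP[te _].
  by have := mem_last t e; rewrite inE => /orP[/eqP -> //|/(allP te) /ltnW].
lia.
Qed.

Lemma refines_compat v w : sorted leq v -> refines (runlengths v) (dcomp w) <-> compat w v.
Proof.
move=> sv; have [p l] := rendsP w; rewrite /compat.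
have := @refines_blocks v 0 (rends w) sv p; rewrite drop0 -/(dcomp w) l => H.
split=> [R|/andP[/eqP e /allP h]].
  have e : size w = size v by rewrite -(sumn_runlengths sv) (refines_sumn R) sumn_dcomp.
  rewrite e eqxx /=; apply/allP => t; rewrite -e => tw; apply/implyP => /andP[tn d].
  have /(H e) := R; apply; last by rewrite -e.
  by rewrite mem_filter tw d orbT.
apply/(H (esym e)) => t; rewrite mem_filter => /andP[d tw] tv.
have := h t tw; rewrite -e tv /=; case/orP: d => [/eqP d|->] //.
by rewrite d e ltnn in tv.
Qed.

(** * Fundamental quasisymmetric functions *)

Section Fund.
Local Open Scope ring_scope.
Variable k : comPzRingType.

Lemma ncvarX x n : ncvar k x ^+ n = ncword k (nseq n x).
Proof.
elim: n => [|n IH]; first by rewrite expr0.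
by rewrite exprS IH -ncword_var ncwordM.
Qed.

Lemma prod_ncvarX i b :
  \prod_(p <- zip i b) ncvar k p.1 ^+ p.2 = ncword k (expand i b).
Proof.
elim: i b => [|x i IH] [|n b]; rewrite ?big_nil //.
by rewrite big_cons IH ncvarX ncwordM.
Qed.

Lemma prod_ncvar i : \prod_(j <- i) ncvar k j = ncword k i.
Proof.
elim: i => [|x i IH]; first by rewrite big_nil.
by rewrite big_cons IH -ncword_var ncwordM.
Qed.

(** Each word has a nonzero coefficient in at most one member of the families
    that define the monomial and complete functions. *)
Lemma fsum_indicator (D : set (seq nat)) (F : seq nat -> k) i0 :
  (forall i, D i -> i != i0 -> F i = 0) ->
  \sum_(i \in D) F i = if `[< D i0 >] then F i0 else 0.
Proof.
move=> F0; case: ifPn => /asboolP Di.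
  have s1 : ([set i0] `<=` D)%classic by move=> i ->.
  have s2 : (D `\` [set i0] `<=` F @^-1` [set 0])%classic.
    by move=> i [Di' /eqP ii0]; apply: F0.
  by rewrite -(fsbig_widen _ _ _ s1 s2) fsbig_set1.
rewrite fsbig1 // => i Di'; apply: F0 => //.
by apply: contra_notN Di => /eqP <-.
Qed.

(** The series that represents [monomialM k b]. *)
Definition Mser b : ncseries k := fun v => (sorted leq v && (runlengths v == b))%:R.

Lemma monomialME b : 0%N \notin b -> monomialM k b = oddpi (Mser b).
Proof.
move=> b0; congr oddpi; apply/funext => v; rewrite /ncsum.
rewrite (@fsum_indicator _ _ (undup v)) => [|i [si ii]]; rewrite prod_ncvarX /ncword;
  last first.
  by case: (v =P expand i b) => // ->; rewrite undup_expand // eqxx.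
rewrite /Mser; case: ifPn => /asboolP.
  case=> si ii; congr (nat_of_bool _)%:R.
  apply/eqP/idP => [->|/andP[sv /eqP <-]];
    first by rewrite sorted_expand //= runlengths_expand.
  by have [] := expand_runlengths sv.
move=> h; case: andP => // -[sv /eqP eb]; case: h.
by have [h1 h2 h3 h4] := expand_runlengths sv; rewrite -eb.
Qed.

(** A finite list that contains all the compositions of an integer. *)
Fixpoint boundedseqs (f N : nat) : seq (seq nat) :=
  if f is f'.+1 then [::] :: [seq i :: c | i <- iota 0 N.+1, c <- boundedseqs f' N]
  else [:: [::]].

Lemma mem_boundedseqs f N s : (size s <= f)%N -> all (geq N) s -> s \in boundedseqs f N.
Proof.
elim: f s => [|f IH] [|x s] // sf /andP[xN sN].
have -> : boundedseqs f.+1 N = [::] :: [seq i ::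
  c | i <- iota 0 N.+1, c <- boundedseqs f N] by [].
rewrite inE; apply/orP; right; apply/allpairsPdep; exists x, s; split=> //.
  by rewrite (mem_iota 0 N.+1).
exact: IH.
Qed.

Lemma composition_bounded b : 0%N \notin b -> b \in boundedseqs (sumn b) (sumn b).
Proof.
move=> b0; apply: mem_boundedseqs.
  elim: b b0 => //= x b IH; rewrite inE negb_or => /andP[x0 /IH]; lia.
apply/allP => x xb /=; elim: b xb {b0} => //= y b IH; rewrite inE.
by case/orP => [/eqP ->|/IH]; lia.
Qed.

(** The series that represents the fundamental function of [dcomp w]. *)
Definition Fser w : ncseries k := fun v => (sorted leq v && compat w v)%:R.

Lemma fundamentalFE w : fundamentalF k (dcomp w) = oddpi (Fser w).
Proof.
rewrite /fundamentalF; set a := dcomp w.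
(* the refinements of [a], as a list *)
pose L := undup [seq b <- boundedseqs (sumn a) (sumn a) | `[< refines b a >]].
have -> : [set b | refines b a]%classic = [set` L]%classic.
  apply/seteqP; split=> b /=; last by rewrite mem_undup mem_filter => /andP[/asboolP].
  move=> R; rewrite mem_undup mem_filter; apply/andP; split; first exact/asboolP.
  rewrite -(refines_sumn R); apply: composition_bounded.
  by case: R => g [].
rewrite -fsbig_seq ?undup_uniq //.
have -> : \sum_(b <- L) monomialM k b = \sum_(b <- L) oddpi (Mser b).
  apply: eq_big_seq => b; rewrite mem_undup mem_filter => /andP[/asboolP[g [_ _ b0]] _].
  exact: monomialME.
rewrite -raddf_sum; congr oddpi; apply/funext => v; rewrite ncsumE /Mser /Fser.
case sv : (sorted leq v); last by rewrite big1.
have mL : (runlengths v \in L) = compat w v.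
  rewrite mem_undup mem_filter; apply/andP/idP => [[/asboolP/(refines_compat _ sv)//]|c].
  have R : refines (runlengths v) a by apply/refines_compat.
  split; first exact/asboolP.
  by rewrite -(refines_sumn R); apply: composition_bounded; case: R => g [].
case: (boolP (compat w v)) => c.
  rewrite (bigD1_seq (runlengths v)) ?undup_uniq ?mL //= eqxx big1 ?addr0 // => b.
  by rewrite eq_sym => /negPf ->.
rewrite big_seq big1 // => b bL; case: eqP => // e.
by rewrite -mL e bL in c.
Qed.

Lemma completehE n : completeh k n = oddpi (Fser (iota 1 n)).
Proof.
congr oddpi; apply/funext => v; rewrite /ncsum.
rewrite (@fsum_indicator _ _ v) => [|i _ /negPf iv]; rewrite prod_ncvar /ncword; last first.
  by rewrite eq_sym iv.
rewrite /Fser /compat eqxx size_iota; case: ifPn => /asboolP.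
  case=> -> ->; rewrite /= !eqxx /=; case: allP => // -[] t.
  rewrite mem_iota => tn; apply/implyP => /andP[tn'].
  by rewrite !nth_iota; lia.
by move=> h; case: (boolP (sorted leq v)) => //= sv; case: eqP => // sz; case: h.
Qed.

End Fund.

(** * Words with a given recording tableau *)

Lemma inv_pairs u : inv u =
  \sum_(i <- iota 0 (size u)) \sum_(j <- iota 0 (size u))
    ((i < j) && (nth 0 u j < nth 0 u i)).
Proof.
have mapS n : iota 1 n = [seq i.+1 | i <- iota 0 n] by rewrite -[1]addn0 iotaDl.
elim: u => [|x u IH] /=; first by rewrite big_nil.
rewrite !big_cons /= add0n mapS !big_map /= IH; congr addn.
  by rewrite -sum1_count big_mkcond (big_nth 0) /index_iota subn0;
    apply: eq_bigr => j _ /=; case: ltnP.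
by apply: eq_bigr => i _; rewrite big_cons big_map.
Qed.

(** Order on the positions of [a], numbered from 1: by letter, then from left to
    right. *)
Definition lexpos (a : seq nat) (p q : nat) :=
  (nth 0 a p.-1 < nth 0 a q.-1) || (nth 0 a p.-1 == nth 0 a q.-1) && (p <= q).

(** The inverse of the standardization of [a]. *)
Definition posword (a : seq nat) : seq nat := sort (lexpos a) (iota 1 (size a)).

Lemma lexpos_trans a : transitive (lexpos a).
Proof. by move=> q p r; rewrite /lexpos; lia. Qed.
Lemma lexpos_total a : total (lexpos a).
Proof. by move=> p q; rewrite /lexpos; lia. Qed.
Lemma lexpos_anti a : antisymmetric (lexpos a).
Proof. by move=> p q; rewrite /lexpos; lia. Qed.
Lemma lexpos_refl a : reflexive (lexpos a).
Proof. by move=> p; rewrite /lexpos; lia. Qed.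

Lemma posword_perm a : perm_eq (posword a) (iota 1 (size a)).
Proof. by rewrite perm_sort. Qed.

Lemma posword_uniq a : uniq (posword a).
Proof. by rewrite (perm_uniq (posword_perm a)) iota_uniq. Qed.

Lemma size_posword a : size (posword a) = size a.
Proof. by rewrite (perm_size (posword_perm a)) size_iota. Qed.

Lemma posword_sorted a : sorted (lexpos a) (posword a).
Proof. by apply: sort_sorted; apply: lexpos_total. Qed.

Lemma eq_posword a w : perm_eq w (iota 1 (size a)) -> sorted (lexpos a) w ->
  w = posword a.
Proof.
move=> p s; apply: (sorted_eq (@lexpos_trans a) (@lexpos_anti a)) => //.
  exact: posword_sorted.
by rewrite perm_sym in p; rewrite perm_sym; apply: perm_trans p; apply: posword_perm.
Qed.

Lemma hi_iota n N : hi n (iota 1 N) = iota 1 (N - n).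
Proof.
apply: (irr_sorted_eq ltn_trans ltnn) => [||x]; last 1 first.
- rewrite mem_iota; apply/mapP/idP => [[y]|h].
    by rewrite mem_filter mem_iota => h ->; lia.
  by exists (x + n); rewrite ?mem_filter ?mem_iota ?addnK //; lia.
- rewrite /hi sorted_map.
  have : sorted ltn [seq x <- iota 1 N | n < x].
    by apply: sorted_filter; [exact: ltn_trans|exact: iota_ltn_sorted].
  have /sub_in_sorted H := filter_all (ltn n) (iota 1 N).
  by apply: H => x y; rewrite !unfold_in /=; lia.
- exact: iota_ltn_sorted.
Qed.

Lemma lo_posword n a : n <= size a -> lo n (posword a) = posword (take n a).
Proof.
move=> na; apply: eq_posword.
  have -> : iota 1 (size (take n a)) = [seq x <- iota 1 (size a) | x <= n].
    apply: (irr_sorted_eq ltn_trans ltnn); first exact: iota_ltn_sorted.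
      by apply: sorted_filter; [exact: ltn_trans|exact: iota_ltn_sorted].
    by move=> x; rewrite mem_filter !mem_iota size_takel //; lia.
  by apply: perm_filter; apply: posword_perm.
have: sorted (lexpos a) (lo n (posword a)).
  by apply: sorted_filter; [exact: lexpos_trans|exact: posword_sorted].
have: all (fun x => 0 < x <= n) (lo n (posword a)).
  apply/allP => x; rewrite mem_filter (perm_mem (posword_perm a)) mem_iota; lia.
move=> /sub_in_sorted H; apply: H => x y; rewrite !unfold_in => hx hy.
by rewrite /lexpos !nth_take; lia.
Qed.

Lemma hi_posword n a : hi n (posword a) = posword (drop n a).
Proof.
apply: eq_posword.
  rewrite size_drop -hi_iota.
  by apply: perm_map; apply: perm_filter; apply: posword_perm.
rewrite /hi sorted_map.
have: sorted (lexpos a) [seq x <- posword a | n < x].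
  by apply: sorted_filter; [exact: lexpos_trans|exact: posword_sorted].
have /sub_in_sorted H := filter_all (ltn n) (posword a).
apply: H => x y; rewrite !unfold_in => /= hx hy.
have ex : n + (x - n).-1 = x.-1 by lia.
have ey : n + (y - n).-1 = y.-1 by lia.
by rewrite /lexpos !nth_drop ex ey; lia.
Qed.

(** An inversion of [a] at the positions [q < p] is the same as an inversion of
    [posword a] with letters [q < p]. *)
Lemma inv_posword a : inv (posword a) = inv a.
Proof.
rewrite !inv_pairs size_posword.
pose G p q : nat := (lexpos a p q) && (q < p).
transitivity (\sum_(p <- posword a) \sum_(q <- posword a) G p q).
  rewrite [RHS](big_nth 0) size_posword /index_iota subn0.
  apply: eq_big_seq => i; rewrite mem_iota => /= iN.
  rewrite [RHS](big_nth 0) size_posword /index_iota subn0.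
  apply: eq_big_seq => j; rewrite mem_iota => /= jN; congr nat_of_bool.
  have S := posword_sorted a.
  have H p q : p < size a -> q < size a -> p <= q ->
    lexpos a (nth 0 (posword a) p) (nth 0 (posword a) q).
    by move=> pN qN; apply: (sorted_leq_nth (@lexpos_trans a) (@lexpos_refl a));
      rewrite ?inE ?size_posword.
  have [ij|ji] := ltnP i j; first by rewrite H //; lia.
  apply/esym/negbTE/negP => /andP[h1 h2].
  have e := lexpos_anti (introT andP (conj h1 (H _ _ jN iN ji))).
  by rewrite e ltnn in h2.
rewrite (perm_big _ (posword_perm a)).
under eq_bigr do rewrite (perm_big _ (posword_perm a)).
have -> : iota 1 (size a) = [seq i.+1 | i <- iota 0 (size a)].
  by rewrite -[1]addn0 iotaDl.
rewrite exchange_big big_map; apply: eq_bigr => i _; rewrite big_map.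
apply: eq_bigr => j _; congr nat_of_bool; rewrite /G /lexpos /=; lia.
Qed.

Lemma sorted_consecutive (T : Type) (x0 : T) (e : rel T) s :
  (forall i, i.+1 < size s -> e (nth x0 s i) (nth x0 s i.+1)) -> sorted e s.
Proof.
elim: s => // x s IH h; case: s IH h => // y s IH h.
apply/andP; split; first exact: (h 0).
by apply: IH => i si; apply: (h i.+1).
Qed.

Lemma sort_posword a : sort leq a = [seq nth 0 a p.-1 | p <- posword a].
Proof.
apply: (sorted_eq leq_trans anti_leq); first by apply: sort_sorted; exact: leq_total.
  rewrite sorted_map; apply: sub_sorted (posword_sorted a) => p q.
  by rewrite /lexpos /=; lia.
rewrite perm_sort perm_sym; apply: (perm_trans (perm_map _ (posword_perm a))).
rewrite -[1]addn0 iotaDl -map_comp /=.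
by rewrite -[X in perm_eq _ X](mkseq_nth 0).
Qed.

Lemma compat_posword a : compat (posword a) (sort leq a).
Proof.
rewrite /compat size_sort size_posword eqxx /=; apply/allP => t.
rewrite mem_iota => tN; apply/implyP => /andP[tN' d]; rewrite sort_posword.
have ht : t.-1 < size a by lia.
rewrite !(nth_map 0) ?size_posword //.
have : lexpos a (nth 0 (posword a) t.-1) (nth 0 (posword a) t).
  apply: (sorted_leq_nth (@lexpos_trans a) (@lexpos_refl a));
    rewrite ?inE ?size_posword //; last by lia.
  exact: posword_sorted.
rewrite /lexpos; lia.
Qed.

Lemma posword_inj a b : perm_eq a b -> posword a = posword b -> a = b.
Proof.
move=> pab e; have sab := perm_size pab.
apply: (@eq_from_nth _ 0) => // i ia.
have es : sort leq a = sort leq b.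
  by apply/(perm_sortP leq_total leq_trans anti_leq).
have : i.+1 \in posword a by rewrite (perm_mem (posword_perm a)) mem_iota; lia.
move: es; rewrite !sort_posword -e => /eq_in_map H /H; exact.
Qed.

(** The word [b] has the letter [v_i] at the position [w_i]; positions of equal
    letters come in increasing order because [v] has a strict ascent at each
    descent of [w]. *)
Lemma posword_surj v w : sorted leq v -> perm_eq w (iota 1 (size v)) -> compat w v ->
  exists2 b, perm_eq b v & posword b = w.
Proof.
move=> sv wp /andP[_ /allP cw].
have Uw : uniq w by rewrite (perm_uniq wp) iota_uniq.
have sw : size w = size v by rewrite (perm_size wp) size_iota.
pose b := [seq nth 0 v (index p w) | p <- iota 1 (size v)].
have sb : size b = size v by rewrite size_map size_iota.
have bv i : i < size v -> nth 0 b (nth 0 w i).-1 = nth 0 v i.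
  move=> iv; have : nth 0 w i \in iota 1 (size v) by rewrite -(perm_mem wp) mem_nth ?sw.
  rewrite mem_iota => wi; rewrite (nth_map 0) ?size_iota; last by lia.
  by rewrite nth_iota ?add1n ?prednK ?index_uniq ?sw //; lia.
exists b.
  apply: (@perm_trans _ [seq nth 0 v (index p w) | p <- w]).
    by apply: perm_map; rewrite perm_sym.
  suff -> : [seq nth 0 v (index p w) | p <- w] = v by [].
  apply: (@eq_from_nth _ 0); rewrite size_map // => i iw.
  by rewrite (nth_map 0) // index_uniq.
apply/esym/eq_posword; first by rewrite sb.
apply: (@sorted_consecutive _ 0) => i; rewrite sw => iv.
rewrite /lexpos !bv //; last by lia.
have := sorted_leq_nth leq_trans leqnn 0 sv; move=> /(_ i i.+1); rewrite !inE => le.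
have := cw i.+1; rewrite mem_iota sw => c.
have {}le : nth 0 v i <= nth 0 v i.+1 by apply: le; lia.
have {}c : nth 0 w i.+1 < nth 0 w i -> nth 0 v i < nth 0 v i.+1.
  by move=> d; have := c _; rewrite iv d; apply; lia.
have [h|h] := ltnP (nth 0 w i.+1) (nth 0 w i); first by rewrite c.
by rewrite andbT orbC -leq_eqVlt.
Qed.

Lemma posword_permutations v : sorted leq v ->
  perm_eq [seq posword b | b <- permutations v]
          [seq w <- permutations (iota 1 (size v)) | compat w v].
Proof.
move=> sv; apply: uniq_perm.
- rewrite map_inj_in_uniq ?permutations_uniq // => a b.
  rewrite !mem_permutations => av bv; apply: posword_inj.
  by rewrite perm_sym in bv; apply: perm_trans bv.
- by rewrite filter_uniq ?permutations_uniq.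
- move=> w; rewrite mem_filter mem_permutations; apply/mapP/andP => [[b]|[c wp]].
    rewrite mem_permutations => bv ->; rewrite -(perm_size bv) posword_perm.
    have := compat_posword b.
    have -> // : sort leq b = v.
    rewrite -[RHS](sorted_sort leq_trans sv).
    by apply/(perm_sortP leq_total leq_trans anti_leq).
  have [b bv <-] := posword_surj sv wp c.
  by exists b; rewrite ?mem_permutations.
Qed.

Section Varsigma.
Local Open Scope ring_scope.
Variable k : comPzRingType.

(** The sum of the words whose position word inserts to [t]. *)
Definition ser n t : ncseries k := fun a => ((size a == n) && (Pword (posword a) == t))%:R.

(** [oddvarsigma] with words instead of permutations and with a tableau given
    as a list of rows. *)
Definition vsig n t : oddser k :=
  \sum_(w <- permutations (iota 1 n) | Pword w == t)
    (-1) ^+ inv w * fundamentalF k (dcomp w).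

Lemma ncsignE m (f : ncseries k) v : ((-1) ^+ m * f) v = (-1) ^+ m * f v.
Proof. by rewrite -signr_odd -[in RHS]signr_odd !mulr_sign; case: odd. Qed.

(** At a weakly increasing word [v], the straightening of [ser n t] collects
    [(-1) ^ inv b] over the rearrangements [b] of [v]; replace [b] with
    [posword b], which runs through the permutations compatible with [v]
    ([posword_permutations]). *)
Lemma vsigE n t : vsig n t = oddpi (ser n t).
Proof.
rewrite oddpi_norm /vsig.
under eq_bigr do rewrite fundamentalFE -(rmorph_sign (@oddpi k)) -rmorphM.
rewrite -raddf_sum; congr oddpi; apply/funext => v; rewrite ncsumE /ncnorm.
under eq_bigr do rewrite ncsignE /Fser.
case sv : (sorted leq v); last by rewrite big1 // => w _; rewrite mulr0.
rewrite /=; have [sn|sn] := eqVneq (size v) n; last first.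
  rewrite big_seq_cond big1 => [|w]; last first.
    rewrite mem_permutations => /andP[/perm_size ws _].
    by rewrite /compat ws size_iota (negPf sn) mulr0.
  rewrite big_seq big1 // => b; rewrite mem_permutations => /perm_size bs.
  by rewrite /ser bs (negPf sn) mulr0.
transitivity (\sum_(w <- [seq posword b | b <- permutations v] | Pword w == t)
   (-1) ^+ inv w : k).
  rewrite (perm_big _ (posword_permutations sv)) big_filter_cond sn.
  rewrite big_mkcond [RHS]big_mkcond; apply: eq_bigr => w _.
  by case: (Pword w == t); case: (compat w v); rewrite ?mulr1 ?mulr0.
rewrite big_map big_mkcond; apply: eq_big_seq => b.
rewrite mem_permutations => /perm_size bs; rewrite /ser bs sn eqxx inv_posword /=.
by case: ifP; rewrite ?mulr1 ?mulr0.
Qed.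

Lemma inv_permword n (w : 'S_n) : inv (permword w) = permlen w.
Proof.
transitivity (\sum_(p : 'I_n * 'I_n) ((p.1 < p.2)%N && (w p.2 < w p.1)%N : nat))%N;
  last first.
  by rewrite /permlen -sum1dep_card [RHS]big_mkcond; apply: eq_bigr => p _; case: ifP.
rewrite -(pair_bigA _ (fun i j : 'I_n => ((i < j)%N && (w j < w i)%N : nat))).
rewrite inv_pairs size_map size_enum_ord.
have -> : iota 0 n = index_iota 0 n by rewrite /index_iota subn0.
rewrite big_mkord; apply: eq_bigr => i _; rewrite big_mkord; apply: eq_bigr => j _.
by rewrite !(nth_map i) -?enumT ?size_enum_ord // !nth_ord_enum ltnS.
Qed.

Lemma permword_perm n (w : 'S_n) : perm_eq (permword w) (iota 1 n).
Proof.
have e : [seq i.+1 | i <- iota 0 n] = iota 1 n by rewrite -[1%N]addn0 iotaDl.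
rewrite -e -val_enum_ord -map_comp /permword.
have -> : [seq (w i).+1 | i <- enum 'I_n] =
          [seq (nat_of_ord i).+1 | i <- [seq w i | i <- enum 'I_n]].
  by rewrite -[RHS]map_comp.
apply: (@perm_map _ _ (fun i : 'I_n => i.+1)); apply: uniq_perm.
- by rewrite (map_inj_uniq perm_inj) enum_uniq.
- exact: enum_uniq.
- move=> i; rewrite mem_enum; apply/mapP; exists (w^-1 i)%g; rewrite ?mem_enum //.
  by rewrite permKV.
Qed.

Lemma permword_inj n : injective (@permword n).
Proof.
move=> w w' /eq_in_map e; apply/permP => i.
by apply/val_inj; have [] := e i (mem_enum _ i).
Qed.

Lemma permword_permutations n :
  perm_eq [seq permword w | w <- enum {: 'S_n}] (permutations (iota 1 n)).
Proof.
have U : uniq [seq permword w | w <- enum {: 'S_n}].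
  by rewrite (map_inj_uniq (@permword_inj n)) enum_uniq.
have S : {subset [seq permword w | w <- enum {: 'S_n}] <= permutations (iota 1 n)}.
  by move=> u /mapP[w _ ->]; rewrite mem_permutations permword_perm.
have SZ : (size (permutations (iota 1 n)) <= size [seq permword w | w <- enum {: 'S_n}])%N.
  by rewrite size_permutations ?iota_uniq // size_iota size_map -cardE card_Sn.
have [_ e] := uniq_min_size U S SZ.
by apply: uniq_perm; rewrite ?permutations_uniq.
Qed.

Lemma oddvarsigmaE n t : tab t -> 0%N \notin flatten t ->
  oddvarsigma k n (fill t) = vsig n t.
Proof.
move=> T t0; rewrite /oddvarsigma /vsig -(perm_big _ (permword_permutations n)).
rewrite big_map [RHS]big_enum_cond /=.
apply: eq_big => [w|w _]; last first.
  rewrite -inv_permword; congr (_ * fundamentalF k _).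
  by rewrite /desccomp /dcomp /rends size_map size_enum_ord.
apply/asboolP/eqP => [e|<- //].
have pw := permword_perm w; have U : uniq (permword w) by rewrite (perm_uniq pw) iota_uniq.
apply: fill_inj => //; first exact: Pword_tab.
by rewrite (perm_mem (Pword_perm U)) (perm_mem pw) mem_iota.
Qed.

End Varsigma.

(** * Products and signs *)

Definition stdtab n t := tab t && perm_eq (flatten t) (iota 1 n).

Lemma stdtab_tab n t : stdtab n t -> tab t. Proof. by case/andP. Qed.
Lemma stdtab_uniq n t : stdtab n t -> uniq (flatten t).
Proof. by case/andP=> _ p; rewrite (perm_uniq p) iota_uniq. Qed.
Lemma stdtab_n0 n t : stdtab n t -> 0 \notin flatten t.
Proof. by case/andP=> _ p; rewrite (perm_mem p) mem_iota. Qed.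
Lemma stdtab_rdw n t : stdtab n t -> perm_eq (rdw t) (iota 1 n).
Proof. by case/andP=> _; apply: perm_trans; apply: rdw_perm. Qed.

Lemma Pword_stdtab n w : perm_eq w (iota 1 n) -> stdtab n (Pword w).
Proof.
move=> p; have U : uniq w by rewrite (perm_uniq p) iota_uniq.
by rewrite /stdtab Pword_tab // (perm_trans (Pword_perm U)).
Qed.

Definition alltabs n := undup [seq Pword w | w <- permutations (iota 1 n)].

Lemma mem_alltabs n t : (t \in alltabs n) = stdtab n t.
Proof.
rewrite mem_undup; apply/mapP/idP => [[w]|st].
  by rewrite mem_permutations => p ->; apply: Pword_stdtab.
exists (rdw t); last by rewrite Pword_rdw // (stdtab_tab st).
by rewrite mem_permutations stdtab_rdw.
Qed.

(** The entries of [t] up to [n] form [t1], the other ones rectify to [t2]; both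
    conditions are expressed by insertion of reading words. *)
Definition splits n t1 t2 (t : seq (seq nat)) :=
  (Pword (lo n (rdw t)) == t1) && (Pword (hi n (rdw t)) == t2).

Lemma Pword_lo n w : uniq w -> Pword (lo n (rdw (Pword w))) = Pword (lo n w).
Proof.
move=> U; apply/esym/Pword_knuth; first exact/knuth_lo/knuth_Pword.
exact: filter_uniq.
Qed.

Lemma hi_uniq n w : uniq w -> uniq (hi n w).
Proof.
move=> U; rewrite map_inj_in_uniq ?filter_uniq // => x y.
by rewrite !mem_filter => /andP[? _] /andP[? _]; lia.
Qed.

Lemma Pword_hi n w : uniq w -> Pword (hi n (rdw (Pword w))) = Pword (hi n w).
Proof.
move=> U; apply/esym/Pword_knuth; first exact/knuth_hi/knuth_Pword.
exact: hi_uniq.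
Qed.

(** [tabinv] for lists of rows, see [tabinv_fill]. *)
Fixpoint tinv (t : seq (seq nat)) : nat :=
  if t is r :: t' then sumn [seq count (geq x) (flatten t') | x <- r] + tinv t' else 0.

(** The number of pairs of boxes in different rows. *)
Fixpoint crosspar (sh : seq nat) : nat :=
  if sh is m :: sh' then m * sumn sh' + crosspar sh' else 0.

(** A pair of entries in different rows is counted either by [inv], if the lower
    entry is larger, or by [tinv]. *)
Lemma inv_rdw t : tab t -> inv (rdw t) + tinv t = crosspar (shape t).
Proof.
elim: t => // r t IH /and4P[_ rr _ T]; rewrite rdw_cons inv_cat (inv_row rr) /=.
rewrite -(IH T) -size_flatten (cross_perm (rdw_perm t) (perm_refl r)).
suff : cross (flatten t) r + sumn [seq count (geq x) (flatten t) | x <- r] =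
  size r * size (flatten t) by lia.
elim: (flatten t) => [|y u IHu]; first by rewrite muln0; elim: (r).
rewrite [size (y :: u)]/= mulnS -IHu.
have -> : cross (y :: u) r = count (gtn y) r + cross u r by [].
suff H : count (gtn y) r + sumn [seq count (geq x) (y :: u) | x <- r] =
  size r + sumn [seq count (geq x) u | x <- r].
  by rewrite addnAC H -addnA (addnC (cross u r)).
elim: (r) => //= x s IHs; rewrite -!addnA; move: IHs => /=.
by rewrite leqNgt; case: ltnP => /=; lia.
Qed.

(** The descent composition read off a recording: by [row_bump] a descent is a
    position where the row index increases. *)
Definition dcompQ (q : seq nat) : seq nat :=
  pairmap (fun s t => t - s) 0 [seq i <- iota 1 (size q) |
    (i == size q) || (nth 0 q i.-1 < nth 0 q i)].

Lemma Qword_descent (w : seq nat) i : uniq w -> i.+1 < size w ->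
  (nth 0 (Qword w) i < nth 0 (Qword w) i.+1) = (nth 0 w i.+1 < nth 0 w i).
Proof.
move=> U iw; have ew := cat_take_drop i w.
have ed : drop i w = [:: nth 0 w i, nth 0 w i.+1 & drop i.+2 w].
  by rewrite (drop_nth 0 (ltnW iw)) (drop_nth 0 iw).
have st : size (Qrec [::] (take i w)) = i by rewrite size_Qrec size_takel //; lia.
set x := nth 0 w i in ed *; set y := nth 0 w i.+1 in ed *.
have Uw : uniq (take i w ++ [:: x, y & drop i.+2 w]) by rewrite -ed ew.
rewrite /Qword -{1 2}ew ed Qrec_cat !nth_cat st ltnn subnn (ltnNge i.+1) leqnSn /=.
rewrite subSnn /= ltnNge row_bump.
- rewrite -leqNgt leq_eqVlt; case: eqP => // xy.
  by move: Uw; rewrite cat_uniq /= inE xy eqxx !andbF.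
- by apply: Pword_tab; move: Uw; rewrite cat_uniq => /andP[].
- have Ut : uniq (take i w) by move: Uw; rewrite cat_uniq => /andP[].
  have E : perm_eq [:: x, y & flatten (Pword (take i w))] [:: x, y & take i w].
    by rewrite !perm_cons Pword_perm.
  rewrite (perm_uniq E); have : uniq (take i w ++ [:: x; y]).
    by apply: subseq_uniq Uw; apply: cat_subseq => //=; rewrite !eqxx sub0seq.
  by rewrite uniq_catC.
Qed.

Lemma dcomp_Qword (w : seq nat) : uniq w -> dcomp w = dcompQ (Qword w).
Proof.
move=> U; rewrite /dcomp /dcompQ /rends size_Qrec; congr pairmap.
apply: eq_in_filter => i; rewrite mem_iota => iw.
have [//|iw'] := eqVneq i (size w); case: i iw iw' => // i iw iw' /=.
by rewrite Qword_descent //; lia.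
Qed.

(** The sign of a permutation is the product of a sign that depends on its
    insertion tableau and a sign that depends on its recording. *)
Lemma inv_Pword (w : seq nat) : uniq w ->
  odd (inv w) = odd (tinv (Pword w) + crosspar (shape (Pword w)) + Qpar [::] (Qword w)).
Proof.
move=> U; have := @inv_insword [::] w isT U; rewrite /= => ->.
rewrite -(inv_rdw (Pword_tab U)) -/(Pword w) -/(Qword w) !oddD.
by case: (odd (tinv _)); case: (odd (inv _)); case: (odd (Qpar _ _)).
Qed.

(** The tableau of shape [sh] filled row by row with consecutive entries from
    [s] on. *)
Fixpoint rtab_from (s : nat) (sh : seq nat) : seq (seq nat) :=
  if sh is m :: sh' then iota s m :: rtab_from (s + m) sh' else [::].
Definition rtab := rtab_from 1.

Lemma shape_rtab s sh : shape (rtab_from s sh) = sh.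
Proof. by elim: sh s => //= m sh IH s; rewrite size_iota IH. Qed.

Lemma flatten_rtab s sh : flatten (rtab_from s sh) = iota s (sumn sh).
Proof. by elim: sh s => //= m sh IH s; rewrite IH iotaD. Qed.

Lemma rtab_tab s sh : is_part sh -> tab (rtab_from s sh).
Proof.
elim: sh s => // m sh IH s /andP[/= p]; rewrite inE negb_or => /andP[m0 sh0].
rewrite IH /is_part ?(path_sorted p) // andbT.
rewrite -(sorted_pairwise ltn_trans) iota_ltn_sorted /= -size_eq0 size_iota eq_sym m0 /=.
case: sh p {IH sh0} => //= m' sh /andP[mm' _].
apply: domI; rewrite !size_iota //= => j jm; rewrite !nth_iota //;
  last exact: leq_trans jm mm'.
by rewrite /geq /= in mm'; lia.
Qed.

Lemma rtab_stdtab sh : is_part sh -> stdtab (sumn sh) (rtab sh).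
Proof. by move=> p; rewrite /stdtab rtab_tab //= flatten_rtab. Qed.

Lemma tinv_rtab s sh : tinv (rtab_from s sh) = 0.
Proof.
elim: sh s => //= m sh IH s; rewrite IH addn0 flatten_rtab.
rewrite sumnE big_map big_seq big1 // => x; rewrite mem_iota => sx.
apply/eqP; rewrite -leqn0 leqNgt -has_count -all_predC; apply/allP => y;
  rewrite mem_iota /=; lia.
Qed.

Lemma fill_rtab sh : fill (rtab sh) = rowtab sh.
Proof.
apply/funext => i; apply/funext => j; rewrite /fill /rowtab /rtab.
suff E s : nth 0 (nth [::] (rtab_from s sh) i) j =
   if j < part sh i then sumn (take i sh) + j + s else 0.
  by rewrite E; case: ifP => //; rewrite addn1.
elim: sh s i => [|m sh IH] s i; first by rewrite /part !nth_nil.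
case: i => [|i] /=; last by rewrite IH /part /=; case: ifP => // _; lia.
rewrite /part /=; have [h|h] := ltnP j m; first by rewrite nth_iota //; lia.
by rewrite nth_default // size_iota.
Qed.

Section Product.
Local Open Scope ring_scope.
Variable k : comPzRingType.

Lemma oddschurE (la : intpart) : oddschur k la = vsig k (sumn la) (rtab la).
Proof.
have st := rtab_stdtab (valP la).
by rewrite /oddschur -fill_rtab oddvarsigmaE ?(stdtab_tab st) ?(stdtab_n0 st).
Qed.

(** A word of length [n + m] is cut in a unique way; both parts of its position
    word have the same insertion tableau as the corresponding parts of the
    reading word of its insertion tableau. *)
Lemma serM n m t1 t2 : ser k n t1 * ser k m t2 =
  \sum_(t <- alltabs (n + m) | splits n t1 t2 t) ser k (n + m) t.
Proof.
apply/funext => a; rewrite ncmulE ncsumE /ser.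
have [sa|sa] := eqVneq (size a) (n + m)%N; last first.
  rewrite [RHS]big1 // big1 // => i _; rewrite size_drop size_takel;
    last by have := ltn_ord i; lia.
  case: eqP => [e|]; last by rewrite mul0r.
  case: (size a - i =P m)%N => [e'|]; last by rewrite mulr0.
  by case/eqP: sa; rewrite -e -e' subnKC // -ltnS.
have lt : (n < (size a).+1)%N by rewrite sa; lia.
rewrite (bigD1 (Ordinal lt)) //= big1 ?addr0; last first.
  move=> i /eqP ni; rewrite size_takel; last by have := ltn_ord i; lia.
  case: eqP => [e|]; last by rewrite mul0r.
  by case: ni; apply/val_inj.
have na : (n <= size a)%N by rewrite sa leq_addr.
rewrite size_takel // size_drop sa addKn !eqxx /= -lo_posword // -hi_posword.
have pw := posword_perm a; have U := posword_uniq a.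
rewrite -(Pword_lo n U) -(Pword_hi n U); set t0 := Pword (posword a).
rewrite -natrM mulnb -/(splits n t1 t2 t0).
have t0T : t0 \in alltabs (n + m) by rewrite mem_alltabs -sa Pword_stdtab.
rewrite big_mkcond (bigD1_seq t0) ?undup_uniq //= eqxx big1 ?addr0; first by case: ifP.
by move=> t; rewrite eq_sym => /negPf ->; case: ifP.
Qed.

Lemma vsigM n m t1 t2 : vsig k n t1 * vsig k m t2 =
  \sum_(t <- alltabs (n + m) | splits n t1 t2 t) vsig k (n + m) t.
Proof.
rewrite !vsigE -rmorphM serM raddf_sum; apply: eq_bigr => t _.
by rewrite vsigE.
Qed.

(** The part of [varsigma] that depends only on the recordings [L] and on the
    shape. *)
Definition Qsum (L : seq (seq nat)) (sh : seq nat) : oddser k :=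
  \sum_(q <- L) (-1) ^+ (crosspar sh + Qpar [::] q) * fundamentalF k (dcompQ q).

Lemma vsig_Qsum n t : vsig k n t = (-1) ^+ tinv t *
  Qsum [seq Qword w | w <- permutations (iota 1 n) & Pword w == t] (shape t).
Proof.
rewrite /Qsum big_map big_filter mulr_sumr /vsig big_seq_cond [RHS]big_seq_cond.
apply: eq_bigr => w /andP[]; rewrite mem_permutations => pw /eqP <-.
have U : uniq w by rewrite (perm_uniq pw) iota_uniq.
rewrite mulrA -exprD -dcomp_Qword //; congr (_ * _).
by rewrite -signr_odd inv_Pword // signr_odd addnA.
Qed.

(** By the Robinson-Schensted correspondence, the recordings of the permutations
    that insert to [t] depend only on the shape of [t]. *)
Lemma vsig_shape n t t' : stdtab n t -> stdtab n t' -> shape t = shape t' ->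
  vsig k n t = (-1) ^+ (tinv t + tinv t') * vsig k n t'.
Proof.
move=> st st' e; rewrite !vsig_Qsum exprD -mulrA signrMK.
congr (_ * _); rewrite e /Qsum; apply: perm_big.
have Uq t0 : uniq [seq Qword w | w <- permutations (iota 1 n) & Pword w == t0].
  rewrite map_inj_in_uniq ?filter_uniq ?permutations_uniq // => u v.
  rewrite !mem_filter !mem_permutations => /andP[/eqP eu pu] /andP[/eqP ev pv].
  by apply: RSK_inj; rewrite ?(perm_uniq pu) ?(perm_uniq pv) ?iota_uniq // eu ev.
have Sq t0 t1 : stdtab n t0 -> stdtab n t1 -> shape t0 = shape t1 ->
    {subset [seq Qword w | w <- permutations (iota 1 n) & Pword w == t0] <=
            [seq Qword w | w <- permutations (iota 1 n) & Pword w == t1]}.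
  move=> s0 s1 e01 q /mapP[w]; rewrite mem_filter mem_permutations => /andP[/eqP ew pw] ->.
  have U : uniq w by rewrite (perm_uniq pw) iota_uniq.
  have [|v [pv Pv Qv]] := RSK_surj U (stdtab_tab s1) (stdtab_uniq s1); first by rewrite ew.
  apply/mapP; exists v => //; rewrite mem_filter mem_permutations Pv eqxx /=.
  by apply: perm_trans pv _; case/andP: s1.
by apply: uniq_perm => // q; apply/idP/idP; apply: Sq.
Qed.

Lemma shape_is_part n t : stdtab n t -> is_part (shape t) /\ sumn (shape t) = n.
Proof.
move=> st; split.
  apply: is_partI; first exact: tab_shape_neq0 (stdtab_tab st).
  exact: tab_part (stdtab_tab st).
by rewrite -size_flatten; case/andP: st => _ /perm_size ->; rewrite size_iota.
Qed.

Lemma vsig_rtab n t : stdtab n t ->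
  vsig k n t = (-1) ^+ tinv t * vsig k n (rtab (shape t)).
Proof.
move=> st; have [p sn] := shape_is_part st.
rewrite (@vsig_shape _ _ (rtab (shape t))) ?shape_rtab ?tinv_rtab ?addn0 //.
by rewrite -{1}sn; apply: rtab_stdtab.
Qed.

Lemma oddschurM (la mu : intpart) : oddschur k la * oddschur k mu =
  \sum_(t <- alltabs (sumn la + sumn mu) | splits (sumn la) (rtab la) (rtab mu) t)
    (-1) ^+ tinv t * vsig k (sumn la + sumn mu) (rtab (shape t)).
Proof.
rewrite !oddschurE vsigM big_seq_cond [RHS]big_seq_cond.
by apply: eq_bigr => t /andP[]; rewrite mem_alltabs => st _; apply: vsig_rtab.
Qed.

End Product.

(** * Littlewood-Richardson tableaux *)

(** The entries of [T] up to [n]; those above [n], lowered by [n], are given by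
    [outer]. *)
Definition inner n (T : filling) : filling := fun i j => if T i j <= n then T i j else 0.
Definition outer n (T : filling) : filling := fun i j => T i j - n.

Lemma fread_inner B n T : fread B (inner n T) = lo n (fread B T).
Proof.
rewrite /fread /lo filter_flatten -map_comp; congr flatten; apply: eq_map => i /=.
rewrite /rowf; elim: (iota 0 B) => //= j s ->.
have -> : inner n T i j = if T i j <= n then T i j else 0 by [].
have [->|h] := posnP (T i j) => //=.
by case: (T i j <= n); rewrite /= ?h.
Qed.

Lemma fread_outer B n T : fread B (outer n T) = hi n (fread B T).
Proof.
rewrite /fread /hi filter_flatten map_flatten -!map_comp; congr flatten.
apply: eq_map => i /=; rewrite /rowf; elim: (iota 0 B) => //= j s ->.
have -> : outer n T i j = T i j - n by [].
rewrite subn_gt0; have [->|h] /= := posnP (T i j) => //.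
by case: (n < T i j).
Qed.

Lemma size_lo_row n r j : isrow r ->
  (j < size (lo n r)) = (j < size r) && (nth 0 r j <= n).
Proof.
elim: r j => [|x r IH] j; first by rewrite /= ltn0.
move=> /= /andP[xr rr]; case: (leqP x n) => xn.
  by case: j => [|j] /=; rewrite ?xn ?ltnS ?IH.
have -> : lo n r = [::].
  apply/eqP; rewrite -size_eq0 size_filter -leqn0 leqNgt -has_count -all_predC.
  by apply: sub_all xr => y /=; lia.
case: j => [|j] /=; first by rewrite (leqNgt x) xn.
apply/esym/negP => /andP[jr]; rewrite ltnS in jr.
by have /= := all_nthP 0 xr j jr; lia.
Qed.

(** The entries up to [n] form an initial part of each row and of each
    column. *)
Lemma tab_inner n t : tab t -> 0 \notin flatten t -> exists t0,
  [/\ tab t0, 0 \notin flatten t0, fill t0 = inner n (fill t) & rdw t0 = lo n (rdw t)].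
Proof.
move=> T t0; have sT := tab_straight T t0.
pose m i := size (lo n (nth [::] t i)).
have rowt i : isrow (nth [::] t i).
  by have [h|h] := ltnP i (size t); [case: (tab_row T h)|rewrite nth_default].
have supp i j : (0 < inner n (fill t) i j) = (j < m i).
  rewrite /m size_lo_row // -nth_shape -fill_supp // /inner -/(fill t i j).
  by case: (fill t i j <= n); rewrite ?andbT ?andbF.
have innE i j : 0 < inner n (fill t) i j -> inner n (fill t) i j = fill t i j.
  by rewrite /inner; case: ifP.
have pos i j : 0 < inner n (fill t) i j -> 0 < fill t i j.
  by move=> h; rewrite -innE.
have s0 : straight m nohole (inner n (fill t)).
  split=> //.
  - move=> i; rewrite leqNgt; apply/negP => h.
    have h1 := h; rewrite -supp in h1.
    have h3 : 0 < fill t i (m i).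
      have := pos _ _ h1; rewrite !fill_supp // => /leq_trans; apply.
      exact: tab_part.
    have h4 : fill t i (m i) < fill t i.+1 (m i) by apply: (sk_col sT) => //; apply: pos.
    have h5 : fill t i.+1 (m i) <= n by move: h1; rewrite /inner; case: ifP.
    have : 0 < inner n (fill t) i (m i) by rewrite /inner (leq_trans (ltnW h4) h5).
    by rewrite supp ltnn.
  - by move=> i j; rewrite supp /nohole andbT.
  - move=> i j j' jj' h1 h2; rewrite (innE _ _ h1) (innE _ _ h2).
    by apply: (sk_row sT) => //; apply: pos.
  - move=> i i' j ii' h1 h2; rewrite (innE _ _ h1) (innE _ _ h2).
    by apply: (sk_col sT) => //; apply: pos.
have Nb := bnd_nth (shape t); set N := (_ + _) in Nb.
have Nm : bnd N m.
  have mle i : m i <= nth 0 (shape t) i by rewrite nth_shape /m /lo size_filter count_size.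
  case: Nb => h1 h2; split=> i; first exact: leq_trans (mle i) (h1 i).
  by move=> /h2 h; have := mle i; rewrite h leqn0 => /eqP.
have [t1 [T1 e1 z1 _ r1]] := straightP s0 Nm.
exists t1; split=> //; rewrite (r1 N Nm) fread_inner.
by rewrite -(tab_fread T t0 Nb).
Qed.

Lemma Pword_lo_inner n t t1 : tab t -> 0 \notin flatten t -> tab t1 ->
  0 \notin flatten t1 ->
  (Pword (lo n (rdw t)) == t1) <-> inner n (fill t) = fill t1.
Proof.
move=> T t0 T1 z1; have [t2 [T2 z2 <- <-]] := tab_inner n T t0.
rewrite Pword_rdw //; split=> [/eqP -> //|e]; apply/eqP; exact: fill_inj.
Qed.

(** The function [g] in the induction accounts for the row indices, which start
    at [p] instead of 0 once [p] rows are removed. *)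
Lemma boxes_fill t : [seq fill t b.1 b.2 | b <- boxes (shape t) [::]] = flatten t.
Proof.
suff E p (g : nat -> nat) : (forall i, g (p + i) = i) ->
  flatten [seq [seq fill t (g i) j | j <- iota 0 (nth 0 (shape t) (g i))]
     | i <- iota p (size t)] = flatten t.
  rewrite -[RHS](E 0 id) // /boxes map_flatten size_map; congr flatten.
  rewrite -map_comp; apply: eq_map => i /=.
  by rewrite -map_comp /part nth_nil subn0.
elim: t p g => // r t IH p g gP /=.
have g0 : g p = 0 by rewrite -[p]addn0 gP.
rewrite g0 /= /fill /= -/(mkseq _ _) mkseq_nth; congr cat.
rewrite -[RHS](IH p.+1 (fun i => (g i).-1)); last by move=> i; rewrite addSnnS gP.
congr flatten; apply/eq_in_map => i; rewrite mem_iota => pi.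
have -> : g i = (g i).-1.+1.
  have -> : i = p + (i - p) by lia.
  by rewrite gP; lia.
by [].
Qed.

Lemma boxes_cons m sh : boxes (m :: sh) [::] =
  [seq (0, j) | j <- iota 0 m] ++ [seq (b.1.+1, b.2) | b <- boxes sh [::]].
Proof.
rewrite /boxes /= /part /= subn0; congr cat.
rewrite map_flatten -map_comp -[1]addn0 iotaDl -map_comp; congr flatten.
by apply: eq_map => i /=; rewrite -map_comp !nth_nil.
Qed.

Lemma tabinvE nu T : tabinv nu T =
  \sum_(b <- boxes nu [::]) \sum_(c <- boxes nu [::])
    ((b.1 < c.1) && (T c.1 c.2 <= T b.1 b.2)).
Proof.
rewrite /tabinv -sum1_count big_mkcond /= big_allpairs /=.
by apply: eq_bigr => b _; apply: eq_bigr => c _; case: ifP.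
Qed.

Lemma tabinv_fill t : tabinv (shape t) (fill t) = tinv t.
Proof.
rewrite tabinvE; elim: t => [|r t IH] /=; first by rewrite big_nil.
rewrite boxes_cons !big_cat /= !big_map.
under eq_bigr do rewrite big_cat !big_map /= big1 //.
under [X in _ + X]eq_bigr do rewrite big_cat !big_map /= big1 //.
rewrite -IH; congr addn.
rewrite -[in RHS](mkseq_nth 0 r) /mkseq -map_comp sumnE big_map.
apply: eq_bigr => j _;
  rewrite add0n /= -boxes_fill count_map -sum1_count [RHS]big_mkcond /=.
by apply: eq_bigr => b _; case: ifP.
Qed.

Section Split.
Variables (la mu : intpart).
Let n := sumn la.
Let m := sumn mu.

Lemma splits_inner N t : stdtab N t ->
  splits n (rtab la) (rtab mu) t ->
  inner n (fill t) = rowtab la /\ Pword (hi n (rdw t)) = rtab mu.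
Proof.
move=> st /andP[h /eqP ->]; split=> //; rewrite -fill_rtab.
have sl := rtab_stdtab (valP la).
apply/(Pword_lo_inner n (stdtab_tab st) (stdtab_n0 st)) => //.
  exact: stdtab_tab sl.
exact: stdtab_n0 sl.
Qed.

Lemma rowtab_pos (ka : intpart) i j : (0 < rowtab ka i j) = (j < part ka i).
Proof. by rewrite /rowtab; case: ifP. Qed.

Lemma rowtab_le (ka : intpart) i j : rowtab ka i j <= sumn ka.
Proof.
have [h|] := posnP (rowtab ka i j); first by rewrite h.
have sl := rtab_stdtab (valP ka); rewrite -fill_rtab => h.
suff : fill (rtab ka) i j \in iota 1 (sumn ka) by rewrite mem_iota; lia.
rewrite -(perm_mem (proj2 (andP sl))) -(boxes_fill (rtab ka)); apply/mapP.
exists (i, j) => //; rewrite boxesE /part nth_nil /= -fill_supp //.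
exact: stdtab_n0 sl.
Qed.

Section FromTableau.
Variables (nu : intpart) (t : seq (seq nat)).
Hypotheses (st : stdtab (n + m) t) (sh : shape t = nu)
  (inn : inner n (fill t) = rowtab la).

Let T := fill t.

Lemma fill_part i j : (0 < T i j) = (j < part nu i).
Proof. by rewrite fill_supp ?(stdtab_n0 st) // sh. Qed.

Lemma fill_inner i j : j < part la i -> T i j = rowtab la i j.
Proof.
rewrite -rowtab_pos -inn /inner -/T; case: (leqP (T i j) n) => //.
Qed.

Lemma fill_inner_iff i j : (0 < T i j <= n) = (j < part la i).
Proof.
by rewrite -rowtab_pos -inn /inner -/T; case: (leqP (T i j) n); rewrite ?andbT ?andbF.
Qed.

Lemma included_fill : included la nu.
Proof.
move=> i; rewrite leqNgt; apply/negP => h.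
have : 0 < T i (part nu i) by move: h; rewrite -fill_inner_iff => /andP[].
by rewrite fill_part ltnn.
Qed.

Lemma outer_supp i j : (0 < outer n T i j) = (part la i <= j < part nu i).
Proof.
rewrite /outer subn_gt0; have := fill_inner_iff i j; have := fill_part i j; lia.
Qed.

Lemma outer_skewf : skewf (part la) (part nu) nohole (outer n T).
Proof.
have sT := tab_straight (stdtab_tab st) (stdtab_n0 st); split.
- exact: is_part_part (valP la).
- exact: is_part_part (valP nu).
- exact: included_fill.
- by move=> i j; rewrite outer_supp /nohole andbT.
- move=> i j j' jj'; rewrite /outer !subn_gt0 => h1 h2.
  have : T i j < T i j' by apply: (sk_row sT) => //; apply: leq_ltn_trans (leq0n _) _;
    eassumption.
  lia.
- move=> i i' j ii'; rewrite /outer !subn_gt0 => h1 h2.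
  have : T i j < T i' j by apply: (sk_col sT) => //; apply: leq_ltn_trans (leq0n _) _;
    eassumption.
  lia.
Qed.

Lemma glue_outer : gluetab la nu (rowtab la) (outer n T) = T.
Proof.
apply/funext => i; apply/funext => j; rewrite /gluetab !boxesE -outer_supp.
rewrite /part nth_nil /=; case: ifP => h; first by rewrite fill_inner.
have := fill_inner_iff i j; rewrite /part h => hT.
rewrite /outer subn_gt0; case: ifP => hn; first by rewrite subnK // ltnW.
by move: hT; rewrite (leqNgt (T i j)) hn andbT; case: (posnP (T i j)) => // ->.
Qed.

(** Rectification yields a straight tableau with a reading word equivalent to
    that of the skew part, and a straight tableau is determined by the plactic
    class of its reading word. *)
Lemma outer_LR : Pword (hi n (rdw t)) = rtab mu -> LRtableaux la mu nu (outer n T).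
Proof.
move=> eP; have sk := outer_skewf; set S := outer n T in sk *.
have Nb := bnd_nth nu; set N := (_ + _) in Nb.
have fr : fread N S = hi n (rdw t).
  rewrite fread_outer (@tab_fread N) ?(stdtab_tab st) ?(stdtab_n0 st) //.
  by rewrite sh.
have pS : perm_eq (fread N S) (iota 1 m).
  rewrite -[m](addKn n) -hi_iota.
  by rewrite fr; apply: perm_map; apply: perm_filter; apply: stdtab_rdw.
have US : uniq (fread N S) by rewrite (perm_uniq pS) iota_uniq.
split.
  apply: (@skewf_SYT _ _ _ m) => //; apply: perm_trans pS.
  by rewrite perm_sym; apply: fread_boxes => //; apply: leq_addr.
have [U rU] := rect_exists sk Nb US.
have [m' [sU Nm' K]] := rect_knuth rU sk Nb.
have [tU [TU eU zU _ /(_ N Nm') rdU]] := straightP sU Nm'.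
have : Pword (fread N S) = Pword (fread N U) by apply: Pword_knuth.
rewrite fr eP -rdU Pword_rdw // => e; suff <- : U = rowtab mu by [].
by rewrite -eU -e fill_rtab.
Qed.

End FromTableau.

(** The converse of [outer_LR]: gluing [S] to the row-by-row tableau. *)
Lemma LR_tableau (nu : intpart) S : included la nu -> LRtableaux la mu nu S ->
  exists t, [/\ stdtab (n + m) t, shape t = nu, splits n (rtab la) (rtab mu) t
              & outer n (fill t) = S].
Proof.
move=> lanu [sytS rS]; have sk := SYT_skewf lanu sytS.
pose T := gluetab la nu (rowtab la) S.
have TE i j : T i j = if j < part la i then rowtab la i j else
                      if j < part nu i then S i j + n else 0.
  rewrite /T /gluetab !boxesE /part nth_nil /=; case: (ltnP j) => //=.
have Spos i j : (0 < S i j) = (part la i <= j < part nu i).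
  by rewrite (sk_supp sk) /nohole andbT.
have sl := rtab_stdtab (valP la).
have := tab_straight (stdtab_tab sl) (stdtab_n0 sl); rewrite fill_rtab => srow.
have laD i : part la i.+1 <= part la i := is_part_part (valP la) i.
have nuD i : part nu i.+1 <= part nu i := is_part_part (valP nu) i.
have Tpos i j : (0 < T i j) = (j < part nu i).
  rewrite TE; have [h|h] := ltnP j (part la i).
    by rewrite rowtab_pos h; apply/esym; apply: leq_trans h (lanu i).
  case: ifP => // h'; have : 0 < S i j by rewrite Spos h h'.
  lia.
have sT : straight (part nu) nohole T.
  split=> //.
  - by move=> i j; rewrite Tpos /nohole andbT.
  - move=> i j j' jj'; rewrite !Tpos => h h'; rewrite !TE h h'.
    have [a|a] := ltnP j (part la i); have [a'|a'] := ltnP j' (part la i).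
    + by apply: (sk_row srow) => //; rewrite rowtab_pos.
    + apply: (@leq_ltn_trans n); first exact: rowtab_le.
      by have : 0 < S i j' by [rewrite Spos a' h']; lia.
    + by lia.
    + by rewrite ltn_add2r; apply: (sk_row sk) => //; rewrite Spos ?a ?a'.
  - move=> i i' j ii'; rewrite !Tpos => h h'; rewrite !TE h h'.
    have [a|a] := ltnP j (part la i); have [a'|a'] := ltnP j (part la i').
    + by apply: (sk_col srow) => //; rewrite rowtab_pos.
    + apply: (@leq_ltn_trans n); first exact: rowtab_le.
      by have : 0 < S i' j by [rewrite Spos a' h']; lia.
    + by have := nonincr_leq laD (ltnW ii'); lia.
    + by rewrite ltn_add2r; apply: (sk_col sk) => //; rewrite Spos ?a ?a'.
have Nb := bnd_nth nu; set N := (_ + _) in Nb.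
have [t [Tt et zt sht /(_ N Nb) rt]] := straightP sT Nb.
have eo : outer n T = S.
  apply/funext => i; apply/funext => j; rewrite /outer TE.
  have S0 : ~~ (0 < S i j) -> S i j = 0 by rewrite -leqNgt leqn0 => /eqP.
  have [a|a] := ltnP j (part la i).
    rewrite S0; last by rewrite Spos leqNgt a.
    by apply/eqP; rewrite subn_eq0; apply: rowtab_le.
  case: ifP => a'; first by rewrite addnK.
  by rewrite S0 // Spos a a'.
have ei : inner n T = rowtab la.
  apply/funext => i; apply/funext => j; rewrite /inner TE.
  have [a|a] := ltnP j (part la i); first by rewrite rowtab_le.
  have r0 : rowtab la i j = 0 by rewrite /rowtab ltnNge a.
  rewrite r0; have [a'|a'] := ltnP j (part nu i); last by [].
  have : 0 < S i j by rewrite Spos a a'.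
  by case: ifP => //; lia.
have eh : hi n (rdw t) = fread N S by rewrite rt -fread_outer eo.
have el : lo n (rdw t) = fread N (rowtab la) by rewrite rt -fread_inner ei.
have rl_ : lo n (rdw t) = rdw (rtab la).
  have [t1 [T1 z1 e1 <-]] := tab_inner n Tt zt.
  congr rdw; apply: fill_inj; rewrite ?(stdtab_tab sl) ?(stdtab_n0 sl) //.
  by rewrite e1 et ei fill_rtab.
have [m' [sU Nm' K]] := rect_knuth rS sk Nb.
have sm := rtab_stdtab (valP mu).
have rU : fread N (rowtab mu) = rdw (rtab mu).
  have [tU [TU eU zU _ /(_ N Nm') <-]] := straightP sU Nm'.
  congr rdw; apply: fill_inj; rewrite ?(stdtab_tab sm) ?(stdtab_n0 sm) //.
  by rewrite eU fill_rtab.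
rewrite rU in K; have pS := perm_trans (knuth_perm K) (stdtab_rdw sm).
have pt : perm_eq (rdw t) (iota 1 (n + m)).
  have p1 : perm_eq (rdw t) (lo n (rdw t) ++ [seq x <- rdw t | ~~ (x <= n)]).
    by rewrite perm_sym perm_filterC.
  apply: (perm_trans p1); rewrite iotaD; apply: perm_cat.
    by rewrite rl_; apply: stdtab_rdw.
  have -> : [seq x <- rdw t | ~~ (x <= n)] = [seq n + x | x <- hi n (rdw t)].
    rewrite /hi -map_comp -[LHS]map_id.
    have -> : [seq x <- rdw t | n < x] = [seq x <- rdw t | ~~ (x <= n)].
      by apply: eq_filter => x; rewrite ltnNge.
    by apply/eq_in_map => x; rewrite mem_filter -ltnNge /= => /andP[h _];
      rewrite subnKC // ltnW.
  by rewrite eh addnC iotaDl; apply: perm_map.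
exists t; split.
- by rewrite /stdtab Tt /=; apply: perm_trans pt; rewrite perm_sym rdw_perm.
- apply: eq_from_nth0 => //; first exact: tab_shape_neq0.
  by case/andP: (valP nu).
- rewrite /splits rl_ eh Pword_rdw ?(stdtab_tab sl) // eqxx /=.
  rewrite (Pword_knuth K) ?Pword_rdw ?(stdtab_tab sm) //.
  by rewrite (perm_uniq pS) iota_uniq.
- by rewrite et.
Qed.

End Split.

Section Rule.
Local Open Scope ring_scope.
Variables la mu : intpart.
Let n := sumn la.
Let m := sumn mu.

(** The standard tableaux that index the terms of the product, for all shapes
    at once. *)
Definition LRtabs := [seq t <- alltabs (n + m) | splits n (rtab la) (rtab mu) t].

Lemma mem_LRtabs t : t \in LRtabs -> [/\ stdtab (n + m) t,
   inner n (fill t) = rowtab la & Pword (hi n (rdw t)) = rtab mu].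
Proof.
rewrite mem_filter mem_alltabs => /andP[h st].
by have [] := splits_inner st h.
Qed.

Lemma oddLR_tabs nu : oddLR la mu nu = \sum_(t <- LRtabs | shape t == nu) (-1) ^+ tinv t.
Proof.
rewrite /oddLR; case: ifPn => /asboolP lanu; last first.
  rewrite big_seq_cond big1 // => t /andP[/mem_LRtabs[st inn _] /eqP e].
  by case: lanu; apply: included_fill st e inn.
pose s := [seq outer n (fill t) | t <- LRtabs & shape t == nu].
have -> : LRtableaux la mu nu = [set` s]%classic.
  apply/seteqP; split=> S /=.
    move=> /(LR_tableau lanu)[t [st sh sp eo]].
    by apply/mapP; exists t; rewrite ?eo // !mem_filter mem_alltabs sh eqxx sp.
  case/mapP=> t; rewrite mem_filter => /andP[/eqP sh /mem_LRtabs[st inn hh]] ->.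
  exact: outer_LR.
rewrite -fsbig_seq; last first.
  rewrite map_inj_in_uniq ?filter_uniq ?undup_uniq // => t t'.
  rewrite !(mem_filter _ _ LRtabs) => /andP[/eqP sh /mem_LRtabs[st inn _]].
  move=> /andP[/eqP sh' /mem_LRtabs[st' inn' _]] e.
  apply: fill_inj; rewrite ?(stdtab_tab st) ?(stdtab_tab st') ?(stdtab_n0 st)
    ?(stdtab_n0 st') //.
  by rewrite -(glue_outer st sh inn) -(glue_outer st' sh' inn') -/n e.
rewrite big_map big_filter big_seq_cond [RHS]big_seq_cond.
apply: eq_bigr => t /andP[/mem_LRtabs[st inn _] /eqP sh].
by rewrite (glue_outer st sh inn) -sh tabinv_fill.
Qed.

Variable k : comPzRingType.

Lemma oddschurM_LR : oddschur k la * oddschur k mu =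
  \sum_(nu \in [set: intpart]%classic) oddschur k nu *~ oddLR la mu nu.
Proof.
(* the shapes that occur *)
pose SH : seq intpart := undup (pmap insub [seq shape t | t <- LRtabs]).
have shP t : t \in LRtabs -> exists2 nu : intpart, shape t = nu & nu \in SH.
  move=> tL; have [st _ _] := mem_LRtabs tL; have [p _] := shape_is_part st.
  exists (IntPart p) => //; rewrite mem_undup mem_pmap; apply/mapP.
  exists (shape t); first exact: map_f.
  by rewrite insubT.
have s1 : ([set` SH] `<=` [set: intpart])%classic by [].
have s2 : ([set: intpart] `\` [set` SH] `<=`
  (fun nu => (oddschur k nu *~ oddLR la mu nu : oddser k)) @^-1` [set 0])%classic.
  move=> nu [_ /= nuSH]; rewrite oddLR_tabs big_seq_cond big1 ?mulr0z // => t.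
  case/andP=> /shP[nu' -> nu'SH] /eqP e; case: nuSH.
  by have -> : nu = nu' by apply/val_inj.
rewrite -(fsbig_widen _ _ _ s1 s2) -fsbig_seq ?undup_uniq //.
under eq_bigr do rewrite oddLR_tabs mulrz_sumr.
rewrite (exchange_big_dep xpredT) //= oddschurM -/n -/m -[LHS]big_filter -/LRtabs.
rewrite big_seq [RHS]big_seq; apply: eq_bigr => t tL.
have [st _ _] := mem_LRtabs tL.
have [nu sh nuSH] := shP t tL.
have [_ sn] := shape_is_part st.
rewrite big_mkcond (bigD1_seq nu) ?undup_uniq //= sh eqxx big1 ?addr0; last first.
  move=> nu' /eqP ne; case: eqP => // e; case: ne; exact/val_inj.
by rewrite oddschurE -sn sh -mulrzl rmorph_sign.
Qed.
End Rule.

(** * Horizontal strips and generation by complete functions *)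

(** None of the words in an elementary relation is increasing. *)
Lemma knuth_row u v : knuth u v -> isrow u || isrow v -> u = v.
Proof.
have nrow p s a b c : (isrow (p ++ [:: a, b, c & s])) -> (a < b) && (b < c).
  by rewrite pairwise_cat /= => /and3P[_ _ /andP[/andP[-> _] /andP[/andP[-> _]]]].
elim=> {u v} [//|u v _ IH|v u w _ IH1 _ IH2|p s x y z xy yz|p s x y z xy yz].
- by rewrite orbC => /IH.
- case/orP => h; first by rewrite -IH2 -IH1 ?h.
  by rewrite IH1 IH2 ?h ?orbT.
- by case/orP => /nrow; lia.
- by case/orP => /nrow; lia.
Qed.

Lemma Pword_row u r : uniq u -> isrow r -> Pword u = [:: r] -> u = r.
Proof.
move=> U rr e; have := knuth_Pword U; rewrite e /rdw /= cats0 => K.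
by apply: knuth_row K _; rewrite rr orbT.
Qed.

Lemma mem_rdw t i x : x \in nth [::] t i -> x \in rdw t.
Proof.
move=> xi; rewrite (perm_mem (rdw_perm t)); apply/flattenP; exists (nth [::] t i) => //.
by apply: mem_nth; rewrite ltnNge; apply/negP => h; rewrite nth_default in xi.
Qed.

(** Lower rows are read first. *)
Lemma hi_row_strip n t i i' x y : isrow (hi n (rdw t)) -> i < i' ->
  x \in nth [::] t i -> y \in nth [::] t i' -> n < x -> n < y -> y < x.
Proof.
elim: t i i' => [|r t IH] i i'; first by rewrite nth_nil.
rewrite rdw_cons /hi filter_cat map_cat pairwise_cat => /and3P[/allrelP D Rt _].
case: i' => // i'; case: i => [|i] /=; last by rewrite ltnS; apply: IH.
move=> _ xr /mem_rdw yt nx ny.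
have : y - n < x - n by apply: D; apply: map_f; rewrite mem_filter ?nx ?ny.
lia.
Qed.

Lemma rtab_from_rcons s sh p :
  rtab_from s (rcons sh p) = rcons (rtab_from s sh) (iota (s + sumn sh) p).
Proof.
elim: sh s => [|m sh IH] s /=; first by rewrite addn0.
by rewrite IH addnA.
Qed.

Lemma strict_lower (f : nat -> nat) n p : (forall j, j.+1 < p -> f j < f j.+1) ->
  n < f 0 -> forall j, j < p -> n + j < f j.
Proof.
move=> fS f0; elim=> [|j IH] jp; first by rewrite addn0.
by have := IH (ltnW jp); have := fS j jp; lia.
Qed.

Section Pieri.
Variables (la mu : intpart) (p : nat).
Let n := sumn la.
Hypotheses (p0 : 0 < p) (emu : mu = [:: p] :> seq nat) (sh_part : is_part (rcons la p)).

Lemma rtab_LRtabs : rtab (rcons la p) \in LRtabs la mu.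
Proof.
have st := rtab_stdtab sh_part; rewrite sumn_rcons in st.
rewrite mem_filter mem_alltabs emu /= addn0 st andbT.
have sl : stdtab (sumn la) (rtab la) := rtab_stdtab (valP la).
rewrite /splits /rtab rtab_from_rcons /rdw rev_rcons /= -/(rdw _) /lo /hi !filter_cat.
have e1 : [seq x <- iota (1 + sumn la) p | x <= sumn la] = [::].
  apply/eqP; rewrite -size_eq0 size_filter -leqn0 leqNgt -has_count -all_predC.
  by apply/allP => x; rewrite mem_iota /=; lia.
have e2 : [seq x <- rdw (rtab_from 1 la) | x <= sumn la] = rdw (rtab_from 1 la).
  by apply/all_filterP/allP => x; rewrite (perm_mem (stdtab_rdw sl)) mem_iota; lia.
have e3 : [seq x <- iota (1 + sumn la) p | sumn la < x] = iota (1 + sumn la) p.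
  by apply/all_filterP/allP => x; rewrite mem_iota; lia.
have e4 : [seq x <- rdw (rtab_from 1 la) | sumn la < x] = [::].
  apply/eqP; rewrite -size_eq0 size_filter -leqn0 leqNgt -has_count -all_predC.
  by apply/allP => x; rewrite (perm_mem (stdtab_rdw sl)) mem_iota /=; lia.
rewrite e1 e2 e3 e4 cats0 /= Pword_rdw ?(stdtab_tab sl) // eqxx /=.
have -> : [seq x - sumn la | x <- iota (1 + sumn la) p] = rdw (rtab mu).
  rewrite emu /rdw /= cats0 addnC iotaDl -map_comp -[RHS]map_id.
  by apply: eq_map => x /=; rewrite addKn.
have sm := rtab_stdtab (valP mu).
by rewrite Pword_rdw ?(stdtab_tab sm) // emu.
Qed.

(** If the entries above [n] rectify to one row, they increase along the reading
    word, hence from each row to the rows above.  So no two of them are in the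
    same column, and there is at most one row below [la].  If this row has
    length [p], its last entry is at least [n + p], the largest entry, and no
    entry above [n] is left for the rows of [la]. *)
Lemma LRtabs_strip t : t \in LRtabs la mu ->
  t = rtab (rcons la p) \/
  size (shape t) <= size la \/
  size (shape t) = (size la).+1 /\ last 0 (shape t) < p.
Proof.
move=> /mem_LRtabs[]; rewrite emu /= addn0 => st inn hh.
have T := stdtab_tab st; have z := stdtab_n0 st; have sT := tab_straight T z.
have U := stdtab_uniq st.
have rh : isrow (hi n (rdw t)).
  have Uh : uniq (hi n (rdw t)) by apply: hi_uniq; rewrite (perm_uniq (rdw_perm t)).
  have ri : isrow (iota 1 p) by rewrite -(sorted_pairwise ltn_trans) iota_ltn_sorted.
  by rewrite (Pword_row Uh ri hh).
have memT i j : 0 < fill t i j -> fill t i j \in nth [::] t i.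
  by rewrite fill_supp // nth_shape => h; apply: mem_nth.
have le i j : fill t i j <= n + p.
  have [->//|h] := posnP (fill t i j).
  have : fill t i j \in rdw t by apply: (@mem_rdw _ i); apply: memT.
  by rewrite (perm_mem (stdtab_rdw st)) mem_iota; lia.
have strip i i' j j' : i < i' -> n < fill t i j -> n < fill t i' j' ->
    fill t i' j' < fill t i j.
  by move=> ii' h h'; apply: (hi_row_strip rh ii') => //; apply: memT;
    apply: leq_ltn_trans (leq0n n) _.
have new i j : size la <= i -> 0 < fill t i j -> n < fill t i j.
  move=> lai h; rewrite ltnNge; apply/negP => h'.
  have := congr1 (fun f => f i j) inn; rewrite /inner -/n h' => e.
  by move: h; rewrite e rowtab_pos /part nth_default.
set r := size la in new *.
have szt : size t <= r.+1.
  rewrite leqNgt; apply/negP => h.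
  have pos i : i < size t -> 0 < fill t i 0.
    by move=> it; rewrite fill_supp // -[nth _ _ _]/(part _ _) part_size
      ?tab_shape_neq0 // size_map.
  have h1 := pos _ h; have h2 := pos _ (ltnW h).
  have := strip r r.+1 0 0 (ltnSn r) (new _ _ (leqnn r) h2) (new _ _ (leqnSn r) h1).
  have := sk_col sT (ltnSn r) h2 h1; lia.
rewrite size_map; move: szt; rewrite leq_eqVlt ltnS => /orP[/eqP szt|]; last by right; left.
have low j : j < nth 0 (shape t) r -> n + j < fill t r j.
  move: j; apply: strict_lower => [j jr|].
    by apply: (sk_row sT) => //; rewrite fill_supp // ltnW.
  apply: new => //; rewrite fill_supp // -[nth _ _ _]/(part _ _) part_size
    ?tab_shape_neq0 //.
  by rewrite size_map szt.
have lastE : last 0 (shape t) = nth 0 (shape t) r by rewrite -nth_last size_map szt.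
have lep : nth 0 (shape t) r <= p.
  rewrite leqNgt; apply/negP => h; have := low _ h; have := le r p; lia.
rewrite lastE; move: lep; rewrite leq_eqVlt => /orP[/eqP ep|]; last by right; right.
left; have s2 := rtab_stdtab sh_part.
apply: fill_inj; rewrite ?(stdtab_tab s2) ?(stdtab_n0 s2) // fill_rtab.
have lowp : n + p.-1 < fill t r p.-1 by apply: low; rewrite ep prednK.
apply/funext => i; apply/funext => j.
have [ir|ri|->] := ltngtP i r.
- have h : fill t i j <= n.
    rewrite leqNgt; apply/negP => h.
    by have := strip i r j p.-1 ir h (leq_ltn_trans (leq_addr _ _) lowp);
      have := le i j; lia.
  have := congr1 (fun f => f i j) inn; rewrite /inner -/n h => ->.
  by rewrite /rowtab /part nth_rcons ir -cats1 takel_cat // ltnW.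
- have -> : fill t i j = 0 by rewrite /fill [nth [::] t i]nth_default ?nth_nil // szt.
  by rewrite /rowtab /part nth_default // size_rcons.
rewrite /rowtab /part nth_rcons ltnn eqxx -cats1 take_size_cat //.
have [jp|pj] := ltnP j p; last first.
  apply/eqP; rewrite -leqn0 leqNgt fill_supp // ep; lia.
(* the [p] entries of the new row are squeezed between [n] and [n + p] *)
have up d : d < p -> fill t r (p.-1 - d) + d <= n + p.
  elim: d => [|d IH] dp; first by rewrite addn0.
  have := IH (ltnW dp); set a := p.-1 - d.
  have -> : p.-1 - d.+1 = a.-1 by lia.
  have : fill t r a.-1 < fill t r a.
    by apply: (sk_row sT); rewrite ?fill_supp // ?ep; lia.
  lia.
have := low j; rewrite ep => /(_ jp); have := up (p.-1 - j).
have -> : p.-1 - (p.-1 - j) = j by lia.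
move=> /(_ ltac:(lia)); rewrite -/n; lia.
Qed.

End Pieri.

Section Generation.
Local Open Scope ring_scope.
Variable k : comPzRingType.

Lemma vsig_nil : vsig k 0 [::] = 1.
Proof.
rewrite /vsig (_ : permutations (iota 1 0) = [:: [::]]) // big_mkcond big_seq1 /=.
rewrite mul1r fundamentalFE.
rewrite -[RHS](rmorph1 (@oddpi k)); congr oddpi; apply/funext => v.
rewrite -[RHS]/((v == [::])%:R) /Fser /compat andbT /=.
by case: v => //= x v; rewrite andbF.
Qed.

Lemma vsig_row p : (0 < p)%N -> vsig k p (rtab [:: p]) = completeh k p.
Proof.
move=> p0; rewrite completehE -fundamentalFE /vsig.
have ri : isrow (iota 1 p) by rewrite -(sorted_pairwise ltn_trans) iota_ltn_sorted.
have T : tab (rtab [:: p]).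
  by apply: rtab_tab; rewrite /is_part /= inE eq_sym -lt0n p0.
have Pi : Pword (iota 1 p) = rtab [:: p].
  by have := Pword_rdw T; rewrite /rdw /= cats0.
rewrite big_mkcond (bigD1_seq (iota 1 p)) ?permutations_uniq ?mem_permutations //=.
rewrite Pi eqxx inv_row // mul1r big_seq_cond big1 ?addr0 // => w /andP[].
rewrite mem_permutations => wp wi; case: eqP => // e; case/eqP: wi.
by apply: (Pword_row _ ri e); rewrite (perm_uniq wp) iota_uniq.
Qed.

(** Induction on the number of rows, then on the last row: by [oddschurM] and
    [LRtabs_strip], the product of [s_la] and [h_p] is the sum of
    [s_(la, p)] and of terms known to be in [B]. *)
Lemma vsig_OSym (B : {pred oddser k}) :
  [/\ 1 \in B, GRing.linear_closed B & GRing.mulr_2closed B] ->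
  (forall n, (0 < n)%N -> completeh k n \in B) ->
  forall sh, is_part sh -> vsig k (sumn sh) (rtab sh) \in B.
Proof.
move=> [B1 Blin Bmul] Bh.
have B0 : 0 \in B.
  by have := Blin (-1) _ _ B1 B1; rewrite scaleN1r addNr.
have BD x y : x \in B -> y \in B -> x + y \in B.
  by move=> xB yB; have := Blin 1 _ _ xB yB; rewrite scale1r.
have BN x : x \in B -> - x \in B.
  by move=> xB; have := Blin (-1) _ _ xB B0; rewrite scaleN1r addr0.
have Bs m x : x \in B -> (-1) ^+ m * x \in B.
  by move=> xB; rewrite -signr_odd mulr_sign; case: odd => //; apply: BN.
have Bsum (I : eqType) (s : seq I) (P : pred I) (F : I -> oddser k) :
    (forall i, i \in s -> P i -> F i \in B) -> \sum_(i <- s | P i) F i \in B.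
  move=> h; rewrite big_seq_cond; elim/big_ind: _ => // i /andP[is_ Pi]; exact: h.
move=> sh; have [r] := ubnP (size sh); elim: r sh => // r IHr sh sr.
have [q] := ubnP (last 0%N sh); elim: q sh sr => // q IHq sh sr lq psh.
case/lastP: sh sr lq psh => [|la p] sr lq psh; first by rewrite vsig_nil.
have pla : is_part la.
  have /andP[s0 s1] := psh; rewrite /is_part (subseq_sorted _ (subseq_rcons la p) s0).
    by move: s1; rewrite mem_rcons inE negb_or => /andP[].
  by move=> x y z /= h1 h2; apply: leq_trans h1.
have p0 : (0 < p)%N.
  by case/andP: psh => _; rewrite mem_rcons inE negb_or eq_sym -lt0n => /andP[].
have pmu : is_part [:: p] by rewrite /is_part /= inE eq_sym -lt0n p0.
pose la' := IntPart pla; pose mu := IntPart pmu.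
rewrite last_rcons ltnS in lq; rewrite size_rcons ltnS in sr.
have tL : rtab (rcons la p) \in LRtabs la' mu by apply: rtab_LRtabs.
have := oddschurM k la' mu; rewrite -big_filter -/(LRtabs la' mu).
rewrite (bigD1_seq (rtab (rcons la p))) ?filter_uniq ?undup_uniq //=.
rewrite /rtab tinv_rtab mul1r shape_rtab -/rtab => e.
rewrite sumn_rcons -[p in (_ + p)%N]addn0.
have -> : vsig k (sumn la + (p + 0))%N (rtab (rcons la p)) =
   oddschur k la' * oddschur k mu - \sum_(i <- LRtabs la' mu | i != rtab (rcons la p))
      (-1) ^+ tinv i * vsig k (sumn la + (p + 0)) (rtab (shape i)).
  by rewrite e addrK.
apply: BD; last apply: BN.
  rewrite !oddschurE /= addn0; apply: Bmul; first exact: IHr.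
  by rewrite vsig_row //; apply: Bh.
apply: Bsum => t tLR tne; apply: Bs.
have [st _ _] := mem_LRtabs tLR; have [pt st'] := shape_is_part st.
rewrite /= in st'; rewrite -st'.
have [et|[h|[h1 h2]]] := @LRtabs_strip la' mu p p0 erefl psh t tLR.
- by rewrite et eqxx in tne.
- apply: IHr => //; exact: leq_ltn_trans h sr.
- apply: IHq => //; first by rewrite h1.
  exact: leq_trans h2 lq.
Qed.

Lemma oddschur_OSym (la : intpart) : OSym (oddschur k la).
Proof.
move=> B Bc Bh; rewrite oddschurE; apply: (vsig_OSym Bc Bh).
exact: (valP la).
Qed.

End Generation.

Local Open Scope ring_scope.

Theorem mainTheorem5 (k : comPzRingType) (la mu : intpart) :
  [/\ OSym (oddschur k la), OSym (oddschur k mu) &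
      oddschur k la * oddschur k mu
      = \sum_(nu \in [set: intpart]%classic) oddschur k nu *~ oddLR la mu nu].
Proof.
by split; [apply: oddschur_OSym|apply: oddschur_OSym|apply: oddschurM_LR].
Qed.
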